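(* Let $\mathbb{F}_N$ be a free group of finite or countably infinite rank $N\ge 1$ and let $(X,\mu)$ be a standard probability space. Then the set of weak equivalence classes containing a free ergodic action is dense in $\mathrm{FR}_\sim(\mathbb{F}_N,X,\mu)$.
   Context: A probability space is a standard Borel space with a Borel probability measure (atoms allowed); it is a standard probability space if the measure is nonatomic. For a countable discrete group $\Gamma$, a measure-preserving action $\Gamma\curvearrowright^a(Y,\nu)$ is a Borel action preserving $\nu$, two actions being identified if they agree almost everywhere; $\gamma^a$ denotes the transformation given by $\gamma\in\Gamma$. $\mathrm{A}(\Gamma,X,\mu)$ is the set of measure-preserving actions of $\Gamma$ on $(X,\mu)$. An action is free if almost every point has trivial stabilizer. Weak containment: for measure-preserving actions $a$ on $(X,\mu)$ and $b$ on $(Y,\nu)$, $a\prec b$ if for all measurable $A_1,\dots,A_n\subseteq X$, finite $F\subseteq\Gamma$ and $\epsilon>0$ there are measurable $B_1,\dots,B_n\subseteq Y$ with $|\mu(\gamma^aA_i\cap A_j)-\nu(\gamma^bB_i\cap B_j)|<\epsilon$ for all $\gamma\in F$, $i,j\le n$. Weak equivalence $a\sim b$ means $a\prec b$ and $b\prec a$. $\mathrm{A}_\sim(\Gamma,X,\mu)$ is the quotient of $\mathrm{A}(\Gamma,X,\mu)$ by $\sim$. Topology: fix an enumeration $(\gamma_i)_{i\ge1}$ of $\Gamma$ (with repetitions if $\Gamma$ is finite). For $a\in \mathrm{A}(\Gamma,X,\mu)$ and a measurable partition $\mathcal A=\{A_1,\dots,A_k\}$ of $X$ into $k$ pieces let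 $M^{\mathcal A}_{n,k}(a)\in[0,1]^{n\times k\times k}$ have $(p,q,r)$ coordinate $\mu(\gamma_p^aA_q\cap A_r)$, let $C_{n,k}(a)$ be the closure of the set of all $M^{\mathcal A}_{n,k}(a)$ over such $\mathcal A$, and let $d(a,b)=\sum_{n,k=1}^\infty 2^{-(n+k)}d_H(C_{n,k}(a),C_{n,k}(b))$, where $d_H$ is the Hausdorff distance (from the supremum metric on $[0,1]^{n\times k\times k}$). Then $d(a,b)=0$ iff $a\sim b$, so $d$ induces a metric on $\mathrm{A}_\sim(\Gamma,X,\mu)$, which carries the resulting topology. $\mathrm{FR}_\sim(\Gamma,X,\mu)\subseteq\mathrm{A}_\sim(\Gamma,X,\mu)$ is the subspace of weak equivalence classes of free actions. *)

(* Defs.v *)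
From HB Require Import structures.
From mathcomp Require Import all_boot all_order all_algebra.
From mathcomp Require Import all_classical all_reals all_analysis.

Set Implicit Arguments.
Unset Strict Implicit.
Unset Printing Implicit Defensive.

Import Order.TTheory GRing.Theory Num.Theory.
Import numFieldNormedType.Exports.

Local Open Scope classical_set_scope.
Local Open Scope ring_scope.
Local Open Scope quotient_scope.

Definition free_basis (I : Type) (G : groupType) (x : I -> G) : Prop :=
  forall (H : groupType) (f : I -> H),
    exists! phi : G -> H,
      {morph phi : y z / (y * z)%g} /\ forall i, phi (x i) = f i.

(* Repetitions are allowed only when the group is finite. *)
Definition enumeration (G : Type) (g : nat -> G) : Prop :=
  (forall y, exists i, g i = y) /\ (infinite_set [set: G] -> injective g).

(* Borel isomorphic to a Polish space; a Hausdorff pseudometric space is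
   metrizable, and it is separable iff it is second countable. *)
Definition standard_borel (R : realType) d (X : measurableType d) : Prop :=
  exists (P : completePseudoMetricType R) (f : X -> P),
    [/\ hausdorff_space P, @second_countable P, bijective f &
        forall A : set X, measurable A <->
          exists2 B : set P, <<s open >> B & A = f @^-1` B].

Section ProbabilityConditions.
Context {R : realType} {d} {X : measurableType d} (mu : probability X R).

Definition nonatomic : Prop :=
  forall A : set X, measurable A -> (0 < mu A)%E ->
    exists B : set X, [/\ measurable B, B `<=` A, (0 < mu B)%E & (mu B < mu A)%E].

Definition standard_probability : Prop := standard_borel R X /\ nonatomic.

End ProbabilityConditions.

(* Actions are not quotiented by almost everywhere equality at this stage:
   weak equivalence, by which they are quotiented below, is coarser. *)
Record mp_action (G : groupType) (R : realType) d (X : measurableType d)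
    (mu : probability X R) := MpAction {
  act :> G -> X -> X ;
  act1 : forall x, act 1%g x = x ;
  actM : forall g h x, act (g * h)%g x = act g (act h x) ;
  measurable_act : forall g, measurable_fun setT (act g) ;
  act_preserving : forall g (A : set X), measurable A ->
    mu (act g @^-1` A) = mu A
}.

HB.instance Definition _ (G : groupType) (R : realType) d
  (X : measurableType d) (mu : probability X R) :=
  gen_eqMixin (mp_action G mu).
HB.instance Definition _ (G : groupType) (R : realType) d
  (X : measurableType d) (mu : probability X R) :=
  gen_choiceMixin (mp_action G mu).

Section ActionProperties.
Context {G : groupType} {R : realType} {d} {X : measurableType d}
  {mu : probability X R}.

Definition free_action (a : mp_action G mu) : Prop :=
  {ae mu, forall x, forall g, a g x = x -> g = 1%g}.

Definition ergodic_action (a : mp_action G mu) : Prop :=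
  forall A : set X, measurable A -> (forall g, a g @` A = A) ->
    mu A = 0%E \/ mu A = 1%E.

End ActionProperties.

Lemma act_image (G : groupType) (R : realType) d (X : measurableType d)
  (mu : probability X R) (a : mp_action G mu) g (A : set X) :
  a g @` A = a g^-1%g @^-1` A.
Proof.
apply/seteqP; split => [_ [x Ax <-]|x Ax] /=.
  by rewrite -actM mulVg act1.
by exists (a g^-1%g x) => //; rewrite -actM mulgV act1.
Qed.

Lemma measurable_act_image (G : groupType) (R : realType) d
  (X : measurableType d) (mu : probability X R) (a : mp_action G mu) g
  (A : set X) : measurable A -> measurable (a g @` A).
Proof.
move=> mA; rewrite act_image -[X in measurable X]setTI.
exact: measurable_act.
Qed.

Definition weakly_contained (G : groupType) (R : realType) d d'
    (X : measurableType d) (Y : measurableType d')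
    (mu : probability X R) (nu : probability Y R)
    (a : mp_action G mu) (b : mp_action G nu) : Prop :=
  forall (n : nat) (A : 'I_n -> set X) (F : seq G) (eps : R),
    (forall i, measurable (A i)) -> 0 < eps ->
    exists2 B : 'I_n -> set Y, (forall i, measurable (B i)) &
      forall g, g \in F -> forall i j,
        (`| mu ((a g @` A i) `&` A j) - nu ((b g @` B i) `&` B j) |
          < eps%:E)%E.

Definition weakly_equivalent (G : groupType) (R : realType) d d'
    (X : measurableType d) (Y : measurableType d')
    (mu : probability X R) (nu : probability Y R)
    (a : mp_action G mu) (b : mp_action G nu) : Prop :=
  weakly_contained a b /\ weakly_contained b a.

Lemma fin_num_overlap (G : groupType) (R : realType) d (X : measurableType d)
  (mu : probability X R) (a : mp_action G mu) g (A B : set X) :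
  measurable A -> measurable B -> mu ((a g @` A) `&` B) \is a fin_num.
Proof.
move=> mA mB; apply: fin_num_measure.
by apply: measurableI => //; exact: measurable_act_image.
Qed.

Section WeakEquivalenceRelation.
Context (G : groupType) {R : realType} {d} {X : measurableType d}
  (mu : probability X R).
Implicit Types a b c : mp_action G mu.

Lemma weakly_contained_refl a : weakly_contained a a.
Proof.
move=> n A F eps mA eps0; exists A => // g _ i j.
by rewrite subee ?abse0 ?lte_fin//; exact: fin_num_overlap.
Qed.

Lemma weakly_contained_trans a b c :
  weakly_contained a b -> weakly_contained b c -> weakly_contained a c.
Proof.
move=> ab bc n A F eps mA eps0.
have eps20 : 0 < eps / 2 by rewrite divr_gt0.
have [B mB AB] := ab n A F _ mA eps20.
have [C mC BC] := bc n B F _ mB eps20.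
exists C => // g gF i j; rewrite [eps]splitr EFinD.
apply: le_lt_trans (lteD (AB g gF i j) (BC g gF i j)).
have fA := fin_num_overlap a g (mA i) (mA j).
have fB := fin_num_overlap b g (mB i) (mB j).
have fC := fin_num_overlap c g (mC i) (mC j).
rewrite -(fineK fA) -(fineK fB) -(fineK fC) -!EFinB !abse_EFin -EFinD lee_fin.
exact: ler_distD.
Qed.

Definition weq : rel (mp_action G mu) :=
  fun a b => `[< weakly_equivalent a b >].

Lemma weq_refl : reflexive weq.
Proof. by move=> a; apply/asboolP; split; exact: weakly_contained_refl. Qed.

Lemma weq_sym : symmetric weq.
Proof.
by move=> a b; apply/asboolP/asboolP => -[? ?]; split.
Qed.

Lemma weq_trans : transitive weq.
Proof.
move=> b a c /asboolP[ab ba] /asboolP[bc cb]; apply/asboolP; split.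
  exact: weakly_contained_trans bc.
exact: weakly_contained_trans ba.
Qed.

Canonical weq_equiv := EquivRel weq weq_refl weq_sym weq_trans.

End WeakEquivalenceRelation.

Section HausdorffDistance.
Context {R : realType} {T : pseudoMetricType R}.
Implicit Types A B C : set T.

(* The infimum is taken in the extended reals, so that no boundedness or
   nonemptiness hypothesis is needed for it to be meaningful. *)
Definition hausdorff_dist A B : \bar R :=
  ereal_inf [set e%:E | e in [set e : R | [/\ 0 < e,
    forall x, A x -> exists2 y, B y & ball x e y &
    forall y, B y -> exists2 x, A x & ball y e x]]].

Lemma hausdorff_dist_ge0 A B : (0 <= hausdorff_dist A B)%E.
Proof. by apply: le_ereal_inf_tmp => _ [e [e0 _ _] <-]; rewrite lee_fin ltW. Qed.

Lemma hausdorff_distxx A : hausdorff_dist A A = 0%E.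
Proof.
apply/eqP; rewrite eq_le hausdorff_dist_ge0 andbT.
apply/lee_addgt0Pr => e e0; rewrite add0e; apply: ereal_inf_lbound.
by exists e => //; split=> // x Ax; exists x => //; exact: ballxx.
Qed.

Lemma hausdorff_dist_sym A B : hausdorff_dist A B = hausdorff_dist B A.
Proof.
by congr (ereal_inf (image _ _)); apply/seteqP; split => e [].
Qed.

Lemma hausdorff_dist_triangle B A C :
  (hausdorff_dist A C <= hausdorff_dist A B + hausdorff_dist B C)%E.
Proof.
have [AB|ABoo] := boolP (hausdorff_dist A B \is a fin_num); last first.
  have -> : hausdorff_dist A B = +oo%E.
    by move: ABoo (hausdorff_dist_ge0 A B); case: (hausdorff_dist A B).
  rewrite addye ?leey// gt_eqF//.
  exact: lt_le_trans (ltNyr 0) (hausdorff_dist_ge0 _ _).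
have [BC|BCoo] := boolP (hausdorff_dist B C \is a fin_num); last first.
  have -> : hausdorff_dist B C = +oo%E.
    by move: BCoo (hausdorff_dist_ge0 B C); case: (hausdorff_dist B C).
  rewrite addey ?leey// gt_eqF//.
  exact: lt_le_trans (ltNyr 0) (hausdorff_dist_ge0 _ _).
apply/lee_addgt0Pr => e e0.
have e20 : 0 < e / 2 by rewrite divr_gt0.
have [_ [r [r0 ABr BAr] <-] rlt] := lb_ereal_inf_adherent e20 AB.
have [_ [s [s0 BCs CBs] <-] slt] := lb_ereal_inf_adherent e20 BC.
rewrite [in leRHS](splitr e) EFinD addeACA.
apply: (@le_trans _ _ (r + s)%:E); last by rewrite EFinD leeD// ltW.
apply: ereal_inf_lbound; exists (r + s) => //; split; first exact: addr_gt0.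
  move=> x /ABr[y /BCs[z Cz yz] xy]; exists z => //.
  exact: ball_triangle xy yz.
move=> z /CBs[y /BAr[x Ax yx] zy]; exists x => //.
by rewrite addrC; exact: ball_triangle zy yx.
Qed.

End HausdorffDistance.

Section WeakDistance.
Context {G : groupType} {R : realType} {d} {X : measurableType d}
  {mu : probability X R} (g : nat -> G).
Implicit Types a b c : mp_action G mu.

Definition mpartition k (A : 'I_k -> set X) : Prop :=
  [/\ forall i, measurable (A i), trivIset setT A & \bigcup_i A i = setT].

(* [0,1]^(n x k x k) is rendered as n-tuples of k x k matrices, whose
   library pseudometric is that of the supremum metric. *)
Definition overlaps n k a (A : 'I_k -> set X) : 'rV['M[R]_k]_n :=
  \row_(p < n) \matrix_(q < k, r < k) fine (mu ((a (g p) @` A q) `&` A r)).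

Definition overlap_closure n k a : set 'rV['M[R]_k]_n :=
  closure [set overlaps n a A | A in @mpartition k].

(* The terms are nonnegative and bounded by 2^-(n+k), so this sum is finite. *)
Definition weak_dist a b : \bar R :=
  (\sum_(0 <= n <oo) \sum_(0 <= k <oo)
    ((2 ^- (n.+1 + k.+1))%:E *
      hausdorff_dist (overlap_closure (n := n.+1) (k := k.+1) a)
                     (overlap_closure (n := n.+1) (k := k.+1) b)))%E.

Let term_ge0 n k a b : (0 <= (2 ^- (n.+1 + k.+1))%:E *
  hausdorff_dist (overlap_closure (n := n.+1) (k := k.+1) a)
                 (overlap_closure (n := n.+1) (k := k.+1) b))%E.
Proof. by rewrite mule_ge0 ?hausdorff_dist_ge0// lee_fin invr_ge0 exprn_ge0. Qed.

Lemma weak_distxx a : weak_dist a a = 0%E.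
Proof.
apply: eseries0 => n _ _; apply: eseries0 => k _ _.
by rewrite hausdorff_distxx mule0.
Qed.

Lemma weak_dist_sym a b : weak_dist a b = weak_dist b a.
Proof.
apply: eq_eseriesr => n _; apply: eq_eseriesr => k _.
by rewrite hausdorff_dist_sym.
Qed.

Lemma weak_dist_triangle b a c :
  (weak_dist a c <= weak_dist a b + weak_dist b c)%E.
Proof.
rewrite -nneseriesD; [|by move=> *; apply: nneseries_ge0..].
apply: lee_nneseries => [n _ _|n _]; first by apply: nneseries_ge0.
rewrite -nneseriesD//; apply: lee_nneseries => // k _.
rewrite -ge0_muleDr ?hausdorff_dist_ge0//.
rewrite lee_pmul2l// ?lte_fin ?invr_gt0 ?exprn_gt0//.
exact: hausdorff_dist_triangle.
Qed.

End WeakDistance.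

(* The space of weak equivalence classes; the enumeration g is a parameter of
   the type because the metric depends on it. *)
Definition weak_space (G : groupType) (R : realType) d (X : measurableType d)
  (mu : probability X R) (g : nat -> G) : Type := {eq_quot (@weq G R d X mu)}.

Section WeakSpace.
Context {G : groupType} {R : realType} {d} {X : measurableType d}
  {mu : probability X R} (g : nat -> G).

Local Notation W := (weak_space mu g).

HB.instance Definition _ := Choice.on W.
HB.instance Definition _ := EqQuotient.on W.

(* The distance between two classes is that of any representatives, since
   weak_dist is a pseudometric vanishing on weakly equivalent actions. *)
Definition weak_ball (x : W) (e : R) : set W :=
  [set y | (weak_dist g (repr x) (repr y) < e%:E)%E].

Lemma weak_ball_center x e : 0 < e -> weak_ball x e x.
Proof. by move=> e0; rewrite /weak_ball/= weak_distxx lte_fin. Qed.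

Lemma weak_ball_sym x y e : weak_ball x e y -> weak_ball y e x.
Proof. by rewrite /weak_ball/= weak_dist_sym. Qed.

Lemma weak_ball_triangle x y z e1 e2 :
  weak_ball x e1 y -> weak_ball y e2 z -> weak_ball x (e1 + e2) z.
Proof.
rewrite /weak_ball/= EFinD => xy yz.
by rewrite (le_lt_trans (weak_dist_triangle g (repr y) _ _))// lteD.
Qed.

Let ent : set_system (W * W) := entourage_ weak_ball.

Let nbhsW (x : W) : set_system W := nbhs_ ent x.

Let nbhsWE : nbhsW = nbhs_ ent. Proof. by []. Qed.

HB.instance Definition _ := hasNbhs.Build W nbhsW.

Let entE : ent = entourage_ weak_ball. Proof. by []. Qed.

HB.instance Definition _ := @Nbhs_isPseudoMetric.Build R W
  ent nbhsWE weak_ball weak_ball_center weak_ball_sym weak_ball_triangle entE.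

Definition weak_class (a : mp_action G mu) : W := \pi_W a.

Definition free_classes : set W := [set weak_class a | a in free_action].

Definition free_ergodic_classes : set W :=
  [set weak_class a | a in [set a | free_action a /\ ergodic_action a]].

End WeakSpace.

Arguments weak_class {G R d X mu} g a.
Arguments free_classes {G R d X} mu g.
Arguments free_ergodic_classes {G R d X} mu g.

(* Main.v *)
From HB Require Import structures.
Require Import Defs.
From mathcomp Require Import all_boot all_order all_algebra.
From mathcomp Require Import all_classical all_reals all_analysis.
From mathcomp Require Import measurable_realfun ring lra zify.

(** Let [a] be a free action and [t] a generator of the free group. The action [a]
    is approximated by a free ergodic action [b] for which the generators other
    than [t] act as before, and [t] acts as before outside a set of small measure.
    Then, for the finitely many group elements that matter up to a given error, [b]
    agrees with [a] outside a set of small measure ([agreement_spreads]); so the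
    overlap matrices of the two actions are close for every partition, and so are
    the weak equivalence classes ([weak_dist_small]).

    To make [t] ergodic, choose a set [B] of measure at most [1/n] that almost
    every orbit of [t] meets infinitely often in both directions ([marker_set]).
    It cuts the space into columns: a column starts at a point [z] of [B] and
    follows the orbit of [z] under [t] up to the last point before the return to
    [B]. Given an ergodic measure-preserving transformation [psi] of [B], the new
    generator goes up the columns as the old one does, and from the top of the
    column of [z] it goes to the base [psi z] ([reroute]). It is ergodic because
    an invariant set is a union of columns over a [psi]-invariant subset of [B],
    and it differs from the old one only at the tops of the columns.

    The new action is free if [psi] satisfies no relation with [a]. To make this
    precise, label a move by [a] with the group element that is applied, and a move
    by [psi] from [z] with the element by which the old generator would have led
    from [z] to the next base. Then from almost every point each [h] of the group
    is spelled by a path labelled by [h] that ends at the image under [b h], and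
    fixed points of [b h] are excluded for nontrivial [h] as soon as every closed
    path has a trivial label ([closed_path_hol]).

    Such a [psi] is found at random ([companion_exists]). Identify [B] with the
    space of coin tosses ([standard_borel_coin]), on which the odometer is ergodic
    ([odo_ergodic]), and conjugate the odometer by an automorphism of the binary
    tree that is chosen by tossing a coin at each node. A shortest closed path with
    a nontrivial label, suitably rotated, would at its last step read the random
    automorphism at a point where it was not read before. Flipping the coins of one
    level near that point changes the end of the path and nothing else in it; the
    levels give infinitely many disjoint events of the same probability, so the
    path closes up with probability zero ([fresh_loop_section0]). By Fubini one
    automorphism serves for almost every starting point ([fresh_loop_null]). *)

Set Implicit Arguments.
Unset Strict Implicit.
Unset Printing Implicit Defensive.

Import Order.TTheory GRing.Theory Num.Theory.
Import numFieldNormedType.Exports.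

Local Open Scope classical_set_scope.
Local Open Scope ring_scope.

(** * Free groups through their universal property *)

(** The permutations of a possibly infinite type; the inverse is part of the
    data, so that it can be required to be measurable. *)
Record bij (T : Type) := Bij {
  bfun :> T -> T ;
  binv : T -> T ;
  bijK : cancel bfun binv ;
  binvK : cancel binv bfun
}.

Lemma bij_ext T (f g : bij T) : bfun f =1 bfun g -> f = g.
Proof.
case: f g => [f f' fK f'K] [g g' gK g'K] /= /funext fg; subst g.
have e : f' = g' by apply/funext => y; apply: (can_inj fK); rewrite f'K g'K.
by subst g'; congr Bij; exact: Prop_irrelevance.
Qed.

Section BijGroup.
Context (T : Type).
Implicit Types f g h : bij T.

Definition bij1 : bij T := @Bij T id id (fun=> erefl) (fun=> erefl).
Definition bijV f : bij T := Bij (@binvK _ f) (@bijK _ f).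
Definition bijM f g : bij T :=
  Bij (can_comp (@bijK _ f) (@bijK _ g)) (can_comp (@binvK _ g) (@binvK _ f)).

HB.instance Definition _ := gen_eqMixin (bij T).
HB.instance Definition _ := gen_choiceMixin (bij T).

Fact bijMA : associative bijM.
Proof. by move=> f g h; apply: bij_ext. Qed.
Fact bij1M : left_id bij1 bijM.
Proof. by move=> f; apply: bij_ext. Qed.
Fact bijM1 : right_id bij1 bijM.
Proof. by move=> f; apply: bij_ext. Qed.
Fact bijVM : left_inverse bij1 bijV bijM.
Proof. by move=> f; apply: bij_ext => x /=; rewrite bijK. Qed.
Fact bijMV : right_inverse bij1 bijV bijM.
Proof. by move=> f; apply: bij_ext => x /=; rewrite binvK. Qed.

HB.instance Definition _ := isGroup.Build (bij T) bijMA bij1M bijM1 bijVM bijMV.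

Lemma bijME f g x : (f * g)%g x = f (g x). Proof. by []. Qed.
Lemma bij1E x : (1%g : bij T) x = x. Proof. by []. Qed.

End BijGroup.

Section FreeBasis.
Context (I : Type) (F : groupType) (x : I -> F).
Hypothesis xF : free_basis x.

(** The subgroup of the elements satisfying [K] receives a homomorphism from
    [F] fixing the basis; composed with the inclusion it is the identity, by
    uniqueness, so the subgroup is everything. *)
Lemma free_basis_ind (K : F -> Prop) :
  K 1%g -> (forall y z, K y -> K z -> K (y * z)%g) ->
  (forall y, K y -> K y^-1%g) -> (forall i, K (x i)) -> forall y, K y.
Proof.
move=> K1 KM KV Kx y.
pose P : pred F := fun z => `[< K z >].
have PV : forall z, P z -> P z^-1%g by move=> z /asboolP/KV/asboolP.
have PM : forall z t, P z -> P t -> P (z * t)%g.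
  by move=> z t /asboolP Kz /asboolP Kt; apply/asboolP/KM.
have PF : group_closed P.
  by split => [|z t Pz Pt]; [exact/asboolP | exact: PM (PV _ _)].
pose S := {z : F | P z}.
pose mS := SubChoice_isSubGroup.Build F P S PF.
pose SG : groupType := HB.pack S mS.
pose f i : SG := exist _ (x i) (asboolT (Kx i)).
have [phi [[phiM phix] _]] := xF f.
have [psi [_ psiU]] := xF x.
have vM : {morph (fun z => sval (phi z)) : u v / (u * v)%g}.
  move=> u v /=; rewrite phiM.
  exact: (@valM F P (HB.pack_for (subGroupType P) S mS)).
have e1 := psiU _ (conj vM (fun i => f_equal sval (phix i))).
have e2 := psiU _ (conj (fun u v => erefl) (fun i => erefl) :
  {morph (@id F) : u v / (u * v)%g} /\ forall i, id (x i) = x i).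
have -> : y = sval (phi y) by rewrite -[LHS]/(id y) -e2 e1.
exact/asboolP/(svalP (phi y)).
Qed.

Lemma free_basis_hom (H : groupType) (f : I -> H) :
  exists phi : F -> H, [/\ phi 1%g = 1%g, {morph phi : y z / (y * z)%g},
    {morph phi : y / y^-1%g} & forall i, phi (x i) = f i].
Proof.
have [phi [[phiM phix] _]] := xF f; exists phi.
have phi1 : phi 1%g = 1%g by apply: (mulgI (phi 1%g)); rewrite -phiM !mulg1.
split=> // y; apply: (mulgI (phi y)); by rewrite -phiM !mulgV.
Qed.

(** Some homomorphism to the permutations of the integers maps every element of
    the basis to the translation by one. *)
Lemma free_basis_torsion_free i n : (x i ^+ n)%g = 1%g -> n = 0%N.
Proof.
pose s : bij int := Bij (addrK (1 : int)) (subrK (1 : int)).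
have [phi [phi1 phiM _ phix]] := free_basis_hom (fun=> s).
have phiX m : phi (x i ^+ m)%g 0 = m%:Z.
  elim: m => [|m IH]; first by rewrite expg0 phi1.
  by rewrite expgS phiM phix bijME IH /= -addn1 PoszD.
by move=> e; have := phiX n; rewrite e phi1 bij1E => -[].
Qed.

End FreeBasis.

(** * Measures up to null sets *)

Section NullSets.
Context {d} {T : measurableType d} {R : realType} (mu : probability T R).
Implicit Types A B N : set T.
Local Open Scope ereal_scope.

Lemma measure_ae_le A B N : measurable A -> measurable B -> measurable N ->
  mu N = 0 -> (forall x, ~ N x -> A x -> B x) -> mu A <= mu B.
Proof.
move=> mA mB mN N0 AB; rewrite -(measureU0 mB mN N0).
apply: le_measure; rewrite ?inE//; first exact: measurableU.
by move=> x Ax; have [|/AB/(_ Ax)] := pselect (N x); [right|left].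
Qed.

Lemma measure_ae_eq A B N : measurable A -> measurable B -> measurable N ->
  mu N = 0 -> (forall x, ~ N x -> A x <-> B x) -> mu A = mu B.
Proof.
move=> mA mB mN N0 AB; apply/eqP; rewrite eq_le.
by apply/andP; split; apply: (@measure_ae_le _ _ N) => // x /AB[].
Qed.

Lemma measureU_null A B : measurable A -> measurable B -> mu A = 0 -> mu B = 0 ->
  mu (A `|` B) = 0.
Proof. by move=> mA mB A0 B0; rewrite measureU0 ?A0. Qed.

Lemma measure_bigcup0 (F : nat -> set T) : (forall n, measurable (F n)) ->
  (forall n, mu (F n) = 0) -> mu (\bigcup_n F n) = 0.
Proof.
move=> mF F0; apply/negligibleP; first exact: bigcupT_measurable.
by apply: (negligible_bigcup (mu := mu)) => n; exists (F n); split; [exact: mF|exact: F0|].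
Qed.

Lemma measure_bigcup0_count (J : countType) (F : J -> set T) :
  (forall j, measurable (F j)) -> (forall j, mu (F j) = 0) ->
  measurable (\bigcup_j F j) /\ mu (\bigcup_j F j) = 0.
Proof.
move=> mF F0.
pose G n := if unpickle n is Some j then F j else set0.
have -> : \bigcup_j F j = \bigcup_n G n.
  apply/seteqP; split=> x [j _ Fx]; first by exists (pickle j); rewrite /G// pickleK.
  by move: Fx; rewrite /G; case: unpickle => // i Fx; exists i.
have mG n : measurable (G n) by rewrite /G; case: (unpickle n).
split; first exact: bigcupT_measurable.
by apply: measure_bigcup0 => // n; rewrite /G; case: (unpickle n).
Qed.

(** The measure is finite, so infinitely many disjoint events cannot share a
    positive measure. *)
Lemma measure0_disjoint (v : \bar R) (F : nat -> set T) :
  (forall n, measurable (F n)) -> trivIset setT F ->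
  (forall n, mu (F n) = v) -> v = 0.
Proof.
move=> mF tF Fv.
have v_ge0 : 0 <= v by rewrite -(Fv 0%N).
have vfin : v \is a fin_num by rewrite -(Fv 0%N) fin_num_measure.
apply/eqP; rewrite eq_le v_ge0 andbT -(fineK vfin) lee_fin leNgt.
apply/negP => v0.
pose n := (Num.truncn (fine v)^-1).+1.
have : mu (\big[setU/set0]_(i < n) F i) <= 1.
  by apply: probability_le1; exact: bigsetU_measurable.
rewrite (measure_bigsetU_ord mu (fun=> true)); [|by move=> *; exact: mF|]; last first.
  by move=> i j _ _ /(tF _ _ I I)/val_inj.
rewrite (eq_bigr (fun=> (fine v)%:E)); last by move=> i _; rewrite fineK//; exact: Fv.
rewrite sumEFin lee_fin sumr_const card_ord leNgt => /negP; apply.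
rewrite -mulr_natl -ltr_pdivrMr// mul1r.
exact: truncnS_gt.
Qed.

Lemma fin_mu A : measurable A -> mu A \is a fin_num.
Proof. by move=> mA; exact: fin_num_measure. Qed.

End NullSets.

Lemma measurable_preimage d d' (T : measurableType d) (T' : measurableType d')
    (f : T -> T') (A : set T') :
  measurable_fun setT f -> measurable A -> measurable (f @^-1` A).
Proof. by move=> mf mA; rewrite -[X in measurable X]setTI; exact: mf. Qed.

Section MeasurableLogic.
Context {d} {T : measurableType d}.
Implicit Types P Q : T -> Prop.

Lemma measurable_prop (p : Prop) : measurable [set x : T | p].
Proof.
have [hp|np] := pselect p.
  by rewrite (_ : [set _ | _] = setT)//; apply/seteqP; split.
by rewrite (_ : [set _ | _] = set0)//; apply/seteqP; split.
Qed.

Lemma measurable_all (J : countType) (P : J -> T -> Prop) :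
  (forall j, measurable [set x | P j x]) -> measurable [set x | forall j, P j x].
Proof.
move=> mP; have -> : [set x | forall j, P j x] =
    \bigcap_n (if unpickle n is Some j then [set x | P j x] else setT).
  apply/seteqP; split=> x /=.
    by move=> Px n _; case: (unpickle n) => //= j; exact: Px.
  by move=> Px j; have := Px (pickle j) I; rewrite pickleK.
by apply: bigcapT_measurable => n; case: (unpickle n).
Qed.

Lemma measurable_not P : measurable [set x | P x] -> measurable [set x | ~ P x].
Proof. exact: measurableC. Qed.

Lemma measurable_ex (J : countType) (P : J -> T -> Prop) :
  (forall j, measurable [set x | P j x]) -> measurable [set x | exists j, P j x].
Proof.
move=> mP; rewrite (_ : [set x | _] = ~` [set x | forall j, ~ P j x]).
  by apply/measurableC/measurable_all => j; exact: measurable_not.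
apply/seteqP; split=> x /=; first by move=> [j Pj] /(_ j).
by move=> /existsNP[j /contrapT]; exists j.
Qed.

Lemma measurable_conj P Q : measurable [set x | P x] -> measurable [set x | Q x] ->
  measurable [set x | P x /\ Q x].
Proof. exact: measurableI. Qed.

Lemma measurable_disj P Q : measurable [set x | P x] -> measurable [set x | Q x] ->
  measurable [set x | P x \/ Q x].
Proof. exact: measurableU. Qed.

Lemma measurable_imp P Q : measurable [set x | P x] -> measurable [set x | Q x] ->
  measurable [set x | P x -> Q x].
Proof.
move=> mP mQ; rewrite (_ : [set x | _] = [set x | ~ P x \/ Q x]).
  by apply: measurable_disj => //; exact: measurable_not.
apply/seteqP; split=> x /=; last by case.
by have [Px /(_ Px)|] := pselect (P x); [right|left].
Qed.

End MeasurableLogic.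

(** * The Cantor space, its tree automorphisms and the odometer *)

Definition agree (n : nat) (c c' : nat -> bool) := forall i, (i < n)%N -> c i = c' i.

Definition cyl (n : nat) (c : nat -> bool) : set (nat -> bool) :=
  [set c' | agree n c' c].

Definition cylinders : set (set (nat -> bool)) :=
  [set A | A = set0 \/ exists n c, A = cyl n c].

Definition cantor : measurableType (sigma_display cylinders) :=
  g_sigma_algebraType cylinders.

Lemma agree_sym n c c' : agree n c c' -> agree n c' c.
Proof. by move=> e i /e. Qed.

Lemma agree_trans n c' c c'' : agree n c c' -> agree n c' c'' -> agree n c c''.
Proof. by move=> e e' i ni; rewrite e// e'. Qed.

Lemma agree_eq (c c' : cantor) : (forall n, agree n c c') -> c = c'.
Proof. by move=> e; apply/funext => i; exact: (e i.+1). Qed.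

Lemma agreeS n c c' : agree n.+1 c c' <-> agree n c c' /\ c n = c' n.
Proof.
split=> [e|[e en] i]; first by split=> [i ni|]; apply: e => //; exact: ltnW.
by rewrite ltnS leq_eqVlt => /predU1P[->//|]; exact: e.
Qed.

Lemma cylE n c c' : agree n c c' -> cyl n c = cyl n c'.
Proof.
move=> e; apply/seteqP; split=> z ez; apply: agree_trans ez _ => //.
exact: agree_sym.
Qed.

Lemma measurable_cyl n c : @measurable _ cantor (cyl n c).
Proof. by apply: sub_sigma_algebra; right; exists n, c. Qed.

Lemma cylinders_setI : setI_closed cylinders.
Proof.
move=> A B [->|[n [c ->]]]; first by left; rewrite set0I.
move=> [->|[p [d ->]]]; first by left; rewrite setI0.
wlog np : n p c d / (n <= p)%N.
  move=> H; have [|/ltnW] := leqP n p; first exact: H.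
  by rewrite setIC; exact: H.
have [[z [zc zd]]|/set0P/negP/negPn/eqP->] := pselect (cyl n c `&` cyl p d !=set0).
  right; exists p, d; apply/seteqP; split=> [y []//|y yd]; split=> // i ni.
  have ip := leq_trans ni np.
  by rewrite -zc// zd// yd.
by left.
Qed.

Lemma cantor_dynkin (P : set (set cantor)) :
  P set0 -> (forall n c, P (cyl n c)) ->
  (forall S, @measurable _ cantor S -> P S -> P (~` S)) ->
  (forall F : (set cantor)^nat, (forall n, @measurable _ cantor (F n)) ->
    trivIset [set: nat] F -> (forall n, P (F n)) -> P (\bigcup_k F k)) ->
  forall S, @measurable _ cantor S -> P S.
Proof.
move=> P0 Pc PC PU; apply: (@dynkin_induction _ cantor cylinders) => //.
- exact: cylinders_setI.
- suff -> : [set: cantor] = cyl 0 (fun=> false) by [].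
  by apply/seteqP.
- by move=> A [->|[n [c ->]]].
Qed.

Lemma measurable_to_cantor d (T : measurableType d) (D : set T) (f : T -> cantor) :
  (forall n, measurable (D `&` [set x | f x n])) -> measurable D ->
  @measurable_fun _ _ T cantor D f.
Proof.
move=> mf mD; apply: (@measurability _ _ T cantor D f cylinders) => // _ [A [->|[n [c ->]]] <-].
  by rewrite preimage_set0 setI0.
elim: n => [|n IH].
  by rewrite (_ : _ `&` _ = D)//; apply/seteqP; split=> [x []|x Dx]//; split.
have -> : D `&` f @^-1` cyl n.+1 c =
    (D `&` f @^-1` cyl n c) `&` (D `&` [set x | f x n = c n]).
  apply/seteqP; split=> x.
    by move=> [Dx /agreeS[]].
  by move=> [[Dx xc] [_ xn]]; split=> //; apply/agreeS.
apply: measurableI => //; case: (c n); first exact: mf.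
rewrite (_ : D `&` _ = D `\` (D `&` [set x | f x n])); first exact: measurableD.
apply/seteqP; split=> x /=.
  by move=> [Dx /negbT/negP fx]; split=> // -[].
by move=> [Dx fx]; split=> //; apply/negbTE/negP => ?; apply: fx.
Qed.

Lemma measurable_coord d (T : measurableType d) (f : T -> cantor) n :
  @measurable_fun _ _ T cantor setT f -> measurable [set x | f x n].
Proof.
move=> mf; rewrite -[X in measurable X]setTI.
apply: (mf _ [set c | c n]) => //.
have e : [set c : cantor | c n] =
    \bigcup_(s in [set: n.-tuple bool])
      cyl n.+1 (fun i => nth true (rcons s true) i).
  apply/seteqP; split=> c /=.
    move=> cn; exists [tuple c i | i < n] => // i.
    rewrite ltnS leq_eqVlt => /predU1P[->|ni].
      by rewrite nth_rcons size_tuple ltnn eqxx cn.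
    rewrite nth_rcons size_tuple ni.
    by rewrite -[i]/(nat_of_ord (Ordinal ni)) -tnth_nth tnth_mktuple.
  move=> [s _ /(_ n (leqnn _))] ->.
  by rewrite nth_rcons size_tuple ltnn eqxx.
apply: (eq_ind_r (@measurable _ cantor) _ e).
apply: (@fin_bigcup_measurable _ cantor) => // s _.
exact: measurable_cyl.
Qed.

Lemma measurable_eq_cantor d (T : measurableType d) (f g : T -> cantor) :
  @measurable_fun _ _ T cantor setT f -> @measurable_fun _ _ T cantor setT g ->
  measurable [set x | f x = g x].
Proof.
move=> mf mg; have -> : [set x | f x = g x] = \bigcap_n
    (([set x | f x n] `&` [set x | g x n]) `|`
     (~` [set x | f x n] `&` ~` [set x | g x n])).
  apply/seteqP; split=> x /=.
    by move=> e n _ /=; rewrite e; case: (g x n); [left|right].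
  move=> e; apply/funext => n; move: (e n I) => /=.
  by case: (f x n); case: (g x n) => // -[[]|[]].
apply: bigcapT_measurable => n.
have mfn := measurable_coord n mf; have mgn := measurable_coord n mg.
by apply: measurableU; apply: measurableI => //; exact: measurableC.
Qed.

(** ** Tree automorphisms *)

Definition prefix_of (c : cantor) (n : nat) : seq bool := mkseq c n.

Lemma prefix_ofS c n : prefix_of c n.+1 = rcons (prefix_of c n) (c n).
Proof. by rewrite /prefix_of mkseqS. Qed.

Lemma size_prefix_of c n : size (prefix_of c n) = n.
Proof. exact: size_mkseq. Qed.

Lemma prefix_of_eq c c' n : prefix_of c n = prefix_of c' n <-> agree n c c'.
Proof.
split=> [e i ni|e]; first by rewrite -(nth_mkseq true c ni) -/(prefix_of c n) e nth_mkseq.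
by apply: (@eq_from_nth _ true); rewrite !size_mkseq// => i ni; rewrite !nth_mkseq//; apply: e.
Qed.

(** The automorphism of the binary tree, acting on its ends, that exchanges the
    two subtrees below each node at which [h] is true; its inverse has to read
    the node of the source, computed by [tree_prefix]. *)
Definition tree (h : seq bool -> bool) (c : cantor) : cantor :=
  fun n => c n (+) h (prefix_of c n).

Fixpoint tree_prefix (h : seq bool -> bool) (c : cantor) (n : nat) : seq bool :=
  if n is n'.+1 then rcons (tree_prefix h c n') (c n' (+) h (tree_prefix h c n'))
  else [::].

Definition tree_inv (h : seq bool -> bool) (c : cantor) : cantor :=
  fun n => c n (+) h (tree_prefix h c n).

Lemma prefix_of_tree_inv h c n : prefix_of (tree_inv h c) n = tree_prefix h c n.
Proof. by elim: n => // n IH; rewrite prefix_ofS IH. Qed.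

Lemma tree_invK h : cancel (tree_inv h) (tree h).
Proof.
by move=> c; apply/funext => n; rewrite /tree prefix_of_tree_inv /tree_inv addbK.
Qed.

Lemma treeK h : cancel (tree h) (tree_inv h).
Proof.
move=> c; have e n : tree_prefix h (tree h c) n = prefix_of c n.
  by elim: n => // n IH; rewrite prefix_ofS /= IH /tree addbK.
by apply/funext => n; rewrite /tree_inv e /tree addbK.
Qed.

Record isometry (f f' : cantor -> cantor) : Prop := Isometry {
  isoK : cancel f f' ;
  isoKV : cancel f' f ;
  iso_agree : forall n c c', agree n c c' -> agree n (f c) (f c') ;
  iso_agreeV : forall n c c', agree n c c' -> agree n (f' c) (f' c')
}.

Lemma isometryV f f' : isometry f f' -> isometry f' f.
Proof. by case=> *; split. Qed.

Lemma isometry_comp f f' g g' :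
  isometry f f' -> isometry g g' -> isometry (f \o g) (g' \o f').
Proof.
case=> fK f'K fa f'a [gK g'K ga g'a]; split.
- by move=> c /=; rewrite fK gK.
- by move=> c /=; rewrite g'K f'K.
- by move=> n c c' e; apply/fa/ga.
- by move=> n c c' e; apply/g'a/f'a.
Qed.

Lemma tree_isometry h : isometry (tree h) (tree_inv h).
Proof.
split; [exact: treeK|exact: tree_invK| |].
  move=> n c c' e i ni; rewrite /tree e//; congr (_ (+) h _).
  by apply/prefix_of_eq => j ji; apply/e/(ltn_trans ji).
move=> n c c' e; apply/prefix_of_eq; rewrite !prefix_of_tree_inv.
by elim: n e => // n IH /agreeS[/IH /= -> ->].
Qed.

Lemma isometry_preimage f f' n c : isometry f f' -> f @^-1` cyl n c = cyl n (f' c).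
Proof.
move=> [fK f'K fa f'a]; apply/seteqP; split=> z /= e.
  by rewrite /cyl/= -[z]fK; exact: f'a.
by rewrite /cyl/= -[c]f'K; exact: fa.
Qed.

Lemma measurable_isometry f f' : isometry f f' ->
  @measurable_fun _ _ cantor cantor setT f.
Proof.
move=> iso; apply: (@measurability _ _ cantor cantor _ f cylinders) => // _ [A [->|
  [n [c ->]]] <-].
  by rewrite preimage_set0 setI0.
by rewrite setTI (isometry_preimage _ _ iso); exact: measurable_cyl.
Qed.

(** ** The odometer *)

(** Addition of one with carry: a digit changes when all the previous ones are
    equal to one. *)
Definition odo := tree (all id).
Definition odo_inv := tree_inv (all id).

Definition odo_isometry : isometry odo odo_inv := tree_isometry _.

Definition odo_pm (s : bool) := if s then odo else odo_inv.

Lemma odo_pm_isometry s : isometry (odo_pm s) (odo_pm (~~ s)).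
Proof. by case: s; [|apply: isometryV]; exact: odo_isometry. Qed.

(** The first [n] digits, read as a number with the least significant digit
    first. *)
Definition address (n : nat) (c : cantor) : nat := \sum_(i < n) c i * 2 ^ i.

Lemma addressS n c : address n.+1 c = (address n c + c n * 2 ^ n)%N.
Proof. by rewrite /address big_ord_recr. Qed.

Lemma address_lt n c : (address n c < 2 ^ n)%N.
Proof.
elim: n => [|n IH]; first by rewrite /address big_ord0.
rewrite addressS expnS mul2n -addnn.
have : (c n * 2 ^ n <= 2 ^ n)%N by case: (c n); rewrite ?mul1n ?mul0n.
lia.
Qed.

Lemma address_inj n c c' : address n c = address n c' -> agree n c c'.
Proof.
elim: n => [//|n IH]; rewrite !addressS => e; apply/agreeS.
have := address_lt n c; have := address_lt n c'.
move: e; case: (c n); case: (c' n); rewrite ?mul0n ?mul1n ?addn0.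
- by move=> /addIn/IH.
- lia.
- lia.
- by move/IH.
Qed.

Lemma all_prefix_of n c : all id (prefix_of c n) = ((address n c).+1 == 2 ^ n)%N.
Proof.
elim: n => [|n IH]; first by rewrite /address big_ord0.
rewrite prefix_ofS all_rcons IH addressS expnS /=.
have := address_lt n c; case: (c n) => /=; lia.
Qed.

Lemma address_odo n c : address n (odo c) = ((address n c).+1 %% 2 ^ n)%N.
Proof.
elim: n => [|n IH]; first by rewrite /address big_ord0 modn1.
rewrite !addressS IH /odo /tree all_prefix_of.
have lt := address_lt n c; have [e|ne] := eqVneq.
  rewrite e modnn add0n -addSn e expnS.
  by case: (c n); rewrite ?mul0n ?mul1n ?addn0 /= ?addnn -?mul2n ?modnn// modn_small//
    ltn_Pmull ?expn_gt0.
rewrite modn_small; last lia.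
rewrite modn_small; first by rewrite addbF addSn.
rewrite expnS; have : (c n * 2 ^ n <= 2 ^ n)%N by case: (c n); rewrite ?mul1n ?mul0n.
lia.
Qed.

Lemma address_iter_odo n k c :
  address n (iter k odo c) = ((address n c + k) %% 2 ^ n)%N.
Proof.
elim: k => [|k IH]; first by rewrite addn0 modn_small// address_lt.
by rewrite iterS address_odo IH -addn1 modnDml addn1 addnS.
Qed.

(** On the first [n] digits the odometer is addition of one modulo [2 ^ n]. *)
Lemma odo_transitive n c c' : exists k, agree n (iter k odo c) c'.
Proof.
exists (address n c' + (2 ^ n - address n c))%N; apply: address_inj.
rewrite address_iter_odo addnCA subnKC ?modnDr ?modn_small ?address_lt//.
exact/ltnW/address_lt.
Qed.

Lemma odo_free k c : iter k odo c = c -> k = 0%N.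
Proof.
move=> /(congr1 (address k)); rewrite address_iter_odo.
have kk : (k < 2 ^ k)%N by exact: ltn_expl.
rewrite -[in RHS](modn_small (address_lt k c)) -[in RHS](addn0 (address k c)).
by move/eqP; rewrite eqn_modDl mod0n modn_small// => /eqP.
Qed.

(** ** The coin-flipping measure *)

Section CoinMeasure.
Context {R : realType} (m : probability cantor R).
Local Open Scope ereal_scope.

Definition coin := forall n c, m (cyl n c) = (2 ^- n)%:E.

Hypothesis mcoin : coin.

(** An isometry exchanges the cylinders of a given length, which all have the
    same measure. *)
Lemma isometry_preserving f f' (A : set cantor) :
  isometry f f' -> measurable A -> m (f @^-1` A) = m A.
Proof.
move=> iso; have mf := measurable_isometry iso.
have mpre (B : set cantor) : measurable B -> measurable (f @^-1` B).
  by move=> mB; rewrite -[X in measurable X]setTI; exact: mf.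
apply: (cantor_dynkin (P := fun B => m (f @^-1` B) = m B)).
- by rewrite preimage_set0 measure0.
- by move=> n c; rewrite (isometry_preimage _ _ iso) !mcoin.
- move=> S mS e.
  by rewrite preimage_setC !probability_setC ?e//; exact: mpre.
- move=> F mF tF e; rewrite preimage_bigcup !measure_bigcup//.
  + by apply: eq_eseriesr => k _; exact: e.
  + by move=> k _; exact: mpre.
  + by move=> i j _ _ [z [Fi Fj]]; apply: tF => //; exists (f z); split.
Qed.

(** The odometer exchanges transitively the cylinders of a given length, so an
    invariant set meets all of them in the same measure: it is independent of
    every cylinder, hence of itself. *)
Lemma odo_ergodic (A N : set cantor) : measurable A -> measurable N -> m N = 0 ->
  (forall c, ~ N c -> A (odo c) <-> A c) -> m A = 0 \/ m A = 1.
Proof.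
move=> mA mN N0 inv.
have mo : forall D : set cantor, measurable D -> measurable (odo @^-1` D).
  by move=> D mD; rewrite -[X in measurable X]setTI;
    exact: (measurable_isometry odo_isometry).
have mAc n c : measurable (A `&` cyl n c) by exact: measurableI _ (measurable_cyl n c).
have shift n c : m (A `&` cyl n (odo c)) = m (A `&` cyl n c).
  have e1 : odo @^-1` cyl n (odo c) = cyl n c.
    by rewrite (isometry_preimage _ _ odo_isometry) (isoK odo_isometry).
  rewrite -[LHS](isometry_preserving odo_isometry)//.
  apply: (@measure_ae_eq _ cantor _ m _ _ N) => //; first exact: mo.
  by move=> z Nz; rewrite /setI/= -e1/=; split=> -[/(inv _ Nz)].
have same n c c' : m (A `&` cyl n c) = m (A `&` cyl n c').
  have [k /cylE <-] := odo_transitive n c c'.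
  elim: k => // k IH; exact: etrans IH (esym (shift n (iter k odo c))).
have unif n c : m (A `&` cyl n c) = m A * (2 ^- n)%:E.
  elim: n c => [|n IH] c.
    by rewrite expr0 invr1 mule1; congr (m _); apply/seteqP; split=> z // [].
  pose c' i := if (i == n)%N then ~~ c n else c i.
  have e : A `&` cyl n c = (A `&` cyl n.+1 c) `|` (A `&` cyl n.+1 c').
    apply/seteqP; split=> z.
      move=> [Az zc]; have [e|ne] := eqVneq (z n) (c n).
        by left; split=> //; apply/agreeS.
      right; split=> //; apply/agreeS; split.
        by move=> i ni; rewrite /c' ltn_eqF// zc.
      by rewrite /c' eqxx; move: ne; case: (z n); case: (c n).
    move=> [[Az /agreeS[]]//|[Az /agreeS[zc _]]]; split=> // i ni.
    by rewrite zc// /c' ltn_eqF.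
  have e2 : m (A `&` cyl n c) = m (A `&` cyl n.+1 c) + m (A `&` cyl n.+1 c').
    rewrite e measureU//.
    apply/seteqP; split=> // z [[_ /agreeS[_ zn]] [_ /agreeS[_]]].
    by rewrite /c' eqxx zn; case: (c n).
  move: e2; rewrite IH (same n.+1 c' c).
  rewrite -(fineK (fin_mu m (mAc n.+1 c))) -(fineK (fin_mu m mA)).
  rewrite -EFinD -!EFinM => -[] e'; congr EFin.
  rewrite exprS invfM mulrCA e'; lra.
have indep : forall D : set cantor, measurable D -> m (A `&` D) = m A * m D.
  apply: cantor_dynkin.
  - by rewrite setI0 measure0 mule0.
  - by move=> n c; rewrite unif mcoin.
  - move=> S mS e; rewrite probability_setC// -setDE.
    have mAS : measurable (A `&` S) by exact: measurableI.
    rewrite measureD//; last by rewrite -ge0_fin_numE// fin_mu.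
    rewrite /= e; move: (fin_mu m mA) (fin_mu m mS).
    case: (m A) => [a| |]//; case: (m S) => [b| |]// _ _.
    have -> : 1 - b%:E = (1 - b)%:E by [].
    have -> : a%:E * (1 - b)%:E = (a * (1 - b))%:E by [].
    have -> : a%:E - a%:E * b%:E = (a - a * b)%:E by [].
    by rewrite mulrBr mulr1.
  - move=> F mF tF e; rewrite setI_bigcupr !measure_bigcup//.
    + rewrite /= -(fineK (fin_mu m mA)) -nneseriesZl//.
      by apply: eq_eseriesr => k _; rewrite fineK ?fin_mu//; exact: e.
    + by move=> k _; exact: measurableI.
    + exact: trivIset_setIl.
have := indep A mA; rewrite setIid; move: (fin_mu m mA).
case: (m A) => [r| |]// _; rewrite -EFinM => -[] e.
have /eqP : (r * (r - 1) = 0)%R by rewrite mulrBr mulr1 -e subrr.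
by rewrite mulf_eq0 subr_eq0 => /orP[] /eqP ->; [left|right].
Qed.

End CoinMeasure.

(** * Standard Borel spaces inside the Cantor space *)

Section PolishCode.
Context {R : realType} (P : completePseudoMetricType R).
Hypotheses (hP : hausdorff_space P) (sP : @second_countable P).

Lemma countable_base : exists U : nat -> set P,
  (forall n, open (U n)) /\
  (forall p O, nbhs p O -> exists2 n, U n p & U n `<=` O).
Proof.
have [B /countable_injP[f fi] [Bo Bb]] := sP.
exists (fun n => [set p | exists V, [/\ B V, f V = n & V p]]).
have UE V : B V -> [set p | exists W, [/\ B W, f W = f V & W p]] = V.
  move=> BV; apply/seteqP; split=> p /=; last by exists V.
  by move=> [W [BW /fi-> //]]; rewrite inE.
split=> [n|p O /Bb[V [BV Vp] VO]]; last by exists (f V); rewrite UE.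
rewrite (_ : [set _ | _] = \bigcup_(V in [set V | B V /\ f V = n]) V).
  by apply: bigcup_open => V [/Bo].
apply/seteqP; split=> p /=; first by move=> [V [? ? ?]]; exists V.
by move=> [V [? ?] ?]; exists V.
Qed.

Variable U : nat -> set P.
Hypothesis Uo : forall n, open (U n).
Hypothesis Ub : forall p O, nbhs p O -> exists2 n, U n p & U n `<=` O.

Definition point_code (p : P) : cantor := fun n => `[< U n p >].

(** The sequences that code a point: the basic open sets selected generate a
    Cauchy filter, and are exactly the basic neighbourhoods of its limit. *)
Definition is_code (c : cantor) : Prop :=
  [/\ forall j k, U j `<=` U k -> c j -> c k,
      forall k, c k -> exists j, c j /\ closure (U j) `<=` U k,
      forall j k, c j -> c k ->
        exists i, c i /\ (U i `<=` U j `&` U k /\ U i !=set0) &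
      forall n, exists k, c k /\ exists p, U k `<=` ball p n.+1%:R^-1].

Lemma is_code_point_code p : is_code (point_code p).
Proof.
have nb n : U n p -> nbhs p (U n) by move=> ?; exact: open_nbhs_nbhs.
split.
- by move=> j k jk /asboolP/jk/asboolP.
- move=> k /asboolP Ukp.
  have [V Vp VU] := uniform_regular (nb _ Ukp).
  have [j Ujp UV] := Ub Vp.
  exists j; split; first exact/asboolP.
  exact: subset_trans (closureS UV) VU.
- move=> j k /asboolP Uj /asboolP Uk.
  have [i Ui ijk] := Ub (filterI (nb _ Uj) (nb _ Uk)).
  by exists i; split; [exact/asboolP|split=> //; exists p].
- move=> n; have e0 : 0 < n.+1%:R^-1 :> R by rewrite invr_gt0.
  have [k Uk kb] := Ub (nbhsx_ballx p _ e0).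
  by exists k; split; [exact/asboolP|exists p].
Qed.

Lemma is_code_ex c : is_code c -> exists p, point_code p = c.
Proof.
move=> [c1 c2 c3 c4].
pose F : set_system P := filter_from [set k | c k] U.
have FF : ProperFilter F.
  apply: filter_from_proper.
    apply: filter_from_filter.
      by have [k [ck _]] := c4 0%N; exists k.
    by move=> j k /= cj ck; have [i [ci [ijk _]]] := c3 _ _ cj ck; exists i.
  by move=> k /= ck; have [i [ci [ijk [p /ijk[]]]]] := c3 _ _ ck ck; exists p.
have : cvg F.
  apply: (@cauchy_cvg P F FF); apply: (@cauchy_exP R P F _) => e e0.
  have [n ne] : exists n : nat, n.+1%:R^-1 < e.
    exists (Num.truncn e^-1); rewrite invf_plt ?posrE//.
    exact: truncnS_gt.
  have [k [ck [p kp]]] := c4 n; exists p, k => // q /kp.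
  exact/le_ball/ltW.
move=> /cvg_ex[p Fp]; exists p; apply/funext => k; apply/asboolP/idP => [Ukp|ck].
  have [j cj jk] := Fp _ (open_nbhs_nbhs (conj (Uo k) Ukp)).
  exact: c1 jk cj.
have [j [cj]] := c2 k ck; apply.
move=> V /Fp[i ci iV].
have [l [cl [lij [q Ul]]]] := c3 _ _ ci cj.
by exists q; have [/iV Vq Uj] := lij q Ul; split.
Qed.

Lemma measurable_is_code : measurable [set c : cantor | is_code c].
Proof.
have mc n : measurable [set c : cantor | c n].
  exact: (@measurable_coord _ cantor id n (@measurable_id _ _ _)).
rewrite (_ : mkset _ = [set c : cantor |
   ((forall j k, U j `<=` U k -> c j -> c k) /\
   (forall k, c k -> exists j, c j /\ closure (U j) `<=` U k)) /\
   ((forall j k, c j -> c k ->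
        exists i, c i /\ (U i `<=` U j `&` U k /\ U i !=set0)) /\
   (forall n, exists k, c k /\ exists p, U k `<=` ball p n.+1%:R^-1))]).
  apply: measurable_conj; apply: measurable_conj.
  - do 2 (apply: measurable_all => ?).
    by apply: measurable_imp; [exact: measurable_prop|exact: measurable_imp].
  - apply: measurable_all => ?; apply: measurable_imp => //.
    apply: measurable_ex => ?; apply: measurable_conj => //.
    exact: measurable_prop.
  - do 2 (apply: measurable_all => ?); do 2 (apply: measurable_imp => //).
    apply: measurable_ex => ?; apply: measurable_conj => //.
    exact: measurable_prop.
  - apply: measurable_all => ?; apply: measurable_ex => ?.
    by apply: measurable_conj => //; exact: measurable_prop.
by apply/seteqP; split=> c /= => [[]|[[? ?] [? ?]]].
Qed.

Lemma point_code_inj : injective point_code.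
Proof.
move=> p q pq; apply: hP => A B pA qB.
have [n Up UA] := Ub pA.
have Uq : U n q by have /asboolP : point_code q n by rewrite -pq; exact/asboolP.
by exists q; split; [exact: UA|exact: nbhs_singleton].
Qed.

End PolishCode.

(** A point is sent to the list of the basic open sets that contain it; by
    completeness the lists that arise in this way form a Borel set, on which the
    inverse is measurable. *)
Lemma standard_borel_cantor (R : realType) d (X : measurableType d) (x0 : X) :
  standard_borel R X -> exists (e : X -> cantor) (r : cantor -> X),
    [/\ measurable_fun setT e, measurable_fun setT r & cancel e r].
Proof.
move=> [P [f [hP sP [f' fK f'K] mX]]].
have [U [Uo Ub]] := countable_base sP.
have mf B : <<s open >> B -> measurable (f @^-1` B).
  by move=> sB; apply/mX; exists B.
pose e x : cantor := point_code U (f x).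
have e_inj : injective e.
  by move=> x y /(point_code_inj hP Ub)/(can_inj fK).
pose r (c : cantor) : X :=
  if pselect (exists x, e x = c) is left h then projT1 (cid h) else x0.
have eK : cancel e r.
  move=> x; rewrite /r; case: pselect => [h|[]]; last by exists x.
  by case: cid => y /= /e_inj.
exists e, r; split=> //.
  apply: measurable_to_cantor => // n; rewrite setTI.
  rewrite (_ : mkset _ = f @^-1` U n).
    by apply: mf; apply: sub_sigma_algebra; exact: Uo.
  by apply/seteqP; split=> x /asboolP.
pose G := [set c : cantor | is_code U c].
have mG : measurable G by exact: measurable_is_code.
have Ge c : G c -> e (r c) = c.
  move=> /(is_code_ex Uo)[p pc]; have ep : e (f' p) = c by rewrite /e f'K.
  by rewrite -ep eK.
have Gr c : ~ G c -> r c = x0.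
  move=> nG; rewrite /r; case: pselect => // -[x xc].
  by exfalso; apply: nG; rewrite -xc; exact: is_code_point_code.
have mU n : measurable [set c : cantor | c n].
  exact: (@measurable_coord _ cantor id n (@measurable_id _ _ _)).
have main : <<s open >> `<=` [set B | measurable (G `&` [set c | B (f (r c))])].
  apply: smallest_sub; last first.
    move=> O oO /=; rewrite (_ : _ `&` _ =
      \bigcup_(n in [set n | U n `<=` O]) (G `&` [set c : cantor | c n])).
      by apply: (@bigcup_measurable _ cantor) => n _; exact: measurableI.
    apply/seteqP; split=> c /=.
      move=> [Gc Oc]; have [n Un UO] := Ub _ _ (open_nbhs_nbhs (conj oO Oc)).
      by exists n => //; split=> //=; rewrite -(Ge c Gc); exact/asboolP.
    move=> [n nO [Gc cn]]; split=> //; apply: nO.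
    by move: cn; rewrite /= -{1}(Ge c Gc) => /asboolP.
  split=> /=.
  - rewrite (_ : _ `&` _ = set0); first exact: measurable0.
    by apply/seteqP; split=> // c [].
  - move=> A mA; rewrite (_ : _ `&` _ = G `\` (G `&` [set c | A (f (r c))])).
      exact: measurableD.
    apply/seteqP; split=> c /=; first by move=> [Gc [_ nA]]; split=> // -[].
    by move=> [Gc nA]; split=> //; split=> // Ac; apply: nA.
  - move=> A mA; rewrite (_ : _ `&` _ = \bigcup_n (G `&` [set c | A n (f (r c))])).
      exact: (@bigcupT_measurable _ cantor).
    apply/seteqP; split=> c /=; first by move=> [Gc [n _ An]]; exists n.
    by move=> [n _ [Gc An]]; split=> //; exists n.
move=> _ A /mX[B sB ->]; rewrite setTI.
rewrite (_ : _ @^-1` _ = (G `&` [set c | B (f (r c))]) `|`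
    (~` G `&` [set c | B (f x0)])).
  apply: measurableU; first exact: main.
  by apply: measurableI; [exact: measurableC|exact: measurable_prop].
apply/seteqP; split=> c /=.
  by move=> Bc; have [Gc|Gc] := pselect (G c); [left|right; rewrite -(Gr _ Gc)].
by move=> [[]//|[nG]]; rewrite -(Gr _ nG).
Qed.

(** * Digits of real numbers *)

Definition shift (c : cantor) : cantor := fun n => c n.+1.

Lemma measurable_shift : measurable_fun setT shift.
Proof.
apply: measurable_to_cantor => // n; rewrite setTI.
exact: (@measurable_coord _ cantor id n.+1 (@measurable_id _ _ _)).
Qed.

Section Digits.
Context {R : realType}.
Implicit Types (b tau t : R) (c : cantor).

(** The partial sums, in Horner form, of the series of the [c i / b ^+ i.+1]. *)
Fixpoint radix_sum b n c : R :=
  if n is n'.+1 then ((c 0%N)%:R + radix_sum b n' (shift c)) / b else 0.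

Definition radix b c : R := limn (fun n => radix_sum b n c).

Definition digit_step b tau t : R := b * t - (tau <= t)%R%:R.

Definition digits b tau t : cantor := fun n => tau <= iter n (digit_step b tau) t.

Lemma digitsS b tau t : shift (digits b tau t) = digits b tau (digit_step b tau t).
Proof. by apply/funext => n; rewrite /shift /digits iterSr. Qed.

Lemma digits_eq b tau t : 0 < b ->
  t = ((digits b tau t 0%N)%:R + digit_step b tau t) / b.
Proof. by move=> b0; rewrite /digits /digit_step /= addrC subrK mulrAC divff ?mul1r//
  gt_eqF. Qed.

Section RadixLimit.
Context (b : R) (b2 : 2 <= b).

Let b0 : 0 < b. Proof. by apply: lt_le_trans b2; rewrite ltr0n. Qed.

Lemma radix_sum_ge0 n c : 0 <= radix_sum b n c.
Proof. by elim: n c => //= n IH c; rewrite divr_ge0 ?addr_ge0// ltW. Qed.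

Lemma radix_sum_le n c : radix_sum b n c <= (b - 1)^-1.
Proof.
have b1 : 0 < b - 1 by have := b2; lra.
elim: n c => [|n IH] c /=; first by rewrite invr_ge0 ltW.
rewrite ler_pdivrMr//; have := IH (shift c).
have -> : (b - 1)^-1 * b = 1 + (b - 1)^-1 by field; rewrite gt_eqF.
by case: (c 0%N) => /=; lra.
Qed.

Lemma radix_sum_nd c : nondecreasing_seq (fun n => radix_sum b n c).
Proof.
apply/nondecreasing_seqP => n; elim: n c => [|n IH] c.
  exact: (radix_sum_ge0 1).
by rewrite /= ler_pM2r ?invr_gt0// lerD2l; exact: IH.
Qed.

Lemma radix_cvg c : radix_sum b n c @[n --> \oo] --> radix b c.
Proof.
apply: nondecreasing_is_cvgn; first exact: radix_sum_nd.
by exists (b - 1)^-1 => _ [n _ <-]; exact: radix_sum_le.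
Qed.

Lemma radixE c : radix b c = ((c 0%N)%:R + radix b (shift c)) / b.
Proof.
apply/cvg_lim => //; rewrite -(cvg_shiftS (fun n => radix_sum b n c)) /=.
by apply: cvgM; [apply: cvgD; [exact: cvg_cst|exact: radix_cvg]|exact: cvg_cst].
Qed.

Lemma radix_ge0 c : 0 <= radix b c.
Proof.
apply: limr_ge; first by apply/cvg_ex; exists (radix b c); exact: radix_cvg.
by apply: nearW => n; exact: radix_sum_ge0.
Qed.

Lemma radix_le c : radix b c <= (b - 1)^-1.
Proof.
apply: limr_le; first by apply/cvg_ex; exists (radix b c); exact: radix_cvg.
by apply: nearW => n; exact: radix_sum_le.
Qed.

Lemma measurable_radix : measurable_fun setT (radix b : cantor -> R).
Proof.
apply: (@measurable_fun_cvg _ cantor R setT (fun n => radix_sum b n)) => [n|c _].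
  elim: n => [|n IH] /=; first exact: measurable_cst.
  apply: measurable_funM; last exact: measurable_cst.
  apply: measurable_funD; last exact: (measurableT_comp IH measurable_shift).
  have mc : measurable_fun setT (fun c : cantor => c 0%N).
    apply: (@measurable_fun_bool _ cantor _ _ true); rewrite setTI.
    exact: (@measurable_coord _ cantor id 0 (@measurable_id _ _ _)).
  rewrite (_ : (fun c : cantor => _) = (fun c : cantor => if c 0%N then 1 else 0 : R)).
    by apply: measurable_fun_ifT.
  by apply/funext => c; case: (c 0%N).
exact: radix_cvg.
Qed.

End RadixLimit.

Lemma measurable_digits b tau : measurable_fun setT (digits b tau).
Proof.
have ms : measurable_fun setT (digit_step b tau).
  apply: measurable_funB; first exact: measurable_funM.
  rewrite (_ : (fun t => _) = (fun t => if tau <= t then 1 else 0 : R)).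
    by apply: measurable_fun_ifT => //; exact: measurable_fun_ler.
  by apply/funext => t; case: (tau <= t).
have mi n : measurable_fun setT (iter n (digit_step b tau)).
  by elim: n => [|n IH]; [exact: measurable_id|exact: measurableT_comp].
apply: measurable_to_cantor => // n; rewrite setTI.
have := @measurable_fun_ler _ _ R setT _ _ (measurable_cst tau) (mi n).
by move=> /(_ measurableT [set true]); rewrite setTI; apply.
Qed.

(** With digits zero and one only, the sum is at most 1/6 when the first digit is
    zero and at least 1/3 when it is one; the threshold lies in between. *)
Lemma digits_radix3 : cancel (radix 3) (digits 3 4^-1).
Proof.
have b2 : 2 <= 3 :> R by lra.
have bit c : (4^-1 <= radix 3 c) = c 0%N.
  rewrite radixE//; have := radix_ge0 b2 (shift c); have := radix_le b2 (shift c).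
  rewrite (_ : 3 - 1 = 2 :> R); last lra.
  case: (c 0%N) => /= h1 h2; [apply/idP|apply/negbTE; rewrite -ltNge]; lra.
have step c : digit_step 3 4^-1 (radix 3 c) = radix 3 (shift c).
  by rewrite /digit_step bit [in LHS]radixE//; field.
have it n c : iter n (digit_step 3 4^-1) (radix 3 c) = radix 3 (fun i => c (n + i)%N).
  elim: n c => [|n IH] c; first by congr (radix _ _); apply/funext.
  by rewrite iterSr step IH; congr (radix _ _); apply/funext => i; rewrite /shift addSn.
by move=> c; apply/funext => n; rewrite /digits it bit addn0.
Qed.

Lemma digit_step2_itv t : 0 <= t < 1 -> 0 <= digit_step 2 2^-1 t < 1.
Proof.
by rewrite /digit_step => t01; have [|] := lerP 2^-1 t => /= ?; lra.
Qed.

Lemma radix_digits2 t : 0 <= t < 1 -> radix 2 (digits 2 2^-1 t) = t.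
Proof.
move=> t01; apply/cvg_lim => //.
have key n (u : R) : 0 <= u < 1 ->
    u - 2 ^- n <= radix_sum 2 n (digits 2 2^-1 u) <= u.
  elim: n u => [|n IH] u u01 /=; first by rewrite expr0; lra.
  rewrite digitsS; have := IH _ (digit_step2_itv u01).
  have := @digits_eq 2 2^-1 u (ltr0n _ 2); rewrite exprS invfM.
  by case: (digits 2 2^-1 u 0%N) => /= *; lra.
apply: (@squeeze_cvgr _ _ _ _ (fun n => t - 2 ^- n) (fun=> t)).
- by apply: nearW => n; exact: key.
- rewrite -[X in _ --> X]subr0; apply: cvgB; first exact: cvg_cst.
  under eq_fun do rewrite -exprVn.
  by apply: cvg_expr; rewrite ger0_norm ?invr_ge0//; lra.
- exact: cvg_cst.
Qed.

Lemma radix_sum2_le n c : radix_sum 2 n c <= 1 - 2 ^- n :> R.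
Proof.
elim: n c => [|n IH] c /=; first by rewrite expr0; lra.
have := IH (shift c); rewrite exprS invfM.
by case: (c 0%N) => /=; move: (2 ^- n) => z; lra.
Qed.

Lemma digits2_cyl n t c : 0 <= t < 1 ->
  agree n (digits 2 2^-1 t) c <-> radix_sum 2 n c <= t < radix_sum 2 n c + 2 ^- n.
Proof.
elim: n t c => [|n IH] t c t01 /=.
  by split=> // _; rewrite expr0; lra.
have t01' := digit_step2_itv t01.
have cS : agree n.+1 (digits 2 2^-1 t) c <->
    digits 2 2^-1 t 0%N = c 0%N /\ agree n (digits 2 2^-1 (digit_step 2 2^-1 t)) (shift c).
  rewrite -digitsS; split=> [e|[e0 e] [//|i]]; last exact: e.
  by split=> [|i ni]; exact: e.
rewrite cS IH//.
have te := @digits_eq 2 2^-1 t (ltr0n _ 2).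
have le1 := radix_sum2_le n (shift c).
have ge0 := @radix_sum_ge0 2 (lexx _) n (shift c).
have z0 : 0 < 2 ^- n :> R by rewrite invr_gt0 exprn_gt0.
rewrite exprS invfM; move: te.
by case: (digits 2 2^-1 t 0%N); case: (c 0%N) => /= te;
  split=> [[]//|]; try split=> //; lra.
Qed.

End Digits.

(** * Nonatomic standard spaces are coin-flipping spaces *)

Section MonotoneLimits.
Context {d} {T : measurableType d} {R : realType} (mu : probability T R).
Implicit Types A : nat -> set T.
Local Open Scope ereal_scope.

Lemma measure_bigcup_le A (t : \bar R) : (forall n, measurable (A n)) ->
  (forall n, A n `<=` A n.+1) -> (forall n, mu (A n) <= t) ->
  mu (\bigcup_n A n) <= t.
Proof.
move=> mA ndA At.
have cv : mu \o A @ \oo --> mu (\bigcup_n A n).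
  apply: nondecreasing_cvg_mu => //; first exact: bigcupT_measurable.
  by apply/nondecreasing_seqP => n; apply/subsetPset.
rewrite -(cvg_lim _ cv)//; apply: lime_le; first by apply/cvg_ex; eexists; exact: cv.
by apply: nearW => n; exact: At.
Qed.

Lemma measure_bigcap_ge A (t : R) : (forall n, measurable (A n)) ->
  (forall n, A n.+1 `<=` A n) -> (forall n, t%:E <= mu (A n)) ->
  t%:E <= mu (\bigcap_n A n).
Proof.
move=> mA niA At; have mI : measurable (\bigcap_n A n) by exact: bigcapT_measurable.
have : mu (\bigcup_n ~` A n) <= (1 - t)%:E.
  apply: measure_bigcup_le => n; first exact: measurableC.
  - exact: subsetC.
  - rewrite probability_setC//; have := At n; move: (fin_mu mu (mA n)).
    by case: (mu (A n)) => [r| |]// _; rewrite -EFinB !lee_fin; lra.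
rewrite -setC_bigcap probability_setC//.
move: (fin_mu mu mI); case: (mu _) => [r| |]// _.
by rewrite -EFinB !lee_fin; lra.
Qed.

End MonotoneLimits.

Section Uniformize.
Context {R : realType} {d} {X : measurableType d} (mu : probability X R).
Context (e : X -> R) (me : measurable_fun setT e).
Hypothesis e0 : forall s, mu (e @^-1` [set s]) = 0%E.

Let F (s : R) : R := fine (mu (e @^-1` `]-oo, s])).

Let mle s : measurable (e @^-1` `]-oo, s]).
Proof. exact: (measurable_preimage me). Qed.
Let mlt s : measurable (e @^-1` `]-oo, s[).
Proof. exact: (measurable_preimage me). Qed.

Let FE s : mu (e @^-1` `]-oo, s]) = (F s)%:E.
Proof. by rewrite /F fineK// fin_mu. Qed.

Let F_nd : {homo F : s t / s <= t}.
Proof.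
move=> s t st; rewrite -lee_fin -!FE; apply: le_measure; rewrite ?inE//.
by move=> x /=; rewrite !in_itv/= => /le_trans; apply.
Qed.

Let F_ge0 s : 0 <= F s. Proof. exact: fine_ge0. Qed.

Let F_le1 s : F s <= 1.
Proof. by rewrite -lee_fin -FE; exact: probability_le1. Qed.

Let FltE s : mu (e @^-1` `]-oo, s[) = (F s)%:E.
Proof.
rewrite -FE; have -> : e @^-1` `]-oo, s] = e @^-1` `]-oo, s[ `|` e @^-1` [set s].
  apply/seteqP; split=> x /=; rewrite !in_itv/= le_eqVlt.
    by case/predU1P => [->|]; [right|left].
  by case=> [->|->]; rewrite ?eqxx ?orbT.
by rewrite measureU0//; [exact: (measurable_preimage me)|exact: e0].
Qed.

Let archi (x : R) : exists n : nat, x < n%:R.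
Proof. by exists (Num.truncn x).+1; exact: truncnS_gt. Qed.

Let archi_inv (x : R) : 0 < x -> exists n : nat, n.+1%:R^-1 < x.
Proof.
by move=> x0; exists (Num.truncn x^-1); rewrite invf_plt ?posrE//; exact: truncnS_gt.
Qed.

Let F_large t : t < 1 -> exists s, t <= F s.
Proof.
move=> t1; apply/not_existsP => nF.
have : (mu (\bigcup_n e @^-1` `]-oo, n%:R%R]) <= t%:E)%E.
  apply: measure_bigcup_le => // n.
    by move=> x /=; rewrite !in_itv/= => /le_trans; apply; rewrite ler_nat.
  by rewrite FE lee_fin ltW// ltNge; apply/negP/nF.
rewrite (_ : bigcup _ _ = setT) ?probability_setT ?lee_fin; first by lra.
apply/seteqP; split=> // x _; have [n xn] := archi (e x).
by exists n => //=; rewrite in_itv/= ltW.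
Qed.

Let F_small t : 0 < t -> exists s, F s < t.
Proof.
move=> t0; apply/not_existsP => nF.
have : (t%:E <= mu (\bigcap_n e @^-1` `]-oo, (- n%:R)%R]))%E.
  apply: measure_bigcap_ge => // n.
    by move=> x /=; rewrite !in_itv/= => /le_trans; apply; rewrite lerN2 ler_nat.
  by rewrite FE lee_fin leNgt; apply/negP/nF.
rewrite (_ : bigcap _ _ = set0) ?measure0 ?lee_fin; first by lra.
apply/seteqP; split=> // x xn; have [n] := archi (- e x).
by have /= := xn n I; rewrite in_itv/=; lra.
Qed.

Let F_right s t : (forall u, s < u -> t <= F u) -> t <= F s.
Proof.
move=> tF; rewrite -lee_fin -FE.
rewrite (_ : _ @^-1` _ = \bigcap_n e @^-1` `]-oo, s + n.+1%:R^-1]).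
  apply: measure_bigcap_ge => // n.
    move=> x /=; rewrite !in_itv/= => /le_trans; apply.
    by rewrite lerD2l lef_pV2 ?posrE ?ltr0n// ler_nat.
  by rewrite FE lee_fin tF// ltrDl invr_gt0 ltr0n.
apply/seteqP; split=> x /=; rewrite in_itv/=.
  by move=> xs n _ /=; rewrite in_itv/= (le_trans xs)// lerDl invr_ge0 ler0n.
move=> xn; rewrite leNgt; apply/negP => sx.
have [|n] := @archi_inv (e x - s); first by rewrite subr_gt0.
rewrite ltrBrDl => /(le_lt_trans _)-/(_ (e x)).
have := xn n I; rewrite /= in_itv/= => h /(_ h).
by rewrite ltxx.
Qed.

Let F_left s t : (forall u, u < s -> F u <= t) -> F s <= t.
Proof.
move=> tF; rewrite -lee_fin -FltE.
rewrite (_ : _ @^-1` _ = \bigcup_n e @^-1` `]-oo, s - n.+1%:R^-1]).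
  apply: measure_bigcup_le => // n.
    move=> x /=; rewrite !in_itv/= => /le_trans; apply.
    by rewrite lerD2l lerN2 lef_pV2 ?posrE ?ltr0n// ler_nat.
  by rewrite FE lee_fin tF// ltrBlDr ltrDl invr_gt0 ltr0n.
apply/seteqP; split=> x /=; rewrite in_itv/=.
  move=> xs; have [|n ns] := @archi_inv (s - e x); first by rewrite subr_gt0.
  by exists n => //=; rewrite in_itv/= lerBrDr ltW// -ltrBrDl.
move=> [n _ /=]; rewrite in_itv/= => /le_lt_trans; apply.
by rewrite ltrBlDr ltrDl invr_gt0 ltr0n.
Qed.

(** The quantile function of [e]. *)
Let q (t : R) : R := if (0 < t) && (t < 1) then inf [set s | t <= F s] else 0.

Let q_le t s : 0 < t < 1 -> (q t <= s) = (t <= F s).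
Proof.
move=> /andP[t0 t1]; rewrite /q t0 t1 /=.
have [s1 s1t] := F_large t1; have [s0 s0t] := F_small t0.
have hi : has_inf [set s | t <= F s].
  split; first by exists s1.
  exists s0 => u /= tu; rewrite leNgt; apply/negP => /ltW/F_nd us0.
  by have := lt_le_trans s0t (le_trans tu us0); rewrite ltxx.
apply/idP/idP => [qs|ts]; last exact: (ge_inf hi.2).
apply: F_right => u su; have [v /= tv vu] := inf_lt hi.1 (le_lt_trans qs su).
exact: le_trans tv (F_nd (ltW vu)).
Qed.

Let F_q t : 0 < t < 1 -> F (q t) = t.
Proof.
move=> t01; apply/eqP; rewrite eq_le -q_le// lexx andbT.
by apply: F_left => u; rewrite ltNge q_le// -ltNge => /ltW.
Qed.

Let mF : measurable_fun setT F.
Proof. by apply: nondecreasing_measurable => // s t; exact: F_nd. Qed.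

Let mFe : measurable_fun setT (F \o e).
Proof. exact: measurableT_comp. Qed.

Let mFlt t : measurable [set x | F (e x) < t].
Proof.
have := measurable_fun_ltr mFe (measurable_cst t).
by move=> /(_ measurableT [set true]); rewrite setTI; apply.
Qed.

Let mq : measurable_fun setT q.
Proof.
have mD : measurable (`]0, 1[ : set R) by [].
apply: measurable_fun_if => //.
- apply: measurable_and; first exact: measurable_fun_ltr.
  exact: measurable_fun_ltr.
- rewrite setTI; apply: (measurability _ (RGenOInfty.measurableE R)) => //.
  move=> _ [_ [s ->] <-].
  rewrite (_ : _ `&` _ = `]0, 1[ `&` `]F s, +oo[); first exact: measurableI.
  apply/seteqP; split=> t /=; rewrite !in_itv/= !andbT.
    move=> [t01 qs]; split=> //; rewrite ltNge -q_le// -ltNge.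
    by move: qs; rewrite /q t01.
  move=> [t01]; rewrite ltNge -q_le// -ltNge => qs; split=> //.
  by move: qs; rewrite /q t01.
Qed.

Let F_unif_open t : 0 < t < 1 -> mu [set x | F (e x) < t] = t%:E.
Proof.
move=> t01; rewrite -[in RHS](F_q t01) -FltE; congr (mu _).
by apply/seteqP; split=> x /=; rewrite in_itv/= !ltNge q_le.
Qed.

Let F_unif t : 0 <= t <= 1 -> mu [set x | F (e x) < t] = t%:E.
Proof.
case/andP; rewrite le_eqVlt => /predU1P[<- _|t0].
  rewrite (_ : mkset _ = set0) ?measure0//.
  by apply/seteqP; split=> x //=; rewrite ltNge F_ge0.
rewrite le_eqVlt => /predU1P[->|t1]; last by apply: F_unif_open; rewrite t0.
have := fin_mu mu (mFlt 1); have := probability_le1 mu (mFlt 1).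
have big u : 0 < u < 1 -> (u%:E <= mu [set x | (F (e x) < 1)%R])%E.
  move=> u01; rewrite -(F_unif_open u01); apply: le_measure; rewrite ?inE//.
  by move=> x /= /lt_trans; apply; case/andP: u01.
case: (mu _) big => [r| |]// big; rewrite lee_fin => r1 _; congr EFin.
apply/eqP; rewrite eq_le r1 leNgt; apply/negP => lt1.
have r0 : 1 / 2 <= r by rewrite -lee_fin; apply: big; lra.
have : (r + 1) / 2 <= r by rewrite -lee_fin; apply: big; lra.
lra.
Qed.

Let F_level t : mu [set x | F (e x) = t] = 0%E.
Proof.
have mE : measurable [set x | F (e x) = t].
  by rewrite (_ : mkset _ = (F \o e) @^-1` [set t])//; exact: (measurable_preimage mFe).
have [t0|t0] := ltP t 0.
  rewrite (_ : mkset _ = set0) ?measure0//; apply/seteqP; split=> x //= xt.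
  by have := F_ge0 (e x); rewrite xt leNgt t0.
have [t1|t1] := leP 1 t.
  apply/eqP; rewrite -measure_le0.
  have <- : mu (~` [set x | F (e x) < 1]) = 0%E.
    by rewrite probability_setC// F_unif ?subee//; lra.
  apply: le_measure; rewrite ?inE//; first exact: measurableC.
  by move=> x /= ->; apply/negP; rewrite -leNgt.
have small u : t < u <= 1 -> (mu [set x | F (e x) = t] <= (u - t)%:E)%E.
  move=> /andP[tu u1].
  have -> : (u - t)%:E = mu ([set x | F (e x) < u] `\` [set x | F (e x) < t]).
    rewrite measureD//; last by rewrite -ge0_fin_numE// fin_mu.
    rewrite setIidr; last by move=> x /= /lt_trans; apply.
    by rewrite /= !F_unif ?EFinB//; lra.
  apply: le_measure; rewrite ?inE//; first exact: measurableD.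
  by move=> x /= ->; split=> //; rewrite ltxx.
have := fin_mu mu mE; have : (0 <= mu [set x | F (e x) = t])%E by [].
case: (mu _) small => [r| |]// small; rewrite lee_fin => r0 _; congr EFin.
apply/eqP; rewrite eq_le r0 andbT leNgt; apply/negP => r1.
have [c1|c1] := leP 1 (t + r / 2).
  have : r <= 1 - t by rewrite -lee_fin; apply: small; lra.
  lra.
have : r <= t + r / 2 - t by rewrite -lee_fin; apply: small; lra.
lra.
Qed.

(** The distribution function of [e] is uniformly distributed, so its binary
    digits are independent fair coin tosses; the quantile function recovers [e]
    from them. *)
Lemma coin_code (r : R -> X) : measurable_fun setT r -> cancel e r ->
  exists (theta : X -> cantor) (eta : cantor -> X) (N : set X),
  [/\ measurable_fun setT theta, measurable_fun setT eta,
      measurable N /\ mu N = 0%E,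
      forall x, ~ N x -> eta (theta x) = x &
      forall n c, mu (theta @^-1` cyl n c) = (2 ^- n)%:E].
Proof.
move=> mr eK; pose theta x : cantor := digits 2 2^-1 (F (e x)).
pose eta (c : cantor) := r (q (radix 2 c)).
pose B (j : rat) := [set x | F (e x) = F (ratr j)].
pose N := ([set x | F (e x) = 0] `|` [set x | F (e x) = 1]) `|` \bigcup_j B j.
have mE t : measurable [set x | F (e x) = t].
  by rewrite (_ : mkset _ = (F \o e) @^-1` [set t])//; exact: (measurable_preimage mFe).
have [mB B0] := measure_bigcup0_count (F := B) (fun j => mE _) (fun j => F_level _).
have mN : measurable N by apply: measurableU => //; apply: measurableU.
have mtheta : measurable_fun setT theta.
  exact: (measurableT_comp (measurable_digits 2 2^-1) mFe).
exists theta, eta, N; split=> //.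
- apply: (measurableT_comp mr); apply: (measurableT_comp mq).
  exact: measurable_radix.
- split=> //; rewrite measureU0 ?B0//; last by apply: measurableU.
  by rewrite measureU0; [exact: F_level|exact: mE|exact: mE|exact: F_level].
- move=> x /not_orP[/not_orP[x0 x1] xB].
  have Fx01 : 0 < F (e x) < 1.
    rewrite !lt_neqAle F_ge0 F_le1 !andbT eq_sym.
    by apply/andP; split; apply/eqP.
  rewrite /eta /theta radix_digits2; last by lra.
  suff -> : q (F (e x)) = e x by rewrite eK.
  apply/eqP; rewrite eq_le q_le// lexx /= leNgt; apply/negP => qx.
  have [j] := rat_in_itvoo qx; rewrite in_itv/= => /andP[qj jx].
  apply: xB; exists j => //; apply/eqP; rewrite eq_le -q_le// (ltW qj)/=.
  exact/F_nd/ltW.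
- move=> n c.
  have ge0 := @radix_sum_ge0 R 2 (lexx _) n c.
  have le1 := @radix_sum2_le R n c.
  have z0 : 0 < 2 ^- n :> R by rewrite invr_gt0 exprn_gt0.
  pose s : R := radix_sum 2 n c.
  transitivity (mu ([set x | F (e x) < s + 2 ^- n] `\` [set x | F (e x) < s])).
    apply: (@measure_ae_eq _ _ _ _ _ _ [set x | F (e x) = 1]) => //.
    - by apply: measurable_preimage => //; exact: measurable_cyl.
    - exact: measurableD.
    move=> x /eqP x1; have Fx01 : 0 <= F (e x) < 1 by rewrite F_ge0 lt_neqAle x1 F_le1.
    split=> [/(digits2_cyl _ _ Fx01)/andP[h1 h2]|[/= h1 /negP h2]].
      by split=> //=; apply/negP; rewrite -leNgt.
    by apply/(digits2_cyl _ _ Fx01); rewrite -/s h1 leNgt h2.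
  rewrite measureD//; last by rewrite -ge0_fin_numE// fin_mu.
  rewrite setIidr; last by move=> x /= /lt_trans; apply; rewrite ltrDl.
  rewrite /= !F_unif /s; [|lra|lra].
  by rewrite -EFinB addrAC subrr add0r.
Qed.

End Uniformize.

(** A Borel code of the points by real numbers reduces the claim to a real random
    variable without atoms. *)
Theorem standard_borel_coin (R : realType) d (X : measurableType d) (mu : probability X R) :
  standard_borel R X -> (forall x, mu [set x] = 0%E) ->
  exists (theta : X -> cantor) (eta : cantor -> X) (N : set X),
  [/\ measurable_fun setT theta, measurable_fun setT eta,
      measurable N /\ mu N = 0%E,
      forall x, ~ N x -> eta (theta x) = x &
      forall n c, mu (theta @^-1` cyl n c) = (2 ^- n)%:E].
Proof.
move=> sX mu0.
have [x0 _] : [set: X] !=set0.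
  apply/set0P/negP => /eqP X0; have := probability_setT mu.
  by rewrite X0 measure0 => -[] /eqP; rewrite eq_sym oner_eq0.
have [e [r [me mr eK]]] := standard_borel_cantor x0 sX.
pose f x : R := radix 3 (e x); pose g (t : R) := r (digits 3 4^-1 t).
have fK : cancel f g by move=> x; rewrite /f /g digits_radix3 eK.
have mf : measurable_fun setT f.
  by apply: (measurableT_comp _ me); apply: measurable_radix; lra.
have mg : measurable_fun setT g by exact: (measurableT_comp mr (measurable_digits _ _)).
apply: (coin_code mf _ mg fK) => s.
have [[x <-]|nx] := pselect (exists x, f x = s).
  rewrite -(mu0 x); congr (mu _); apply/seteqP; split=> y /=; last by move=> ->.
  exact: (can_inj fK).
rewrite (_ : _ @^-1` _ = set0) ?measure0//.
by apply/seteqP; split=> y //= ys; apply: nx; exists y.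
Qed.

(** * Closed paths and their holonomy *)

(** The letter [inl n] stands for the move [alpha n], and [inr s] for the move
    [psi s], where [psi true] and [psi false] are inverse to each other. *)
Definition letter := (nat + bool)%type.

Section Paths.
Context {X : Type} {F : groupType} (g : nat -> F).
Context (alpha : nat -> X -> X) (psi : bool -> X -> X).

Definition step (l : letter) : X -> X :=
  match l with inl n => alpha n | inr s => psi s end.

Fixpoint run (w : seq letter) (x : X) : X :=
  if w is l :: w' then run w' (step l x) else x.

Lemma run_cat w1 w2 x : run (w1 ++ w2) x = run w2 (run w1 x).
Proof. by elim: w1 x => /=. Qed.

Fixpoint valid (B : set X) (w : seq letter) (x : X) : Prop :=
  if w is l :: w' then (if l is inr _ then B x else True) /\ valid B w' (step l x)
  else True.

Lemma valid_cat B w1 w2 x :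
  valid B (w1 ++ w2) x <-> valid B w1 x /\ valid B w2 (run w1 x).
Proof. by elim: w1 x => [|l w1 IH] x /=; [split=> [|[]]|rewrite IH; tauto]. Qed.

(** The moves [alpha] carry the labels [g], and a move of [psi true] from [z] the
    arbitrary label [kappa z]; the holonomy is the product of the labels along a
    path, the last one on the left as in a composition of maps. *)
Definition letter_hol (kappa : X -> F) (l : letter) (x : X) : F :=
  match l with
  | inl n => g n
  | inr true => kappa x
  | inr false => (kappa (psi false x))^-1%g
  end.

Fixpoint hol (kappa : X -> F) (w : seq letter) (x : X) : F :=
  if w is l :: w' then (hol kappa w' (step l x) * letter_hol kappa l x)%g else 1%g.

Lemma hol_cons kappa l w x :
  hol kappa (l :: w) x = (hol kappa w (step l x) * letter_hol kappa l x)%g.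
Proof. by []. Qed.

Lemma hol_cat kappa w1 w2 x :
  hol kappa (w1 ++ w2) x = (hol kappa w2 (run w1 x) * hol kappa w1 x)%g.
Proof.
by elim: w1 x => [|l w1 IH] x /=; rewrite ?mulg1// IH mulgA.
Qed.

Context (G B : set X).
Hypothesis alpha_good : forall n x, G x -> G (alpha n x).
Hypothesis psi_good : forall s x, G x -> B x -> G (psi s x) /\ B (psi s x).
Hypothesis psiK : forall s x, G x -> B x -> psi (~~ s) (psi s x) = x.
Hypothesis alpha_free : forall p x, G x ->
  run (map inl p) x = x -> (\prod_(n <- rev p) g n)%g = 1%g.
Hypothesis psi_free : forall s k x, G x -> B x ->
  run (nseq k (inr s)) x = x -> k = 0%N.
Hypothesis no_loop : forall n v s x, G x ->
  let w := inl n :: rcons v (inr s) in valid B w x -> run w x = x ->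
  exists w1 w2, [/\ w = w1 ++ w2, w1 != [::], w2 != [::] & run w1 x = x].

Lemma run_good w x : G x -> valid B w x -> G (run w x).
Proof.
elim: w x => //= -[n|s] w IH x Gx [Bx vx]; apply: IH => //; first exact: alpha_good.
by have [] := psi_good s Gx Bx.
Qed.

Lemma letters_split (w : seq letter) :
  (exists v1 s n v2, w = rcons v1 (inr s) ++ inl n :: v2) \/
  (exists p q, w = map inl p ++ map inr q).
Proof.
elim: w => [|l w [[v1 [s [n [v2 ->]]]]|[p [q ->]]]]; first by right; exists [::], [::].
  by left; exists (l :: v1), s, n, v2.
case: l => [n|s]; first by right; exists (n :: p), q.
case: p => [|n p]; first by right; exists [::], (s :: q).
by left; exists [::], s, n, (map inl p ++ map inr q).
Qed.

Lemma signs_split (q : seq bool) :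
  (exists q1 s q2, q = q1 ++ s :: ~~ s :: q2) \/ (exists k s, q = nseq k s).
Proof.
elim: q => [|t q [[q1 [s [q2 ->]]]|[k [s ->]]]]; first by right; exists 0%N, true.
  by left; exists (t :: q1), s, q2.
case: k => [|k]; first by right; exists 1%N, t.
have [->|/negPf ts] := eqVneq t s; first by right; exists k.+2, s.
left; exists [::], t, (nseq k s).
by move: ts; case: t; case: s.
Qed.

(** A shortest closed path with nontrivial holonomy cannot be cut at a
    repetition of its base point, hence visits it only once; turned so as to
    start with [alpha] and to end with [psi] it contradicts [no_loop]. *)
Theorem closed_path_hol kappa w x :
  G x -> valid B w x -> run w x = x -> hol kappa w x = 1%g.
Proof.
have [k] := ubnP (size w); elim: k w x => // k IH w x /ltnSE wk Gx vw wx.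
have proper n v s y : let u := inl n :: rcons v (inr s) in (size u <= k)%N ->
    G y -> valid B u y -> run u y = y -> hol kappa u y = 1%g.
  move=> u uk Gy vu uy; have [w1 [w2 [uE w10 w20 w1y]]] := no_loop Gy vu uy.
  move: vu uy uk; rewrite (uE : u = _) => /valid_cat[v1 v2].
  rewrite run_cat w1y in v2 *; rewrite size_cat => w2y uk.
  have s1 : (0 < size w1)%N by rewrite lt0n size_eq0.
  have s2 : (0 < size w2)%N by rewrite lt0n size_eq0.
  rewrite hol_cat w1y (IH w2 y)// ?(IH w1 y)// ?mulg1//.
    by apply: leq_trans uk; rewrite -addn1 leq_add2l.
  by apply: leq_trans uk; rewrite -addn1 addnC leq_add2r.
have [[v1 [s [n [v2 wE]]]]|[p [q wE]]] := letters_split w.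
  move: vw wx wk; rewrite wE => /valid_cat[w1 w2]; rewrite run_cat => w12.
  set y := run (rcons v1 (inr s)) x in w2 w12 *.
  have Gy : G y by exact: run_good.
  have e : (inl n :: v2) ++ rcons v1 (inr s) = inl n :: rcons (v2 ++ v1) (inr s).
    by rewrite -rcons_cat.
  rewrite size_cat addnC -size_cat e => wk.
  have := proper n (v2 ++ v1) s y wk Gy; rewrite -e hol_cat w12 hol_cat -/y => h.
  have {h} : (hol kappa (rcons v1 (inr s)) x * hol kappa (inl n :: v2) y)%g = 1%g.
    by apply: h; [apply/valid_cat; rewrite w12|rewrite run_cat w12].
  by move=> /(canRL (mulKg _)); rewrite mulg1 => ->; rewrite mulVg.
case: p wE => [wE|n p wE]; last first.
  case/lastP: q wE => [|q s] wE.
    have hE m z : hol kappa (map inl m) z = (\prod_(i <- rev m) g i)%g.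
      elim: m z => [|i m IHm] z /=; first by rewrite big_nil.
      by rewrite IHm rev_cons big_rcons /=.
    move: wx; rewrite wE cats0 => /(alpha_free Gx).
    by rewrite hE.
  have e : w = inl n :: rcons (map inl p ++ map inr q) (inr s).
    by rewrite wE map_rcons -rcons_cat.
  by rewrite e; apply: proper; rewrite -?e.
have [q0|q0] := eqVneq q [::]; first by rewrite wE q0.
rewrite cat0s in wE; have Bx : B x.
  by move: vw; rewrite wE; case: (q) q0 => //= s q' _ [].
have [[q1 [s [q2 qE]]]|[j [s qE]]] := signs_split q; last first.
  have := @psi_free s j x Gx Bx; rewrite -map_nseq -qE -wE => /(_ wx) j0.
  by rewrite wE qE j0.
have wE' : w = map inr q1 ++ inr s :: inr (~~ s) :: map inr q2.
  by rewrite wE qE map_cat.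
move: vw wx wk; rewrite wE' => /valid_cat[v1 /= [By [_ v2]]].
rewrite run_cat /= size_cat /=; set y := run _ x in By v2 *.
have Gy : G y by exact: run_good.
rewrite psiK// in v2 * => yx wk.
have hE : letter_hol kappa (inr (~~ s)) (step (inr s) y) =
    (letter_hol kappa (inr s) y)^-1%g.
  by have := psiK s Gy By; case: (s) => /= [->|_]; rewrite ?invgK.
rewrite hol_cat -/y !hol_cons hE mulgVK [step _ (step _ _)]psiK//.
rewrite -hol_cat; apply: IH => //; first by rewrite size_cat; lia.
  by apply/valid_cat.
by rewrite run_cat.
Qed.

End Paths.

(** * A random conjugate of the odometer *)

(** The coin with number [pickle s] decides on the exchange at the node [s], so a
    point of the Cantor space encodes a tree automorphism. *)
Definition node_bits (w : cantor) (s : seq bool) : bool := w (pickle s).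

Definition phi (w : cantor) : cantor -> cantor := tree (node_bits w).
Definition phi_inv (w : cantor) : cantor -> cantor := tree_inv (node_bits w).

Definition phi_isometry w : isometry (phi w) (phi_inv w) := tree_isometry _.

Definition rand_odo (w : cantor) (s : bool) : cantor -> cantor :=
  phi w \o odo_pm s \o phi_inv w.

Lemma rand_odo_isometry w s : isometry (rand_odo w s) (rand_odo w (~~ s)).
Proof.
apply: (isometry_comp (f' := odo_pm (~~ s) \o phi_inv w)).
  exact: isometry_comp (phi_isometry w) (odo_pm_isometry s).
exact/isometryV/phi_isometry.
Qed.

Section JointMeasurability.
Context {d} {T : measurableType d}.
Implicit Types w c : T -> cantor.

Local Lemma measurable_bit c n (b : bool) : measurable_fun setT c ->
  measurable [set t | c t n = b].
Proof.
move=> mc; case: b; first exact: measurable_coord.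
rewrite (_ : mkset _ = ~` [set t | c t n]); first exact/measurableC/measurable_coord.
by apply/seteqP; split=> t /=; [move=> ->|move/negP/negbTE].
Qed.

Local Lemma measurable_xor w c n s : measurable_fun setT w -> measurable_fun setT c ->
  forall b, measurable [set t | c t n (+) node_bits (w t) s = b].
Proof.
move=> mw mc b; rewrite (_ : mkset _ = [set t | exists b',
    c t n = b' /\ node_bits (w t) s = b (+) b']).
  by apply: measurable_ex => b'; apply: measurable_conj; exact: measurable_bit.
apply/seteqP; split=> t /=.
  by move=> <-; exists (c t n); rewrite addbAC addbb.
by move=> [_ [<- ->]]; rewrite addbC addbK.
Qed.

Lemma measurable_phi w c : measurable_fun setT w -> measurable_fun setT c ->
  measurable_fun setT (fun t => phi (w t) (c t)).
Proof.
move=> mw mc; apply: measurable_to_cantor => // n; rewrite setTI.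
have mp s : measurable [set t | prefix_of (c t) n = s].
  have [sn|sn] := eqVneq (size s) n; last first.
    rewrite (_ : mkset _ = set0)//; apply/seteqP; split=> t //= e.
    by rewrite -e size_prefix_of eqxx in sn.
  rewrite (_ : mkset _ = c @^-1` cyl n (nth true s)).
    by apply: (measurable_preimage mc); exact: measurable_cyl.
  apply/seteqP; split=> t /=.
    by move=> <- i ni; rewrite nth_mkseq.
  move=> e; apply: (@eq_from_nth _ true); rewrite size_prefix_of// => i ni.
  by rewrite nth_mkseq//; exact: e.
rewrite (_ : mkset _ = [set t | exists s, prefix_of (c t) n = s /\
    c t n (+) node_bits (w t) s = true]).
  by apply: measurable_ex => s; apply: measurable_conj => //; exact: measurable_xor.
apply/seteqP; split=> t /=; first by exists (prefix_of (c t) n).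
by move=> [_ [<-]].
Qed.

Lemma measurable_phi_inv w c : measurable_fun setT w -> measurable_fun setT c ->
  measurable_fun setT (fun t => phi_inv (w t) (c t)).
Proof.
move=> mw mc; apply: measurable_to_cantor => // n; rewrite setTI.
have mp k s : measurable [set t | tree_prefix (node_bits (w t)) (c t) k = s].
  elim: k s => [|k IH] s; first exact: (measurable_prop ([::] = s)).
  rewrite (_ : mkset _ = [set t | exists s' b,
      tree_prefix (node_bits (w t)) (c t) k = s' /\
      (c t k (+) node_bits (w t) s' = b /\ rcons s' b = s)]).
    apply: measurable_ex => s'; apply: measurable_ex => b.
    apply: measurable_conj => //; apply: measurable_conj; first exact: measurable_xor.
    exact: measurable_prop.
  apply/seteqP; split=> t /=; last by move=> [_ [_ [<- [<-]]]].
  by move=> <-; do 2 eexists; split; [reflexivity|split].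
rewrite (_ : mkset _ = [set t | exists s,
    tree_prefix (node_bits (w t)) (c t) n = s /\
    c t n (+) node_bits (w t) s = true]).
  by apply: measurable_ex => s; apply: measurable_conj => //; exact: measurable_xor.
apply/seteqP; split=> t /=; last by move=> [_ [<-]].
by eexists; split; first reflexivity.
Qed.

Lemma measurable_odo_pm s c : measurable_fun setT c ->
  measurable_fun setT (fun t => odo_pm s (c t)).
Proof. exact: (measurableT_comp (measurable_isometry (odo_pm_isometry s))). Qed.

Lemma measurable_rand_odo w c s : measurable_fun setT w -> measurable_fun setT c ->
  measurable_fun setT (fun t => rand_odo (w t) s (c t)).
Proof.
move=> mw mc; apply: measurable_phi => //; apply: measurable_odo_pm.
exact: measurable_phi_inv.
Qed.

End JointMeasurability.

(** ** Flipping one level below a node *)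

Section Flip.
Context (sigma : seq bool).
Let V := cyl (size sigma) (nth true sigma).

(** Reverses the decisions at all the nodes that lie [k] levels below [sigma]: this
    changes the image of the ends through [sigma], in one digit that depends on
    [k], and no other image. *)
Definition flip (k : nat) (w : cantor) : cantor := fun i => w i (+)
  (if unpickle i is Some tau then
     (size tau == size sigma + k)%N && (take (size sigma) tau == sigma) else false).

Lemma flip_isometry k : isometry (flip k) (flip k).
Proof. by split=> [c|c|n c c' e i ni|n c c' e i ni]; rewrite /flip ?addbK ?e//;
  apply/funext => i; rewrite addbK. Qed.

Lemma phi_flip k w c n : phi (flip k w) c n =
  phi w c n (+) ((n == size sigma + k)%N && `[< V c >]).
Proof.
rewrite /phi /tree /node_bits /flip pickleK addbA size_prefix_of.
congr (_ (+) _); case: eqP => //= ->; apply/eqP/asboolP => [e i ni|Vc].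
  have := congr1 (nth true ^~ i) e; rewrite nth_take// nth_mkseq//.
  exact/ltn_addr.
apply: (@eq_from_nth _ true) => [|i].
  by rewrite size_takel// size_mkseq leq_addr.
rewrite size_takel ?size_mkseq ?leq_addr// => ni.
by rewrite nth_take// nth_mkseq ?ltn_addr//; exact: Vc.
Qed.

Lemma phi_flip_out k w c : ~ V c -> phi (flip k w) c = phi w c.
Proof.
move=> nV; apply/funext => n; rewrite phi_flip.
by case: asboolP => //; rewrite andbF addbF.
Qed.

Lemma phi_inv_flip_out k w y : ~ V (phi_inv w y) -> phi_inv (flip k w) y = phi_inv w y.
Proof.
move=> /(phi_flip_out k w) e; apply: (can_inj (isoK (phi_isometry (flip k w)))).
by rewrite e (isoKV (phi_isometry _)) (isoKV (phi_isometry _)).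
Qed.

End Flip.

Section RandomPaths.
Context {X : Type} (alpha : nat -> X -> X) (B : set X) (theta : X -> cantor)
  (eta : cantor -> X).

Definition psi_of (w : cantor) (s : bool) (x : X) : X :=
  if `[< B x >] then eta (rand_odo w s (theta x)) else x.

(** The two points of the Cantor space at which the random tree automorphism is
    read when [psi_of w s] is applied to a point with code [c] stay outside [V]. *)
Definition misses (w : cantor) (s : bool) (V : set cantor) (c : cantor) :=
  ~ V (phi_inv w c) /\ ~ V (odo_pm s (phi_inv w c)).

Fixpoint avoids (w : cantor) (v : seq letter) (V : set cantor) (x : X) : Prop :=
  if v is l :: v' then
    (if l is inr s then B x -> misses w s V (theta x) else True) /\
    avoids w v' V (step alpha (psi_of w) l x)
  else True.

Lemma avoidsP w v V x :
  (forall v1 s v2, v = v1 ++ inr s :: v2 ->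
     let y := run alpha (psi_of w) v1 x in B y -> misses w s V (theta y)) ->
  avoids w v V x.
Proof.
elim: v x => //= l v IH x H; split.
  by case: l H => // s H; exact: (H [::] s v).
by apply: IH => v1 s v2 e; apply: (H (l :: v1) s v2); rewrite e.
Qed.

Lemma avoidsS w v (V V' : set cantor) x : V' `<=` V -> avoids w v V x -> avoids w v V' x.
Proof.
move=> VV; elim: v x => //= l v IH x [h /IH h']; split=> //.
by case: l h {h'} => // s h Bx; have [h1 h2] := h Bx; split=> /VV.
Qed.

(** Only finitely many points are read along a path, so a point distinct from
    all of them has a neighbourhood that avoids them. *)
Lemma avoids_cyl w v c x : avoids w v [set c] x -> exists n, avoids w v (cyl n c) x.
Proof.
have sep (c' : cantor) : c' <> c -> exists n, ~ cyl n c c'.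
  move=> cc; apply/existsNP => H; apply: cc; apply: agree_eq => n; exact: H.
have mono n n' : (n <= n')%N -> cyl n' c `<=` cyl n c.
  by move=> nn z zc i ni; apply: zc; exact: leq_trans nn.
elim: v x => [|l v IH] x /=; first by move=> _; exists 0%N.
move=> [h /IH[n hn]]; case: l h hn => [m|s] h hn; first by exists n.
have [Bx|nBx] := pselect (B x); last by exists n; split.
have [/sep[n1 h1] /sep[n2 h2]] := h Bx.
exists (maxn n (maxn n1 n2)); split; last first.
  by apply: avoidsS hn; apply: mono; rewrite leq_maxl.
by move=> _; split => /mono; [move=> /(_ n1)|move=> /(_ n2)];
  rewrite !leq_max leqnn ?orbT => /(_ isT).
Qed.

(** The event that the path spelled by [v] followed by [inr s] closes up at [x]
    and that its last step reads the random automorphism at a point in the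
    cylinder of [sigma], where it has not been read before. *)
Definition fresh_loop (v : seq letter) (s : bool) (sigma : seq bool) :
    set (cantor * X) := [set z |
  let V := cyl (size sigma) (nth true sigma) in
  let y := run alpha (psi_of z.1) v z.2 in
  let u := phi_inv z.1 (theta y) in
  avoids z.1 v V z.2 /\
  (~ V u /\ (V (odo_pm s u) /\ phi z.1 (odo_pm s u) = theta z.2))].

Lemma flip_path sigma k w v x (V := cyl (size sigma) (nth true sigma)) :
  avoids w v V x ->
  run alpha (psi_of (flip sigma k w)) v x = run alpha (psi_of w) v x /\
  avoids (flip sigma k w) v V x.
Proof.
elim: v x => //= l v IH x [h hv].
have e : step alpha (psi_of (flip sigma k w)) l x = step alpha (psi_of w) l x.
  case: l h {hv} => //= s h; rewrite /psi_of; case: asboolP => // /h[h1 h2].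
  by rewrite /rand_odo/= phi_inv_flip_out// phi_flip_out.
rewrite e; have [e2 av] := IH _ hv; split=> //; split=> //.
case: l h {e e2 av hv} => // s h Bx; have [h1 h2] := h Bx.
by split; rewrite phi_inv_flip_out.
Qed.

(** The path up to its last step is not affected by the flips, which however
    change a digit of its end point, so at most one of them closes it up. *)
Lemma flip_fresh_loop v s sigma k k' w x :
  fresh_loop v s sigma (flip sigma k w, x) ->
  fresh_loop v s sigma (flip sigma k' w, x) -> k = k'.
Proof.
set V := cyl (size sigma) (nth true sigma).
suff H w1 : fresh_loop v s sigma (w1, x) ->
    fresh_loop v s sigma (flip sigma k' (flip sigma k w1), x) -> k = k'.
  move=> h h'; apply: (H (flip sigma k w)) => //.
  by rewrite (isoK (flip_isometry sigma k)).
move=> [/= av [Vu [Vu' e]]] [/= av2 [_ []]].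
have [r1 av1] := flip_path k av.
have [r2 _] := flip_path k' av1.
rewrite r2 r1.
set y := run _ _ _ _ in Vu Vu' e *.
have e1 : phi_inv (flip sigma k w1) (theta y) = phi_inv w1 (theta y).
  by rewrite phi_inv_flip_out.
rewrite phi_inv_flip_out ?e1// => _; set u' := odo_pm s _ in Vu' e *.
rewrite -e => /(congr1 (fun c : cantor => c (size sigma + k)%N)).
rewrite !phi_flip eqxx eqn_add2l asboolT//= andbT.
by have [//|ne] := eqVneq k k'; case: (phi _ _ _).
Qed.

End RandomPaths.

Section FreshLoopNull.
Context {R : realType} {d} {X : measurableType d} (mu : probability X R).
Context (m : probability cantor R) (mcoin : coin m).
Context (alpha : nat -> X -> X) (B : set X) (theta : X -> cantor) (eta : cantor -> X).
Hypothesis malpha : forall n, measurable_fun setT (alpha n).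
Hypothesis mB : measurable B.
Hypothesis mtheta : measurable_fun setT theta.
Hypothesis meta : measurable_fun setT eta.

Section Joint.
Context {d'} {T : measurableType d'}.
Implicit Types (w : T -> cantor) (p : T -> X).

Local Lemma measurable_section p : measurable_fun setT p -> measurable [set t | B (p t)].
Proof. by move=> mp; exact: (measurable_preimage mp mB). Qed.

Lemma measurable_psi_of w p s : measurable_fun setT w -> measurable_fun setT p ->
  measurable_fun setT (fun t => psi_of B theta eta (w t) s (p t)).
Proof.
move=> mw mp; apply: measurable_fun_ifT => //.
  apply: (@measurable_fun_bool _ T _ _ true); rewrite setTI.
  rewrite (_ : _ @^-1` _ = [set t | B (p t)]); first exact: measurable_section.
  by apply/seteqP; split=> t /= => [/asboolP|/asboolP].
apply: (measurableT_comp meta); apply: measurable_rand_odo => //.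
exact: (measurableT_comp mtheta mp).
Qed.

Lemma measurable_run w p v : measurable_fun setT w -> measurable_fun setT p ->
  measurable_fun setT (fun t => run alpha (psi_of B theta eta (w t)) v (p t)).
Proof.
move=> mw; elim: v p => //= l v IH p mp; apply: IH.
case: l => [n|s] /=; first exact: (measurableT_comp (malpha n) mp).
exact: measurable_psi_of.
Qed.

Lemma measurable_avoids w p v V : measurable V ->
  measurable_fun setT w -> measurable_fun setT p ->
  measurable [set t | avoids alpha B theta eta (w t) v V (p t)].
Proof.
move=> mV mw; elim: v p => [|l v IH] p mp /=; first exact: measurable_prop.
apply: measurable_conj; last first.
  apply: IH; case: l => [n|s] /=; first exact: (measurableT_comp (malpha n) mp).
  exact: measurable_psi_of.
case: l => [n|s]; first exact: measurable_prop.
have mu1 : measurable_fun setT (fun t => phi_inv (w t) (theta (p t))).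
  by apply: measurable_phi_inv => //; exact: (measurableT_comp mtheta mp).
apply: measurable_imp; first exact: measurable_section.
apply: measurable_conj; apply: measurable_not; first exact: (measurable_preimage mu1 mV).
exact: (measurable_preimage (measurable_odo_pm s mu1) mV).
Qed.

End Joint.

Lemma measurable_fresh_loop v s sigma :
  measurable (fresh_loop alpha B theta eta v s sigma).
Proof.
have m1 : measurable_fun setT (fst : cantor * X -> cantor) by exact: measurable_fst.
have m2 : measurable_fun setT (snd : cantor * X -> X) by exact: measurable_snd.
have mV : measurable (cyl (size sigma) (nth true sigma) : set cantor).
  exact: measurable_cyl.
have mu1 : measurable_fun setT (fun z : cantor * X =>
    phi_inv z.1 (theta (run alpha (psi_of B theta eta z.1) v z.2))).
  apply: measurable_phi_inv => //; apply: (measurableT_comp mtheta).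
  exact: measurable_run.
have mu2 := measurable_odo_pm s mu1.
apply: measurable_conj; first exact: measurable_avoids.
apply: measurable_conj; first by apply: measurable_not; exact: (measurable_preimage mu1 mV).
apply: measurable_conj; first exact: (measurable_preimage mu2 mV).
apply: measurable_eq_cantor; first exact: measurable_phi.
exact: (measurableT_comp mtheta).
Qed.

(** Flipping the levels below [sigma] one at a time produces infinitely many
    disjoint events of equal probability. *)
Lemma fresh_loop_section0 v s sigma x :
  m (ysection (fresh_loop alpha B theta eta v s sigma) x) = 0%E.
Proof.
have mE := measurable_ysection x (measurable_fresh_loop v s sigma).
set E := ysection _ x in mE *.
have mf k := measurable_isometry (flip_isometry sigma k).
apply: (@measure0_disjoint _ cantor R m _ (fun k => flip sigma k @^-1` E)) => [k|k k' _ _|k].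
- exact: (measurable_preimage (mf k)).
- by move=> [w [/= /ysectionP h /ysectionP h']]; apply: flip_fresh_loop h h'.
- exact: (isometry_preserving mcoin (flip_isometry sigma k)).
Qed.

(** By Fubini almost every tree automorphism makes all these countably many events
    negligible. *)
Lemma fresh_loop_null : exists w : cantor, forall v s sigma,
  mu (xsection (fresh_loop alpha B theta eta v s sigma) w) = 0%E.
Proof.
pose E (j : seq letter * bool * seq bool) :=
  fresh_loop alpha B theta eta j.1.1 j.1.2 j.2.
have mE j : measurable (E j) by exact: measurable_fresh_loop.
pose f j w := mu (xsection (E j) w).
have mf j : measurable_fun setT (f j) by exact: measurable_fun_xsection.
have f0 j : (\int[m]_w f j w = 0)%E.
  have -> : (\int[m]_w f j w = \int[mu]_x m (ysection (E j) x))%E.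
    have := indic_fubini_tonelli m mu (mE j).
    by rewrite indic_fubini_tonelli_FE// indic_fubini_tonelli_GE.
  by apply: integral0_eq => x _; exact: fresh_loop_section0.
have mN j : measurable [set w | f j w != 0%E].
  have := mf j measurableT [set~ 0%E]; rewrite setTI.
  rewrite (_ : _ @^-1` _ = [set w | f j w != 0%E]); first by apply; exact: measurableC.
  by apply/seteqP; split=> w /= => [/eqP|/eqP].
have N0 j : m [set w | f j w != 0%E] = 0%E.
  have [|Z [mZ Z0 ZN]] := (iffLR (ae_eq_integral_abs m measurableT (mf j))).
    by rewrite -[RHS](f0 j); apply: eq_integral => w _; rewrite gee0_abs.
  apply: (@subset_measure0 _ cantor _ m _ Z) => // w /= /eqP fw.
  by apply: ZN => /= /(_ I).
have [_ NU] := measure_bigcup0_count mN N0.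
have [w Nw] : (~` \bigcup_j [set w | f j w != 0%E]) !=set0.
  apply/set0P/negP => /eqP e.
  have := probability_setC m (proj1 (measure_bigcup0_count mN N0)).
  rewrite e measure0 NU sube0 => /eqP.
  by rewrite eq_sym onee_eq0.
exists w => v s sigma; apply: contrapT => /eqP h; apply: Nw.
by exists (v, s, sigma).
Qed.

End FreshLoopNull.

(** * An ergodic transformation of a set, freely independent of an action *)

(** The normalized restriction of [mu] to [B] is again standard and without
    atoms. *)
Lemma coin_coordinates (R : realType) d (X : measurableType d) (mu : probability X R)
    (B : set X) :
  standard_borel R X -> (forall x, mu [set x] = 0%E) ->
  measurable B -> mu B != 0%E ->
  exists (m : probability cantor R) (theta : X -> cantor) (eta : cantor -> X) (N : set X),
  [/\ coin m, measurable_fun setT theta, measurable_fun setT eta,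
      measurable N /\ mu N = 0%E &
      (forall x, B x -> ~ N x -> eta (theta x) = x) /\
      (forall D, measurable D -> mu (B `&` theta @^-1` D) = (mu B * m D)%E)].
Proof.
move=> sX mu0 mB B0.
pose nu : probability X R := mnormalize (mrestr mu mB) mu.
have muB : mu B = (fine (mu B))%:E by rewrite fineK// fin_mu.
have nuE A : nu A = (mu (A `&` B) * ((fine (mu B))^-1)%:E)%E.
  have e1 : mrestr mu mB setT = mu B by rewrite /mrestr setTI.
  by rewrite /nu /= /mnormalize /= e1 (negPf B0) muB.
have fB0 : fine (mu B) != 0 by apply: contraNneq B0 => e; rewrite muB e.
have nu1 x : nu [set x] = 0%E.
  rewrite nuE (_ : mu _ = 0%E) ?mul0e//.
  have [Bx|nBx] := pselect (B x).
    by rewrite setIidl// => _ ->.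
  rewrite (_ : _ `&` _ = set0) ?measure0//.
  by apply/seteqP; split=> // y [-> ].
have [theta [eta [N [mtheta meta [mN N0] tK tc]]]] := standard_borel_coin sX nu1.
pose mt := isMeasurableFun.Build _ _ _ _ theta mtheta.
pose th : {mfun X >-> cantor} := HB.pack theta mt.
exists (distribution nu th), theta, eta, (N `&` B); split=> //.
- split; first exact: measurableI.
  move: N0; rewrite nuE => /eqP.
  by rewrite mule_eq0 eqe invr_eq0 (negPf fB0) orbF => /eqP.
- split=> [x Bx nN|D mD]; first by apply: tK => Nx; apply: nN.
  transitivity (mu B * (mu (theta @^-1` D `&` B) * ((fine (mu B))^-1)%:E))%E; last first.
    by congr (_ * _)%E; exact/esym/nuE.
  rewrite setIC; move: muB fB0; case: (mu B) => // b _ /= b0.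
  have : mu (theta @^-1` D `&` B) \is a fin_num.
    by apply: fin_mu; apply: measurableI => //; exact: (measurable_preimage mtheta).
  case: (mu _) => // r _; rewrite -!EFinM; congr EFin.
  by rewrite mulrCA divff// mulr1.
Qed.

Section Companion.
Context {R : realType} {d} {X : measurableType d} {mu : probability X R}.
Context {F : groupType} (g : nat -> F) (a : mp_action F mu) (B : set X).

(** The pair of maps [psi true] and [psi false] is a transformation of [B]
    together with its inverse, well behaved on the conull set [G]. The field
    [companion_hol] says that it satisfies no relation with the action, and for the
    moves of the action alone that the action is free on [G]. *)
Record companion (G : set X) (psi : bool -> X -> X) : Prop := {
  companion_measurable_good : measurable G ;
  companion_null : mu (~` G) = 0%E ;
  companion_act : forall h x, G x -> G (a h x) ;
  companion_measurable : forall s, measurable_fun setT (psi s) ;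
  companion_preserving : forall s A, measurable A -> mu (psi s @^-1` A) = mu A ;
  companion_in : forall s x, G x -> B x -> G (psi s x) /\ B (psi s x) ;
  companion_out : forall s x, ~ (G x /\ B x) -> psi s x = x ;
  companionK : forall s x, psi (~~ s) (psi s x) = x ;
  companion_hol : forall kappa w x, G x -> valid (fun n => a (g n)) psi B w x ->
    run (fun n => a (g n)) psi w x = x ->
    hol g (fun n => a (g n)) psi kappa w x = 1%g ;
  companion_ergodic : forall A, measurable A ->
    (forall x, A (psi true x) <-> A x) -> mu (B `&` A) = 0%E \/ mu (B `\` A) = 0%E
}.

End Companion.

Section CompanionExists.
Context {R : realType} {d} {X : measurableType d} {mu : probability X R}.
Context {F : groupType} (g : nat -> F) (g_surj : forall h, exists n, g n = h).
Context (a : mp_action F mu).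
Context (B : set X) (mB : measurable B).
Context (m : probability cantor R) (theta : X -> cantor) (eta : cantor -> X) (N : set X).
Hypothesis mcoin : coin m.
Hypothesis mtheta : measurable_fun setT theta.
Hypothesis meta : measurable_fun setT eta.
Hypothesis mN : measurable N.
Hypothesis N0 : mu N = 0%E.
Hypothesis thetaK : forall x, B x -> ~ N x -> eta (theta x) = x.
Hypothesis thetaE : forall D, measurable D -> mu (B `&` theta @^-1` D) = (mu B * m D)%E.
Hypothesis B0 : mu B != 0%E.

Let alpha n := act a (g n).
Let B1 := B `\` N.

Local Lemma measurable_B1 : measurable B1. Proof. exact: measurableD. Qed.
#[local] Hint Resolve measurable_B1 : core.

Local Lemma theta_null D : measurable D -> mu (B `&` theta @^-1` D) = 0%E <-> m D = 0%E.
Proof.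
move=> mD; rewrite thetaE//; split=> [/eqP|->]; last by rewrite mule0.
by rewrite mule_eq0 (negPf B0) => /eqP.
Qed.

Local Lemma m_null (D : set cantor) (A : set X) : measurable D -> measurable A -> mu A = 0%E ->
  (forall x, B x -> ~ A x -> ~ D (theta x)) -> m D = 0%E.
Proof.
move=> mD mA A0 AD; apply/theta_null => //.
have mBD : measurable (B `&` theta @^-1` D).
  by apply: measurableI => //; exact: (measurable_preimage mtheta mD).
apply: (subset_measure0 _ mA _ A0) => // x [Bx Dx].
by apply: contrapT => /(AD _ Bx).
Qed.

Context (w : cantor).
Hypothesis w_null : forall v s sigma,
  mu (xsection (fresh_loop alpha B1 theta eta v s sigma) w) = 0%E.

Let psi0 := psi_of B1 theta eta w.

Local Lemma psi0_in s x : B1 x -> psi0 s x = eta (rand_odo w s (theta x)).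
Proof. by move=> Bx; rewrite /psi0 /psi_of asboolT. Qed.

Local Lemma psi0_out s x : ~ B1 x -> psi0 s x = x.
Proof. by move=> Bx; rewrite /psi0 /psi_of asboolF. Qed.

Local Lemma measurable_psi0 s : measurable_fun setT (psi0 s).
Proof.
exact: (measurable_psi_of measurable_B1 mtheta meta s (measurable_cst w) (@measurable_id _
  X setT)).
Qed.
#[local] Hint Resolve measurable_psi0 : core.

Local Lemma psi0_preserving s A : measurable A -> mu (psi0 s @^-1` A) = mu A.
Proof.
move=> mA.
have mp f (C : set cantor) : measurable_fun setT f -> measurable C ->
  measurable (f @^-1` C : set X) by move=> mf mC; exact: (measurable_preimage mf mC).
have meA : measurable (eta @^-1` A) by exact: (measurable_preimage meta mA).
have mr := measurable_isometry (rand_odo_isometry w s).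
have mreA := measurable_preimage mr meA.
transitivity (mu ((B `&` theta @^-1` (rand_odo w s @^-1` (eta @^-1` A))) `|` (A `\` B))).
  apply: (measure_ae_eq _ _ mN N0).
  - exact: (measurable_preimage (measurable_psi0 s) mA).
  - by apply: measurableU; [apply: measurableI => //; exact: (mp _ _ mtheta mreA)|
    exact: measurableD].
  move=> x Nx /=; have [Bx|nBx] := pselect (B x).
    rewrite psi0_in//; split=> [?|[[]//|[]//]]; by left.
  by rewrite psi0_out; [split=> [?|[[]//|[]//]]; right|move=> []].
rewrite measureU//=; last 3 first.
- by apply: measurableI => //; exact: (mp _ _ mtheta mreA).
- exact: measurableD.
- by apply/seteqP; split=> // x [[? _] []].
rewrite thetaE// (isometry_preserving mcoin (rand_odo_isometry w s))//.
rewrite -thetaE//.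
rewrite -measureU//; last 3 first.
- by apply: measurableI => //; exact: (mp _ _ mtheta meA).
- exact: measurableD.
- by apply/seteqP; split=> // x [[? _] []].
apply: (measure_ae_eq _ _ mN N0) => //.
  by apply: measurableU; [apply: measurableI => //; exact: (mp _ _ mtheta meA)|
    exact: measurableD].
move=> x Nx; have [Bx|nBx] := pselect (B x).
  by split=> [[[_ /=]|[]//]|Ax]; rewrite ?thetaK//; left; split=> //=; rewrite thetaK.
by split=> [[[]//|[]//]|Ax]; right.
Qed.

(** Points where the coordinates of [psi0 s x] are not those expected. *)
Let inexact s := [set x | B1 x /\
  (~ B1 (psi0 s x) \/ theta (psi0 s x) <> rand_odo w s (theta x))].

(** The sequences that are not the coordinates of a point of [B1]. *)
Let bad_code := [set c | ~ B1 (eta c) \/ theta (eta c) <> c].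

Local Lemma measurable_bad_code : measurable bad_code.
Proof.
apply: measurable_disj; apply: measurable_not;
  first exact: (measurable_preimage meta measurable_B1).
apply: measurable_eq_cantor; last exact: (@measurable_id _ cantor).
exact: (measurableT_comp mtheta meta).
Qed.
#[local] Hint Resolve measurable_bad_code : core.

Local Lemma bad_code0 : m bad_code = 0%E.
Proof.
apply: (m_null measurable_bad_code mN N0) => x Bx Nx.
by rewrite /bad_code /= thetaK// => -[]; apply.
Qed.
#[local] Hint Resolve bad_code0 : core.

Local Lemma measurable_inexact s : measurable (inexact s).
Proof.
apply: measurable_conj; first exact: measurable_B1.
apply: measurable_disj; apply: measurable_not.
  exact: (measurable_preimage (measurable_psi0 s) measurable_B1).
apply: measurable_eq_cantor; first exact: (measurableT_comp mtheta (measurable_psi0 s)).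
exact: (measurableT_comp (measurable_isometry (rand_odo_isometry w s)) mtheta).
Qed.
#[local] Hint Resolve measurable_inexact : core.

Local Lemma inexact0 s : mu (inexact s) = 0%E.
Proof.
have mr := measurable_isometry (rand_odo_isometry w s).
have mD := measurable_preimage mr measurable_bad_code.
have /(theta_null mD) D0 : m (rand_odo w s @^-1` bad_code) = 0%E.
  by rewrite (isometry_preserving mcoin (rand_odo_isometry w s)).
have mBD : measurable (B `&` theta @^-1` (rand_odo w s @^-1` bad_code)).
  by apply: measurableI => //; exact: (measurable_preimage mtheta mD).
apply: (subset_measure0 (measurable_inexact s) mBD _ D0) => x [B1x].
by rewrite psi0_in// => h; split=> //; case: B1x.
Qed.
#[local] Hint Resolve inexact0 : core.

Context (Na : set X).
Hypothesis mNa : measurable Na.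
Hypothesis Na0 : mu Na = 0%E.
Hypothesis Na_free : forall x, ~ Na x -> forall h, a h x = x -> h = 1%g.

Let E (j : seq letter * bool * seq bool) :=
  xsection (fresh_loop alpha B1 theta eta j.1.1 j.1.2 j.2) w.

(** The points to be removed: those from which a loop closes up at a fresh reading
    of the random automorphism, those whose stabilizer may be nontrivial, and those
    at which the coordinates of [B] fail. The set [G] of the points from which no path reaches them is
    invariant, and its complement is a countable union of null sets because the
    moves preserve the measure. *)
Let exceptional := ((\bigcup_j E j `|` Na) `|` (B `&` N)) `|` (inexact true `|` inexact false).

Local Lemma measurable_alpha n : measurable_fun setT (alpha n).
Proof. exact: measurable_act. Qed.
#[local] Hint Resolve measurable_alpha : core.

Local Lemma E_null : measurable (\bigcup_j E j) /\ mu (\bigcup_j E j) = 0%E.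
Proof.
apply: measure_bigcup0_count => j; last exact: w_null.
by apply: measurable_xsection; exact: measurable_fresh_loop.
Qed.

Local Lemma measurable_exceptional : measurable exceptional.
Proof.
have [mE _] := E_null.
by repeat first [exact: measurable_inexact|exact: measurableI|exact: mE|exact: mNa
  |apply: measurableU].
Qed.
#[local] Hint Resolve measurable_exceptional : core.

Local Lemma exceptional0 : mu exceptional = 0%E.
Proof.
have [mE E0] := E_null.
have mBN : measurable (B `&` N) by exact: measurableI.
have m2 : measurable (\bigcup_j E j `|` Na) by exact: measurableU.
have m3 : measurable (\bigcup_j E j `|` Na `|` B `&` N) by exact: measurableU.
have m4 : measurable (inexact true `|` inexact false).
  by apply: measurableU; exact: measurable_inexact.
have BN0 : mu (B `&` N) = 0%E by apply: (subset_measure0 mBN mN _ N0) => x [].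
apply: measureU_null => //.
  apply: measureU_null => //.
  exact: measureU_null.
by apply: measureU_null; do ?[exact: measurable_inexact|exact: inexact0].
Qed.
#[local] Hint Resolve exceptional0 : core.

Local Lemma measurable_run_psi0 v : measurable_fun setT (run alpha psi0 v).
Proof.
elim: v => [|[n|s] v IH]; first exact: measurable_id.
  exact: (measurableT_comp IH (measurable_alpha n)).
exact: (measurableT_comp IH (measurable_psi0 s)).
Qed.

Local Lemma run_preserving v A : measurable A -> mu (run alpha psi0 v @^-1` A) = mu A.
Proof.
move=> mA; elim: v => [//|[n|s] v IH]; rewrite -[RHS]IH.
  exact: (act_preserving a (g n) (measurable_preimage (measurable_run_psi0 v) mA)).
exact: (psi0_preserving s (measurable_preimage (measurable_run_psi0 v) mA)).
Qed.

Let G := [set x | forall v, ~ exceptional (run alpha psi0 v x)].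

Local Lemma notgoodE : ~` G = \bigcup_v (run alpha psi0 v @^-1` exceptional).
Proof.
apply/seteqP; split=> x /=.
  by move=> /existsNP[v /contrapT Zv]; exists v.
by move=> [v _ Zv] /(_ v).
Qed.

Local Lemma good_conull : measurable (~` G) /\ mu (~` G) = 0%E.
Proof.
rewrite notgoodE; apply: measure_bigcup0_count => v;
  first exact: (measurable_preimage (measurable_run_psi0 v) measurable_exceptional).
by rewrite run_preserving// exceptional0.
Qed.

Local Lemma measurable_good : measurable G.
Proof. by rewrite -(setCK G); apply: measurableC; have [] := good_conull. Qed.
#[local] Hint Resolve measurable_good : core.

Local Lemma good_not_exceptional x : G x -> ~ exceptional x. Proof. by move=> /(_ [::]). Qed.

Local Lemma good_run v x : G x -> G (run alpha psi0 v x).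
Proof. by move=> Gx u; rewrite -run_cat; exact: Gx. Qed.

Local Lemma good_alpha n x : G x -> G (alpha n x).
Proof. move=> Gx; exact (@good_run [:: inl n] x Gx). Qed.

Local Lemma good_B1 x : G x -> B x -> B1 x.
Proof. by move=> /good_not_exceptional Zx Bx; split=> // Nx; apply: Zx; left; right. Qed.

Local Lemma good_psi0 s x : G x -> B x ->
  [/\ G (psi0 s x), B1 (psi0 s x) & theta (psi0 s x) = rand_odo w s (theta x)].
Proof.
move=> Gx Bx; have B1x := good_B1 Gx Bx.
have nx : ~ inexact s x.
  by move=> h; apply: (good_not_exceptional Gx); right; case: s h; [left|right].
split; first exact (@good_run [:: inr s] x Gx).
  by apply: contrapT => h; apply: nx; split=> //; left.
by apply: contrapT => h; apply: nx; split=> //; right.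
Qed.

Local Lemma good_theta x : G x -> B x -> eta (theta x) = x.
Proof. by move=> Gx Bx; apply: thetaK => // Nx; have [] := good_B1 Gx Bx. Qed.

Local Lemma theta_inj x y : G x -> B x -> G y -> B y -> theta x = theta y -> x = y.
Proof. by move=> Gx Bx Gy By e; rewrite -(good_theta Gx Bx) e good_theta. Qed.

Let psi s x := if `[< G x /\ B x >] then psi0 s x else x.

Local Lemma psiE s x : G x -> psi s x = psi0 s x.
Proof.
move=> Gx; rewrite /psi; case: asboolP => // nGB; rewrite psi0_out// => -[Bx _].
by apply: nGB.
Qed.

Local Lemma psi_in s x : G x -> B x -> G (psi s x) /\ B (psi s x).
Proof. by move=> Gx Bx; rewrite psiE//; have [? []] := good_psi0 s Gx Bx. Qed.

Local Lemma psiK s x : psi (~~ s) (psi s x) = x.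
Proof.
have [[Gx Bx]|nGB] := pselect (G x /\ B x); last by rewrite /psi !asboolF.
have [G1 B1x e1] := good_psi0 s Gx Bx; have [Bx' _] := B1x.
have [G2 [B2 _] e2] := good_psi0 (~~ s) G1 Bx'.
rewrite !psiE ?psiE//; apply: theta_inj => //.
by rewrite e2 e1 (isoK (rand_odo_isometry w s)).
Qed.

Local Lemma run_psi v x : G x -> run alpha psi v x = run alpha psi0 v x.
Proof.
elim: v x => //= -[n|s] v IH x Gx /=; first by apply: IH; exact: good_alpha.
by rewrite psiE// IH//; exact (@good_run [:: inr s] x Gx).
Qed.

Local Lemma alpha_free p x : G x -> run alpha psi (map inl p) x = x ->
  (\prod_(n <- rev p) g n)%g = 1%g.
Proof.
move=> Gx; have -> : run alpha psi (map inl p) x = a (\prod_(n <- rev p) g n)%g x.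
  elim: p (x) => [|n p IH] y /=; first by rewrite big_nil act1.
  by rewrite IH rev_cons big_rcons /= actM.
by apply: Na_free => Nx; apply: (good_not_exceptional Gx); left; left; right.
Qed.

(** In the coordinates the moves [psi] are conjugate to the odometer, which has no
    periodic point. *)
Local Lemma psi_free s k x : G x -> B x -> run alpha psi (nseq k (inr s)) x = x -> k = 0%N.
Proof.
move=> Gx Bx e.
have H : [/\ G (run alpha psi (nseq k (inr s)) x), B (run alpha psi (nseq k (inr s)) x) &
    theta (run alpha psi (nseq k (inr s)) x) =
    phi w (iter k (odo_pm s) (phi_inv w (theta x)))].
  elim: k x Gx Bx {e} => [|k IH] x Gx Bx.
    by split=> //=; rewrite (isoKV (phi_isometry w)).
  have [G1 B1x] := psi_in s Gx Bx; have [G2 B2 e2] := IH _ G1 B1x.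
  split=> //=; rewrite [LHS]e2 psiE//; have [_ _ ->] := good_psi0 s Gx Bx.
  by rewrite -iterS iterSr /rand_odo /= (isoK (phi_isometry w)).
have [_ _] := H; rewrite e => /(congr1 (phi_inv w)).
rewrite (isoK (phi_isometry w)); move: (phi_inv w (theta x)) => c {H e}.
case: s => /= ec; first exact: (@odo_free k c).
apply: (@odo_free k c); rewrite {1}ec.
elim: k {ec} => // k IH; by rewrite iterSr iterS /= (isoKV odo_isometry) IH.
Qed.

(** If no proper part of the closed path is closed, its base point is visited at
    the two ends only, so the last step reads the random automorphism at an end of
    the tree that was not read before, that is, in a cylinder that the previous
    readings avoid. The base point would then lie on a fresh loop, and such points
    were removed. *)
Local Lemma no_loop n v s x : G x -> let u := inl n :: rcons v (inr s) in
  valid alpha psi B u x -> run alpha psi u x = x ->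
  exists w1 w2, [/\ u = w1 ++ w2, w1 != [::], w2 != [::] & run alpha psi w1 x = x].
Proof.
move=> Gx u vu ux; apply: contrapT => nw.
have {}nw w1 w2 : u = w1 ++ w2 -> w1 != [::] -> w2 != [::] ->
    run alpha psi0 w1 x <> x.
  by move=> *; rewrite -run_psi// => ?; apply: nw; exists w1, w2.
pose v' := inl n :: v; have uE : u = v' ++ [:: inr s] by rewrite /u -cats1.
move: vu ux; rewrite uE run_cat => /valid_cat[_ [Bq _]].
rewrite run_psi// in Bq *; set q := run alpha psi0 v' x in Bq *.
have Gq : G q by exact: good_run.
have -> : run alpha psi [:: inr s] q = psi s q by [].
rewrite psiE// => qx; have [_ B1x eq] := good_psi0 s Gq Bq.
rewrite qx in B1x eq; have [Bx _] := B1x.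
pose u0 := phi_inv w (theta q); pose u' := odo_pm s u0.
have u'x : phi w u' = theta x by [].
have av : avoids alpha B1 theta eta w v' [set u'] x.
  apply: avoidsP => v1 t v2 v'E p [Bp _]; rewrite -/psi0 in p Bp *.
  have Gp : G p by exact: good_run.
  split=> /= e.
    have px : p = x.
      by apply: theta_inj => //; rewrite -u'x -e (isoKV (phi_isometry w)).
    case: v1 @p px v'E {Bp Gp e} => [|l v1] p px v'E; first by [].
    by apply: (nw (l :: v1) (inr t :: v2 ++ [:: inr s])) px => //; rewrite uE v'E -catA.
  have [Gp' [Bp' _] ep] := good_psi0 t Gp Bp.
  have px : psi0 t p = x.
    by apply: theta_inj => //; rewrite ep -u'x -e.
  apply: (nw (rcons v1 (inr t)) (v2 ++ [:: inr s])).
  - by rewrite uE v'E -cats1 -!catA.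
  - by case: (v1).
  - by case: (v2).
  - by rewrite -cats1 run_cat.
have u0u' : u0 <> u'.
  rewrite /u'; case: (s) => /= e; first by have := @odo_free 1 u0 (esym e).
  by have := @odo_free 1 u0; rewrite /= {1}e (isoKV odo_isometry) => /(_ erefl).
have [n1 av1] := avoids_cyl av.
have [n2 sep] : exists n2, ~ agree n2 u0 u'.
  by apply/existsNP => h; apply: u0u'; exact: agree_eq.
pose n3 := maxn n1 n2; pose sigma := prefix_of u' n3.
have cE : cyl (size sigma) (nth true sigma) = cyl n3 u'.
  by rewrite size_prefix_of; apply: cylE => i ni; rewrite nth_mkseq.
apply: (good_not_exceptional Gx); left; left; left; exists (v', s, sigma) => //.
rewrite /E /=; apply/xsectionP; rewrite /fresh_loop /= cE -/psi0 -/q -/u0 -/u'.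
split; first apply: avoidsS av1.
  by move=> z zu i ni; apply: zu; apply: leq_trans ni _; rewrite leq_maxl.
split; last by split.
by move=> h; apply: sep => i ni; apply: h; apply: leq_trans ni _; rewrite leq_maxr.
Qed.

Local Lemma measurable_psi s : measurable_fun setT (psi s).
Proof.
apply: measurable_fun_ifT => //.
apply: (@measurable_fun_bool _ X _ _ true); rewrite setTI.
rewrite (_ : _ @^-1` _ = G `&` B); first exact: measurableI.
by apply/seteqP; split=> t /= => [/asboolP|/asboolP].
Qed.
#[local] Hint Resolve measurable_psi : core.

Local Lemma psi_preserving s A : measurable A -> mu (psi s @^-1` A) = mu A.
Proof.
move=> mA; rewrite -(psi0_preserving s mA); have [mGC GC0] := good_conull.
apply: (measure_ae_eq _ _ mGC GC0).
- exact: (measurable_preimage (measurable_psi s) mA).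
- exact: (measurable_preimage (measurable_psi0 s) mA).
- by move=> x /contrapT Gx /=; rewrite psiE.
Qed.

Local Lemma code_null A : measurable A -> m (phi w @^-1` (eta @^-1` A)) = 0%E ->
  mu (B `&` A) = 0%E.
Proof.
move=> mA; have meA := measurable_preimage meta mA.
rewrite (isometry_preserving mcoin (phi_isometry w))// => /(theta_null meA) H.
have mH : measurable (B `&` theta @^-1` (eta @^-1` A)).
  by apply: measurableI => //; exact: (measurable_preimage mtheta meA).
rewrite -[RHS]H; apply: (measure_ae_eq _ _ mN N0) => //; first exact: measurableI.
by move=> x Nx; split=> -[Bx Ax]; split=> //; move: Ax; rewrite /= thetaK.
Qed.

(** Conjugation by an automorphism of the tree carries the ergodicity of the
    odometer to [psi]. *)
Local Lemma psi_ergodic A : measurable A -> (forall x, A (psi true x) <-> A x) ->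
  mu (B `&` A) = 0%E \/ mu (B `\` A) = 0%E.
Proof.
move=> mA inv; have [mGC GC0] := good_conull.
pose D := phi w @^-1` (eta @^-1` A).
have mphi := measurable_isometry (phi_isometry w).
have mD : measurable D by exact: (measurable_preimage mphi (measurable_preimage meta mA)).
pose K : set cantor := [set c | ~ (G `&` B1) (eta c) \/ theta (eta c) <> c].
have mK : measurable K.
  apply: measurable_disj; apply: measurable_not.
    by apply: (measurable_preimage meta); exact: measurableI.
  apply: measurable_eq_cantor; last exact: (@measurable_id _ cantor).
  exact: (measurableT_comp mtheta meta).
have K0 : m K = 0%E.
  apply: (@m_null _ (N `|` ~` G)) => //; first exact: measurableU.
    exact: measureU_null.
  move=> x Bx /not_orP[Nx /contrapT Gx]; rewrite /K /= thetaK// => -[|//].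
  by apply; split.
have [|||h|h] := @odo_ergodic _ m mcoin D (phi w @^-1` K) mD.
- exact: (measurable_preimage mphi mK).
- by rewrite (isometry_preserving mcoin (phi_isometry w)).
- move=> c /not_orP[/contrapT[Gc B1c] /contrapT ec].
  rewrite /D /= -(inv (eta (phi w c))) psiE// psi0_in// ec /rand_odo /=.
  by rewrite (isoK (phi_isometry w)).
- by left; exact: code_null.
- right; rewrite setDE; apply: code_null; first exact: measurableC.
  have -> : phi w @^-1` (eta @^-1` (~` A)) = ~` D by [].
  by rewrite (probability_setC m mD) [X in (1 - X)%E]h subee.
Qed.

Lemma companion_of_random : companion g a B G psi.
Proof.
have [mGC GC0] := good_conull; split.
- exact: measurable_good.
- exact: GC0.
- by move=> h x Gx; have [n <-] := g_surj h; exact (@good_alpha n x Gx).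
- exact: measurable_psi.
- exact: psi_preserving.
- exact: psi_in.
- by move=> s x nGB; rewrite /psi asboolF.
- exact: psiK.
- apply: (@closed_path_hol X F g alpha psi G B).
  + exact: good_alpha.
  + exact: psi_in.
  + by move=> s x _ _; exact: psiK.
  + exact: alpha_free.
  + exact: psi_free.
  + exact: no_loop.
- exact: psi_ergodic.
Qed.

End CompanionExists.

(** The companion is a conjugate of the odometer, in coordinates that turn [B] into
    the Cantor space, by a tree automorphism that is drawn at random. *)
Theorem companion_exists (R : realType) d (X : measurableType d) (mu : probability X R)
    (F : groupType) (g : nat -> F) (a : mp_action F mu) (B : set X) :
  standard_borel R X -> (forall x, mu [set x] = 0%E) ->
  (forall h, exists n, g n = h) -> free_action a -> measurable B -> mu B != 0%E ->
  exists G psi, companion g a B G psi.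
Proof.
move=> sX mu0 g_surj [Na [mNa Na0 NaF]] mB B0.
have [m [theta [eta [N [mcoin mtheta meta [mN N0] [tK tE]]]]]] :=
  coin_coordinates sX mu0 mB B0.
have mB1 : measurable (B `\` N) by exact: measurableD.
have malpha n : measurable_fun setT (a (g n)) by exact: measurable_act.
have [w w0] := fresh_loop_null mu mcoin malpha mB1 mtheta meta.
eexists; eexists.
apply: (@companion_of_random _ _ _ _ _ g g_surj a B mB m theta eta N mcoin
  mtheta meta mN N0 tK tE B0 w w0 Na mNa Na0).
by move=> x Nx; apply: contrapT => h; apply: Nx; apply: NaF.
Qed.

(** * Sparse sets meeting every orbit *)

Section Marker.
Context {R : realType} {d} {X : measurableType d} (mu : probability X R).
Context (T T' : X -> X) (TK : cancel T T').
Hypothesis mT : measurable_fun setT T.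
Hypothesis mT' : measurable_fun setT T'.
Hypothesis T_mp : forall A, measurable A -> mu (T @^-1` A) = mu A.
Context (e : X -> cantor) (me : measurable_fun setT e) (e_inj : injective e).
Context (n : nat).

Local Lemma iterK i x : iter i T' (iter i T x) = x.
Proof. by elim: i => // i IH; rewrite iterSr iterS TK. Qed.

Local Lemma measurable_iter i : measurable_fun setT (iter i T).
Proof. by elim: i => [|i IH]; [exact: measurable_id|exact: (measurableT_comp mT)]. Qed.
#[local] Hint Resolve measurable_iter : core.

Local Lemma measurable_iter' i : measurable_fun setT (iter i T').
Proof. by elim: i => [|i IH]; [exact: measurable_id|exact: (measurableT_comp mT')]. Qed.
#[local] Hint Resolve measurable_iter' : core.

Let scyl (s : seq bool) : set cantor := cyl (size s) (nth true s).

Let isolated (s : seq bool) := [set x | scyl s (e x) /\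
  forall i, (0 < i < n)%N -> ~ scyl s (e (iter i T x))].

Local Lemma measurable_isolated s : measurable (isolated s).
Proof.
have mc : measurable (scyl s) by exact: measurable_cyl.
apply: measurable_conj; first exact: (measurable_preimage me mc).
apply: measurable_all => i; apply: measurable_imp; first exact: (measurable_prop (0 < i < n)%N).
exact: measurable_not (measurable_preimage (measurableT_comp me (measurable_iter i)) mc).
Qed.
#[local] Hint Resolve measurable_isolated : core.

Local Lemma isolated_cover x : (forall i, (0 < i < n)%N -> iter i T x <> x) ->
  exists s, isolated s x.
Proof.
move=> ap.
have [N hN] : exists N, forall i, (0 < i < n)%N -> ~ agree N (e (iter i T x)) (e x).
  elim: {-2}n (leqnn n) => [|k IH] kn; first by exists 0%N => i; rewrite ltn0 andbF.
  have [N hN] := IH (ltnW kn).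
  have [k0|k0] := posnP k; first by exists 0%N => i; rewrite k0; case: i.
  have [N' hN'] : exists N', ~ agree N' (e (iter k T x)) (e x).
    by apply/existsNP => h; apply: (ap k); rewrite ?k0//; exact/e_inj/agree_eq.
  exists (maxn N N') => i /andP[i0]; rewrite ltnS leq_eqVlt => /predU1P[->|ik] h.
    by apply: hN' => j jN; apply: h; rewrite leq_max jN orbT.
  by apply: (hN i) => [|j jN]; [rewrite i0|apply: h; rewrite leq_max jN].
have cE : scyl (prefix_of (e x) N) = cyl N (e x).
  by rewrite /scyl size_prefix_of; apply: cylE => i ni; rewrite nth_mkseq.
by exists (prefix_of (e x) N); rewrite /isolated /= cE; split=> // i /hN.
Qed.

Let near (D : set X) := [set x | exists i, (i < n)%N /\ (D (iter i T x) \/ D (iter i T' x))].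

Local Lemma measurable_near D : measurable D -> measurable (near D).
Proof.
move=> mD; apply: measurable_ex => i; apply: measurable_conj.
  exact: (measurable_prop (i < n)%N).
apply: measurable_disj; first exact: (measurable_preimage (measurable_iter i) mD).
exact: (measurable_preimage (measurable_iter' i) mD).
Qed.

Let isolated_seq k := if unpickle k is Some s then isolated s else set0.

Fixpoint marker_upto k : set X :=
  if k is k'.+1 then marker_upto k' `|` (isolated_seq k' `\` near (marker_upto k')) else set0.

Let M := \bigcup_k marker_upto k.

Local Lemma measurable_marker_upto k : measurable (marker_upto k).
Proof.
elim: k => //= k IH; apply: measurableU => //; apply: measurableD; last exact: measurable_near.
by rewrite /isolated_seq; case: (unpickle k).
Qed.
#[local] Hint Resolve measurable_marker_upto : core.

Local Lemma marker_upto_le k k' : (k <= k')%N -> marker_upto k `<=` marker_upto k'.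
Proof.
move=> /subnK <-; elim: (k' - k)%N => // i IH x /IH; by left.
Qed.

Local Lemma marker_upto_spaced k x i : (0 < i < n)%N -> marker_upto k x ->
  ~ marker_upto k (iter i T x).
Proof.
move=> i0n; have iN : (i < n)%N by case/andP: i0n.
elim: k x => //= k IH x [xk|[xA xn]] [ik|[iA iN']].
- exact: IH ik.
- by apply: iN'; exists i; split=> //; right; rewrite iterK.
- by apply: xn; exists i; split=> //; left.
- move: xA iA; rewrite /isolated_seq; case: (unpickle k) => // s [_ /(_ i i0n) h] [].
  by move/h.
Qed.

(** The points that do not return to themselves before time [n] lie in the sets of
    a countable list, each of which is disjoint from its next [n.-1] images. Going
    through the list, add to [B] the points that are far from what [B] already
    contains: the result is disjoint from its next [n.-1] images, hence small, and
    it is maximal, hence near every such point. *)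
Lemma marker_set : exists B : set X,
  [/\ measurable B, (n%:R%:E * mu B <= 1)%E &
      forall x, (forall i, (0 < i < n)%N -> iter i T x <> x) -> (0 < n)%N ->
        exists i, (i < n)%N /\ (B (iter i T x) \/ B (iter i T' x))].
Proof.
have mMU : measurable M by exact: bigcupT_measurable.
have spaced x i : (0 < i < n)%N -> M x -> ~ M (iter i T x).
  move=> i0n [k _ xk] [k' _ ik].
  apply: (@marker_upto_spaced (maxn k k') x i i0n).
    by apply: marker_upto_le xk; rewrite leq_maxl.
  by apply: marker_upto_le ik; rewrite leq_maxr.
exists M; split=> //.
  have mi i : measurable (iter i T @^-1` M) by exact: (measurable_preimage (measurable_iter i)).
  have mui i : mu (iter i T @^-1` M) = mu M.
    by elim: i => // i <-; rewrite -[RHS]T_mp//; congr (mu _);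
      apply/funext => x /=; rewrite -iterSr.
  have : (mu (\big[setU/set0]_(i < n) iter i T @^-1` M) <= 1)%E.
    by apply: probability_le1; apply: bigsetU_measurable.
  rewrite (measure_bigsetU_ord mu (fun=> true)); [|by move=> i; exact: mi|]; last first.
    move=> i j _ _ [x [/= xi xj]]; apply/val_inj => /=.
    wlog ij : i j xi xj / (i < j)%N.
      move=> H; have [ij|ji|//] := ltngtP i j; first exact: H.
      by apply/esym; exact: H.
    exfalso; apply: (@spaced (iter i T x) (j - i)%N); rewrite -?iterD ?subnK// ?(ltnW ij)//.
    by rewrite subn_gt0 ij /= (leq_ltn_trans (leq_subr _ _)).
  rewrite (eq_bigr (fun=> mu M)); last by move=> i _; exact: mui.
  move: (fin_mu mu mMU); case: (mu M) => [r| |]// _.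
  rewrite sumEFin sumr_const card_ord => rn.
  by rewrite -EFinM mulr_natl.
move=> x ap n0; have [s sx] := isolated_cover ap.
have sE : isolated_seq (pickle s) x by rewrite /isolated_seq pickleK.
have [[i [iN h]]|nx] := pselect (near (marker_upto (pickle s)) x).
  by exists i; split=> //; case: h => h; [left|right]; exists (pickle s).
by exists 0%N; split=> //; left; exists (pickle s).+1 => //; right.
Qed.

End Marker.

(** * Piecewise defined transformations *)

Section Piecewise.
Context {R : realType} {d} {X : measurableType d} (mu : probability X R).
Context (D : nat -> set X) (t : nat -> X -> X) (f : X -> X).
Hypothesis mD : forall k, measurable (D k).
Hypothesis mt : forall k, measurable_fun setT (t k).
Hypothesis D_cover : forall x, exists k, D k x.
Hypothesis fE : forall k x, D k x -> f x = t k x.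

Lemma measurable_piecewise : measurable_fun setT f.
Proof.
move=> _ A mA; rewrite setTI (_ : _ @^-1` _ = \bigcup_k (D k `&` t k @^-1` A)).
  apply: bigcupT_measurable => k; apply: measurableI => //.
  exact: (measurable_preimage (mt k)).
apply/seteqP; split=> x /=.
  by move=> Ax; have [k Dx] := D_cover x; exists k => //; split=> //=; rewrite -fE.
by move=> [k _ [Dx /=]]; rewrite -fE.
Qed.

(** The images of the pieces partition the space again, because [f] is
    bijective. *)
Lemma piecewise_preserving f' : measurable_fun setT f' -> cancel f f' -> cancel f' f ->
  trivIset setT D -> (forall k, injective (t k)) ->
  (forall k A, measurable A -> mu (t k @^-1` A) = mu A) ->
  forall A, measurable A -> mu (f @^-1` A) = mu A.
Proof.
move=> mf' fK f'K tD t_inj t_mp A mA.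
have mfD k : measurable (f' @^-1` D k) by exact: (measurable_preimage mf').
have mAD k : measurable (A `&` f' @^-1` D k) by exact: measurableI.
have DE k : D k `&` f @^-1` A = t k @^-1` (A `&` f' @^-1` D k).
  apply/seteqP; split=> x /=.
    by move=> [Dx Ax]; rewrite -(fE Dx) fK.
  move=> [Ax Dx]; have e : f' (t k x) = x by apply: (t_inj k); rewrite -fE.
  by rewrite e in Dx; split=> //; rewrite (fE Dx).
have tAD : trivIset setT (fun k => A `&` f' @^-1` D k).
  by move=> i j _ _ [x [[_ xi] [_ xj]]]; apply: tD => //; exists (f' x).
have tDA : trivIset setT (fun k => D k `&` f @^-1` A).
  by move=> i j _ _ [x [[xi _] [xj _]]]; apply: tD => //; exists x.
have mf := measurable_piecewise.
have mDA k : measurable (D k `&` f @^-1` A).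
  by apply: measurableI => //; exact: (measurable_preimage mf).
have e1 : f @^-1` A = \bigcup_k (D k `&` f @^-1` A).
  apply/seteqP; split=> x; last by move=> [k _ []].
  by move=> Ax; have [k Dx] := D_cover x; exists k.
have e2 : A = \bigcup_k (A `&` f' @^-1` D k).
  apply/seteqP; split=> x; last by move=> [k _ []].
  by move=> Ax; have [k Dx] := D_cover (f' x); exists k.
rewrite e1 [in RHS]e2 !measure_bigcup//.
by apply: eq_eseriesr => k _; rewrite DE; exact: t_mp.
Qed.

End Piecewise.

(** * Rerouting one generator *)

Definition least (P : nat -> Prop) : nat :=
  xget 0%N [set n | P n /\ forall i, (i < n)%N -> ~ P i].

Lemma least_eq P n : P n -> (forall i, (i < n)%N -> ~ P i) -> least P = n.
Proof.
move=> Pn Pi; apply: xget_unique => // k [Pk Pki].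
by have [/Pi|/Pki|] := ltngtP k n.
Qed.

Lemma leastP P : (exists n, P n) -> P (least P) /\ forall i, (i < least P)%N -> ~ P i.
Proof.
move=> [n]; have [k] := ubnP n; elim: k n => // k IH n /ltnSE nk Pn.
have [[i [ni Pi]]|nP] := pselect (exists i, (i < n)%N /\ P i).
  exact: IH (leq_trans ni nk) Pi.
have Pni i : (i < n)%N -> ~ P i by move=> ni Pi; apply: nP; exists i.
by rewrite (least_eq Pn Pni).
Qed.

Section Reroute.
Context {R : realType} {d} {X : measurableType d} {mu : probability X R}.
Context {F : groupType} (g : nat -> F) (a : mp_action F mu) (B : set X).
Context (G : set X) (psi : bool -> X -> X) (comp : companion g a B G psi).
Context (g_surj : forall h, exists n, g n = h) (t : F) (mB : measurable B).

Definition fwd (k : nat) (x : X) : X := a (t ^+ k)%g x.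
Definition bwd (k : nat) (x : X) : X := a (t ^- k)%g x.

Hypothesis hits_bwd : forall x, G x -> exists j, B (bwd j x).
Hypothesis hits_fwd : forall x, G x -> exists h, B (fwd h.+1 x).

Local Lemma fwd0 x : fwd 0 x = x. Proof. by rewrite /fwd expg0 act1. Qed.

Local Lemma fwdD i j x : fwd i (fwd j x) = fwd (i + j) x.
Proof. by rewrite /fwd -actM expgnDr. Qed.

Local Lemma fwdK i : cancel (fwd i) (bwd i).
Proof. by move=> x; rewrite /fwd /bwd -actM mulVg act1. Qed.

Local Lemma bwdK i : cancel (bwd i) (fwd i).
Proof. by move=> x; rewrite /fwd /bwd -actM mulgV act1. Qed.

Local Lemma fwd_bwd i j x : (i <= j)%N -> fwd i (bwd j x) = bwd (j - i) x.
Proof.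
move=> ij; have e : x = fwd (j - i) (fwd i (bwd j x)) by rewrite fwdD subnK// bwdK.
by rewrite [in RHS]e fwdK.
Qed.

Local Lemma bwd_fwd i j x : (i <= j)%N -> bwd i (fwd j x) = fwd (j - i) x.
Proof. by move=> ij; rewrite -{1}(subnKC ij) -fwdD fwdK. Qed.

Local Lemma G_fwd k x : G x -> G (fwd k x). Proof. exact: (companion_act comp). Qed.
Local Lemma G_bwd k x : G x -> G (bwd k x). Proof. exact: (companion_act comp). Qed.

(** The distance down to the base of the column of [x], and the distance from a
    base point up to the top of its column. *)
Let depth x := least (fun j => B (bwd j x)).
Let height z := least (fun h => B (fwd h.+1 z)).

(** The new generator follows the old one inside the columns over [B], and from
    the top of a column it moves to the base of another one through [psi]. *)
Definition reroute (x : X) : X :=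
  if pselect (G x) then
    if pselect (B (fwd 1 x)) then psi true (bwd (depth x) x) else fwd 1 x
  else x.

Definition reroute_inv (y : X) : X :=
  if pselect (G y) then
    if pselect (B y) then fwd (height (psi false y)) (psi false y) else bwd 1 y
  else y.

Local Lemma reroute_out x : ~ G x -> reroute x = x.
Proof. by rewrite /reroute; case: pselect. Qed.

Local Lemma reroute_fwd x : G x -> ~ B (fwd 1 x) -> reroute x = fwd 1 x.
Proof. by rewrite /reroute; case: pselect => // ? _; case: pselect. Qed.

Local Lemma reroute_top x : G x -> B (fwd 1 x) -> reroute x = psi true (bwd (depth x) x).
Proof. by rewrite /reroute; case: pselect => // ? _; case: pselect. Qed.

Local Lemma reroute_inv_out x : ~ G x -> reroute_inv x = x.
Proof. by rewrite /reroute_inv; case: pselect. Qed.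

Local Lemma reroute_inv_bwd x : G x -> ~ B x -> reroute_inv x = bwd 1 x.
Proof. by rewrite /reroute_inv; case: pselect => // ? _; case: pselect. Qed.

Local Lemma reroute_inv_base x : G x -> B x ->
  reroute_inv x = fwd (height (psi false x)) (psi false x).
Proof. by rewrite /reroute_inv; case: pselect => // ? _; case: pselect. Qed.

Local Lemma base_in x : G x -> G (bwd (depth x) x) /\ B (bwd (depth x) x).
Proof. by move=> Gx; split; [exact: G_bwd|have [] := leastP (hits_bwd Gx)]. Qed.

Local Lemma height_base x : G x -> B (fwd 1 x) -> height (bwd (depth x) x) = depth x.
Proof.
move=> Gx B1; have [Bb Bi] := leastP (hits_bwd Gx).
apply: least_eq => [|i id]; first by rewrite -add1n -fwdD bwdK.
rewrite fwd_bwd//; apply: Bi; rewrite -/(depth x); lia.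
Qed.

Local Lemma depth_top z : G z -> B z -> depth (fwd (height z) z) = height z.
Proof.
move=> Gz Bz; have [_ Bi] := leastP (hits_fwd Gz).
apply: least_eq => [|i ih]; first by rewrite fwdK.
rewrite bwd_fwd; last exact: ltnW.
have -> : (height z - i = (height z - i).-1.+1)%N by lia.
apply: Bi; rewrite -/(height z); lia.
Qed.

Local Lemma top_fwd z : G z -> B (fwd 1 (fwd (height z) z)).
Proof. by move=> Gz; rewrite fwdD add1n; have [] := leastP (hits_fwd Gz). Qed.

Local Lemma rerouteK : cancel reroute reroute_inv.
Proof.
move=> x; have [Gx|nGx] := pselect (G x); last by rewrite reroute_out// reroute_inv_out.
have [Bx|nBx] := pselect (B (fwd 1 x)).
  rewrite reroute_top//; have [Gb Bb] := base_in Gx.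
  have [Gp Bp] := companion_in comp true Gb Bb.
  by rewrite reroute_inv_base// (companionK comp true) height_base// bwdK.
by rewrite reroute_fwd// reroute_inv_bwd ?fwdK//; exact: G_fwd.
Qed.

Local Lemma reroute_invK : cancel reroute_inv reroute.
Proof.
move=> y; have [Gy|nGy] := pselect (G y); last by rewrite reroute_inv_out// reroute_out.
have [By|nBy] := pselect (B y).
  rewrite reroute_inv_base//; have [Gz Bz] := companion_in comp false Gy By.
  rewrite reroute_top; [|exact: G_fwd|exact: top_fwd].
  by rewrite depth_top// fwdK (companionK comp false).
rewrite reroute_inv_bwd// reroute_fwd ?bwdK//; exact: G_bwd.
Qed.

Local Lemma measurable_fwd k : measurable_fun setT (fwd k). Proof. exact: measurable_act. Qed.
#[local] Hint Resolve measurable_fwd : core.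
Local Lemma measurable_bwd k : measurable_fun setT (bwd k). Proof. exact: measurable_act. Qed.
#[local] Hint Resolve measurable_bwd : core.
Local Lemma measurable_companion_map s : measurable_fun setT (psi s). Proof. exact:
  (companion_measurable comp). Qed.
#[local] Hint Resolve measurable_companion_map : core.
Local Lemma measurable_companion_good : measurable G. Proof. exact:
  (companion_measurable_good comp). Qed.
#[local] Hint Resolve measurable_companion_good : core.

(** The points to which the same element of the group, followed possibly by [psi],
    is applied. *)
Let piece (k : nat) : set X :=
  match k with
  | 0 => [set x | ~ G x]
  | 1 => [set x | G x /\ ~ B (fwd 1 x)]
  | k'.+2 => [set x | G x /\ (B (fwd 1 x) /\ (B (bwd k' x) /\
      forall i, (i < k')%N -> ~ B (bwd i x)))]
  end.

Let piece_map (k : nat) : X -> X :=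
  match k with 0 => id | 1 => fwd 1 | k'.+2 => psi true \o bwd k' end.

Local Lemma measurable_piece k : measurable (piece k).
Proof.
have mp (f : X -> X) : measurable_fun setT f -> measurable [set x | B (f x)].
  by move=> mf; exact: (measurable_preimage mf mB).
case: k => [|[|k]] /=; first exact: measurable_not.
  by apply: measurable_conj => //; apply: measurable_not; exact: mp.
do 2 (apply: measurable_conj; first by [|exact: mp]).
apply: measurable_conj; first exact: mp.
apply: measurable_all => i; apply: measurable_imp; first exact: (measurable_prop (i < k)%N).
by apply: measurable_not; exact: mp.
Qed.
#[local] Hint Resolve measurable_piece : core.

Local Lemma measurable_piece_map k : measurable_fun setT (piece_map k).
Proof.
case: k => [|[|k]]; [exact: measurable_id|exact: measurable_fwd|].
exact: (measurableT_comp (measurable_companion_map true) (measurable_bwd k)).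
Qed.

Local Lemma piece_cover x : exists k, piece k x.
Proof.
have [Gx|nGx] := pselect (G x); last by exists 0%N.
have [Bx|nBx] := pselect (B (fwd 1 x)); last by exists 1%N.
by exists (depth x).+2; have [? ?] := leastP (hits_bwd Gx).
Qed.

Local Lemma pieceE k x : piece k x -> reroute x = piece_map k x.
Proof.
case: k => [|[|k]] /=; first exact: reroute_out.
  by move=> [Gx]; exact: reroute_fwd.
by move=> [Gx [Bx [Bk Bi]]]; rewrite reroute_top// /depth (least_eq Bk Bi).
Qed.

Let piece_inv (k : nat) : set X :=
  match k with
  | 0 => [set x | ~ G x]
  | 1 => [set x | G x /\ ~ B x]
  | k'.+2 => [set x | G x /\ (B x /\ (B (fwd k'.+1 (psi false x)) /\
      forall i, (i < k')%N -> ~ B (fwd i.+1 (psi false x))))]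
  end.

Let piece_inv_map (k : nat) : X -> X :=
  match k with 0 => id | 1 => bwd 1 | k'.+2 => fwd k' \o psi false end.

Local Lemma measurable_reroute : measurable_fun setT reroute.
Proof. exact: (measurable_piecewise measurable_piece measurable_piece_map piece_cover
  pieceE). Qed.
#[local] Hint Resolve measurable_reroute : core.

Local Lemma measurable_reroute_inv : measurable_fun setT reroute_inv.
Proof.
have mp (f : X -> X) : measurable_fun setT f -> measurable [set x | B (f x)].
  by move=> mf; exact: (measurable_preimage mf mB).
have mfp i : measurable_fun setT (fun x => fwd i (psi false x)).
  exact: (measurableT_comp (measurable_fwd i) (measurable_companion_map false)).
apply: (@measurable_piecewise _ X piece_inv piece_inv_map).
- case=> [|[|k]] /=; first exact: measurable_not.
    by apply: measurable_conj => //; exact: measurable_not.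
  do 2 (apply: measurable_conj; first by []).
  apply: measurable_conj; first exact: mp.
  apply: measurable_all => i; apply: measurable_imp; first exact: (measurable_prop (i < k)%N).
  by apply: measurable_not; exact: mp.
- by case=> [|[|k]]; [exact: measurable_id|exact: measurable_bwd|exact: mfp].
- move=> x; have [Gx|nGx] := pselect (G x); last by exists 0%N.
  have [Bx|nBx] := pselect (B x); last by exists 1%N.
  have [Gz _] := companion_in comp false Gx Bx.
  by exists (height (psi false x)).+2; have [? ?] := leastP (hits_fwd Gz).
- case=> [|[|k]] x /=; first exact: reroute_inv_out.
    by move=> [Gx]; exact: reroute_inv_bwd.
  by move=> [Gx [Bx [Bk Bi]]]; rewrite reroute_inv_base// /height (least_eq Bk Bi).
Qed.
#[local] Hint Resolve measurable_reroute_inv : core.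

Local Lemma reroute_preserving A : measurable A -> mu (reroute @^-1` A) = mu A.
Proof.
apply: (piecewise_preserving measurable_piece measurable_piece_map piece_cover pieceE
  measurable_reroute_inv
  rerouteK reroute_invK).
- move=> i j _ _ [x []].
  case: i j => [|[|i]] [|[|j]] //= hi hj; try by exfalso; tauto.
  have [_ [_ [Bi Hi]]] := hi; have [_ [_ [Bj Hj]]] := hj; congr _.+2.
  by have [/Hj|/Hi|//] := ltngtP i j.
- case=> [|[|k]] //=; first exact: can_inj (fwdK 1).
  apply: inj_comp; last exact: can_inj (bwdK k).
  exact: can_inj (companionK comp true).
- case=> [|[|k]] {}A mA //=; first exact: act_preserving.
  rewrite (_ : _ @^-1` _ = bwd k @^-1` (psi true @^-1` A))//.
  rewrite [LHS]act_preserving; first exact: (companion_preserving comp).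
  exact: (measurable_preimage (measurable_companion_map true)).
Qed.

Local Lemma reroute_inv_preserving A : measurable A -> mu (reroute_inv @^-1` A) = mu A.
Proof.
move=> mA; rewrite -reroute_preserving; last exact: (measurable_preimage
  measurable_reroute_inv).
by congr (mu _); apply/funext => x /=; rewrite rerouteK.
Qed.

(** The element by which the old generator leads from a base point to the base of
    the next column. *)
Let kappa z := (t ^+ (height z).+1)%g.

Let alpha n := act a (g n).

Let idx h := projT1 (cid (g_surj h)).
Local Lemma idxE h : g (idx h) = h. Proof. by rewrite /idx; case: cid. Qed.

(** Inside a column one move by [a t] suffices. At the top, go down to the base by
    a power of [t] and then apply [psi true]; the label [kappa] of the latter makes
    up for the descent. *)
Lemma reroute_path x : G x -> exists w,
  [/\ valid alpha psi B w x, run alpha psi w x = reroute x & hol g alpha psi kappa w x = t].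
Proof.
move=> Gx; have [Bx|nBx] := pselect (B (fwd 1 x)); last first.
  exists [:: inl (idx t)]; split=> //=; last by rewrite idxE mul1g.
  by rewrite reroute_fwd// /alpha idxE /fwd expg1.
exists [:: inl (idx (t ^- depth x)%g); inr true].
have e : alpha (idx (t ^- depth x)%g) x = bwd (depth x) x by rewrite /alpha idxE.
split=> /=; rewrite e.
- by split=> //; split=> //; have [] := base_in Gx.
- by rewrite reroute_top.
- by rewrite mul1g idxE /kappa height_base// expgS mulgK.
Qed.

Lemma reroute_inv_path x : G x -> exists w,
  [/\ valid alpha psi B w x, run alpha psi w x = reroute_inv x &
      hol g alpha psi kappa w x = (t^-1)%g].
Proof.
move=> Gx; have [Bx|nBx] := pselect (B x); last first.
  exists [:: inl (idx t^-1%g)]; split=> //=; last by rewrite idxE mul1g.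
  by rewrite reroute_inv_bwd// /alpha idxE /bwd expg1.
exists [:: inr false; inl (idx (t ^+ height (psi false x))%g)]; split=> //=.
  by rewrite reroute_inv_base// /alpha idxE.
by rewrite mul1g idxE /kappa expgS invgM mulgA mulgV mul1g.
Qed.

(** An invariant set contains whole columns, so it is determined by its trace on
    [B], which [psi] preserves. *)
Lemma reroute_ergodic A : measurable A -> (forall x, A (reroute x) <-> A x) ->
  mu A = 0%E \/ mu A = 1%E.
Proof.
move=> mA inv.
have up i z : (i <= height z)%N -> G z -> A (fwd i z) <-> A z.
  elim: i => [|i IH] ih Gz; first by rewrite fwd0.
  rewrite -(IH (ltnW ih) Gz) -(inv (fwd i z)) reroute_fwd.
  - by rewrite fwdD add1n.
  - exact: G_fwd.
  - by rewrite fwdD add1n; have [_ Bi] := leastP (hits_fwd Gz); exact: Bi.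
have low x : G x -> A (bwd (depth x) x) <-> A x.
  move=> Gx; have [Gb Bb] := base_in Gx.
  have dh : (depth x <= height (bwd (depth x) x))%N.
    rewrite leqNgt; apply/negP => hd.
    have [Bh _] := leastP (hits_fwd Gb); have [_ Bi] := leastP (hits_bwd Gx).
    move: Bh; rewrite -/(height _) fwd_bwd//; apply: Bi; rewrite -/(depth x); lia.
  by rewrite -(up _ _ dh Gb) bwdK.
have psi_inv x : A (psi true x) <-> A x.
  have [[Gx Bx]|nGB] := pselect (G x /\ B x); last by rewrite (companion_out comp).
  rewrite -(up _ _ (leqnn _) Gx) -(inv (fwd (height x) x)) reroute_top.
  - by rewrite depth_top// fwdK.
  - exact: G_fwd.
  - exact: top_fwd.
have null C : measurable C -> mu (B `&` C) = 0%E ->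
    (forall x, G x -> C x -> C (bwd (depth x) x)) -> mu C = 0%E.
  move=> mC BC0 Cb; have mBC : measurable (B `&` C) by exact: measurableI.
  have mGC : measurable (~` G) by exact: measurableC.
  have mU k : measurable (bwd k @^-1` (B `&` C)) by exact: (measurable_preimage
    (measurable_bwd k)).
  have U0 : mu (\bigcup_k (bwd k @^-1` (B `&` C))) = 0%E.
    by apply: measure_bigcup0 => // k; rewrite -[RHS]BC0; exact: act_preserving.
  have mUU : measurable (\bigcup_k (bwd k @^-1` (B `&` C))) by exact: bigcupT_measurable.
  apply: (subset_measure0 mC (measurableU _ _ mGC mUU)).
    move=> x Cx; have [Gx|] := pselect (G x); last by left.
    by right; exists (depth x) => //; split; [have [] := base_in Gx|exact: Cb].
  by apply: measureU_null => //; exact: (companion_null comp).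
have [h|h] := companion_ergodic comp mA psi_inv.
  by left; apply: null => // x Gx; have [_ h'] := low x Gx; exact: h'.
right; have mAC : measurable (~` A) by exact: measurableC.
have : mu (~` A) = 0%E.
  by apply: null => // x Gx nAx Ab; apply: nAx; have [h' _] := low x Gx; exact: h'.
rewrite probability_setC//; move: (fin_mu mu mA); case: (mu A) => [r| |]// _.
by rewrite -EFinB => -[] /eqP; rewrite subr_eq0 => /eqP <-.
Qed.

Lemma reroute_eq x : G x -> ~ B (fwd 1 x) -> reroute x = a t x.
Proof. by move=> *; rewrite reroute_fwd// /fwd expg1. Qed.

Lemma reroute_bij : exists S : bij X,
  [/\ forall x, S x = reroute x, forall x, binv S x = reroute_inv x,
    measurable_fun setT S /\ measurable_fun setT (binv S) &
    forall A, measurable A -> mu (S @^-1` A) = mu A /\ mu (binv S @^-1` A) = mu A].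
Proof.
exists (Bij rerouteK reroute_invK); split=> // A mA.
by split; [exact: reroute_preserving|exact: reroute_inv_preserving].
Qed.

End Reroute.

(** * Free ergodic actions uniformly close to a free action *)

Lemma standard_singleton (R : realType) d (X : measurableType d) (x0 : X) :
  standard_borel R X -> measurable [set x0].
Proof.
move=> /(standard_borel_cantor x0)[e [r [me _ eK]]].
rewrite (_ : [set x0] = [set y | e y = e x0]).
  by apply: measurable_eq_cantor => //; exact: measurable_cst.
by apply/seteqP; split=> y /=; [move=> ->|exact: (can_inj eK)].
Qed.

Lemma nonatomic_singleton (R : realType) d (X : measurableType d) (mu : probability X R) x :
  standard_probability mu -> mu [set x] = 0%E.
Proof.
move=> [sX na]; have m1 := standard_singleton x sX.
apply/eqP; rewrite eq_le measure_ge0 andbT leNgt; apply/negP => x0.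
have [B [mB Bx B0 Blt]] := na _ m1 x0.
have [Bx'|nBx] := pselect (B x).
  by move: Blt; rewrite (_ : B = [set x]) ?ltxx//; apply/seteqP; split=> // y ->.
move: B0; rewrite (_ : B = set0) ?measure0 ?ltxx//.
by apply/seteqP; split=> // y By; apply: nBx; rewrite -(Bx y By).
Qed.

(** The action [b] moves one generator by [reroute] and the others as [a] does.
    From a good point every [h] is spelled by a path of the companion that has
    holonomy [h] and leads to the image under [b h]; a fixed point of [b h] closes
    the path, so [h] is [1]. The generator [t] alone acts ergodically, and it is
    modified only at the points that [a t] maps into [B]. *)
Theorem free_ergodic_perturbation (R : realType) d (X : measurableType d)
    (mu : probability X R) (I : Type) (F : groupType) (x : I -> F) (i0 : I)
    (g : nat -> F) (a : mp_action F mu) (n : nat) :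
  standard_probability mu -> free_basis x -> (forall h, exists p, g p = h) ->
  free_action a -> (0 < n)%N ->
  exists b : mp_action F mu, [/\ free_action b, ergodic_action b &
    exists E, [/\ measurable E, (n%:R%:E * mu E <= 1)%E &
      forall y, ~ E y -> forall i, b (x i) y = a (x i) y]].
Proof.
move=> sm xF g_surj a_free n0; have [sX _] := sm.
have mu0 y : mu [set y] = 0%E by exact: nonatomic_singleton.
have [y0 _] : [set: X] !=set0.
  apply/set0P/negP => /eqP X0; have := probability_setT mu.
  by rewrite X0 measure0 => -[] /eqP; rewrite eq_sym oner_eq0.
have [e [r [me _ eK]]] := standard_borel_cantor y0 sX.
pose t := x i0; pose T := a t; pose T' := a t^-1%g.
have TK : cancel T T' by move=> y; rewrite /T /T' -actM mulVg act1.
have T'K : cancel T' T by move=> y; rewrite /T /T' -actM mulgV act1.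
have mT : measurable_fun setT T by exact: measurable_act.
have mT' : measurable_fun setT T' by exact: measurable_act.
have iterT i y : iter i T y = fwd a t i y.
  elim: i => [|i IH]; first by rewrite /fwd expg0 act1.
  by rewrite iterS IH /fwd expgS actM.
have iterT' i y : iter i T' y = bwd a t i y.
  elim: i => [|i IH]; first by rewrite /bwd expg0 invg1 act1.
  by rewrite iterS IH /bwd expgSr invgM actM.
have [B [mB nB Bcov]] := marker_set TK mT mT' (act_preserving a t) me (can_inj eK) n.
have cov y : (forall h, a h y = y -> h = 1%g) ->
    exists i, (i < n)%N /\ (B (fwd a t i y) \/ B (bwd a t i y)).
  move=> fy; have [|//|i [iN h]] := Bcov y.
    move=> i /andP[i1 _]; rewrite iterT => /fy/(free_basis_torsion_free xF) i0'.
    by rewrite i0' in i1.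
  by exists i; rewrite -iterT -iterT'.
have B0 : mu B != 0%E.
  apply/negP => /eqP B0; have [Na [mNa Na0 NaF]] := a_free.
  pose U k := fwd a t k @^-1` B `|` bwd a t k @^-1` B.
  have mf k : measurable (fwd a t k @^-1` B).
    by exact: (measurable_preimage (measurable_act a _) mB).
  have mb k : measurable (bwd a t k @^-1` B).
    by exact: (measurable_preimage (measurable_act a _) mB).
  have mU k : measurable (U k) by exact: measurableU.
  have U0 k : mu (U k) = 0%E.
    apply: measureU_null => //; first by rewrite -[RHS]B0; exact: act_preserving.
    by rewrite -[RHS]B0; exact: act_preserving.
  have mUU : measurable (\bigcup_k U k) by exact: bigcupT_measurable.
  have : mu (Na `|` \bigcup_k U k) = 0%E.
    by apply: measureU_null => //; exact: measure_bigcup0.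
  rewrite (_ : _ `|` _ = setT) ?probability_setT => [/eqP|].
    by rewrite onee_eq0.
  apply/seteqP; split=> // y _; have [|nNa] := pselect (Na y); first by left.
  right; have [|i [_ h]] := cov y; last by exists i.
  by apply: contrapT => h; apply: nNa; apply: NaF.
have [G [psi comp]] := companion_exists sX mu0 g_surj a_free mB B0.
have G_free y : G y -> forall h, a h y = y -> h = 1%g.
  move=> Gy h hy; have [p ph] := g_surj h.
  have H := companion_hol comp; have := H (fun=> 1%g) [:: inl p] y Gy (conj Logic.I Logic.I).
  by rewrite /= ph mul1g; apply.
have fwd_add i j y : fwd a t i (fwd a t j y) = fwd a t (i + j) y.
  by rewrite /fwd -actM expgnDr.
have bwd_add i j y : bwd a t i (bwd a t j y) = bwd a t (j + i) y.
  by rewrite /bwd -actM -invgM -expgnDr.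
have fwdK i : cancel (fwd a t i) (bwd a t i).
  by move=> y; rewrite /fwd /bwd -actM mulVg act1.
have bwdK i : cancel (bwd a t i) (fwd a t i).
  by move=> y; rewrite /fwd /bwd -actM mulgV act1.
have G_act h y : G y -> G (a h y) by exact: (companion_act comp).
have hits_bwd y : G y -> exists j, B (bwd a t j y).
  move=> Gy; have [i [iN [h|h]]] := cov _ (G_free _ (G_act (t ^- n)%g y Gy)); last first.
    by exists (n + i)%N; rewrite -bwd_add.
  exists (n - i)%N; suff -> : bwd a t (n - i) y = fwd a t i (bwd a t n y) by [].
  have {1}-> : y = fwd a t (n - i) (fwd a t i (bwd a t n y)).
    by rewrite fwd_add subnK ?bwdK// ltnW.
  by rewrite fwdK.
have hits_fwd y : G y -> exists h, B (fwd a t h.+1 y).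
  move=> Gy; have [i [iN [h|h]]] := cov _ (G_free _ (G_act (t ^+ n)%g y Gy)).
    exists (i + n).-1; rewrite prednK; last by rewrite addn_gt0 n0 orbT.
    by rewrite -fwd_add.
  exists (n - i).-1; rewrite prednK ?subn_gt0//.
  suff -> : fwd a t (n - i) y = bwd a t i (fwd a t n y) by [].
  by rewrite -{2}(subnKC (ltnW iN)) -fwd_add fwdK.
have [S [SE S'E [mS mS'] S_mp]] := reroute_bij comp mB hits_bwd hits_fwd.
pose abij h : bij X := @Bij X (a h) (a h^-1%g)
  (fun y => etrans (esym (actM a _ _ y)) (etrans (congr1 (fun k => a k y) (mulVg h)) (act1
    a y)))
  (fun y => etrans (esym (actM a _ _ y)) (etrans (congr1 (fun k => a k y) (mulgV h)) (act1
    a y))).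
pose f i := if pselect (i = i0) then S else abij (x i).
have [phi [phi1 phiM phiV phix]] := free_basis_hom xF f.
pose kappa z := (t ^+ (least (fun h => B (fwd a t h.+1 z))).+1)%g.
pose path h (s : X -> X) := forall y, G y -> exists w,
  [/\ valid (fun p => a (g p)) psi B w y, run (fun p => a (g p)) psi w y = s y &
    hol g (fun p => a (g p)) psi kappa w y = h].
pose Q h := [/\ measurable_fun setT (phi h),
  forall A, measurable A -> mu (phi h @^-1` A) = mu A & path h (phi h)].
have path_act h : path h (a h).
  move=> y Gy; have [p ph] := g_surj h.
  by exists [:: inl p]; split=> //=; rewrite ?ph ?mul1g.
(* Paths are concatenated at good points, which the moves preserve. *)
have QM h k : Q h -> Q k -> Q (h * k)%g.
  move=> [mh h_mp ph] [mk k_mp pk]; rewrite /Q phiM; split.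
  - exact: (measurableT_comp mh mk).
  - move=> A mA; rewrite -(h_mp A mA) -(k_mp (phi h @^-1` A))//.
    exact: (measurable_preimage mh mA).
  move=> y Gy; have [w [vw rw hw]] := pk y Gy.
  have Gk : G (phi k y).
    rewrite -rw; apply: run_good vw => //; last exact: (companion_in comp).
    by move=> p z; exact: G_act.
  have [w' [vw' rw' hw']] := ph _ Gk.
  exists (w ++ w'); split; first by apply/valid_cat; rewrite rw.
    by rewrite run_cat rw rw'.
  by rewrite hol_cat rw hw hw'.
have Qall h : Q h /\ Q h^-1%g.
  elim/(free_basis_ind xF): h => [|h k [Qh QhV] [Qk QkV]|h [Qh QhV]|i].
  - have Q1 : Q 1%g.
      by rewrite /Q phi1; split; [exact: measurable_id|by []|move=> y Gy; exists [::]].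
    by rewrite invg1.
  - by rewrite invgM; split; exact: QM.
  - by rewrite invgK.
  rewrite /Q phiV phix /f; case: pselect => [ei|ni] /=; first subst i.
    split; split=> //.
    + by move=> A /S_mp[].
    + by move=> y Gy; rewrite SE; exact: (reroute_path comp g_surj hits_bwd).
    + by move=> A /S_mp[].
    + by move=> y Gy; have := reroute_inv_path a B psi g_surj t Gy; rewrite -S'E.
  split; split; [exact: measurable_act|exact: act_preserving|exact: path_act|
    exact: measurable_act|exact: act_preserving|exact: path_act].
pose b : mp_action F mu := @MpAction F R d X mu (fun h => phi h)
  (fun y => congr1 (fun s : bij X => s y) phi1)
  (fun h k y => congr1 (fun s : bij X => s y) (phiM h k))
  (fun h => let: conj (And3 m _ _) _ := Qall h in m)
  (fun h => let: conj (And3 _ m _) _ := Qall h in m).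
have bt y : b t y = reroute a B G psi t y.
  by rewrite /b /= phix /f; case: pselect => // _; rewrite SE.
exists b; split.
- exists (~` G); split; first exact/measurableC/(companion_measurable_good comp).
    exact: (companion_null comp).
  move=> y /= h Gy; apply: h => h hy.
  have [[_ _ ph] _] := Qall h; have [w [vw rw <-]] := ph _ Gy.
  by apply: (companion_hol comp) => //; rewrite rw.
- move=> A mA invA; apply: (reroute_ergodic comp mB hits_bwd hits_fwd mA) => y.
  rewrite -bt; split=> [Aty|Ay]; last by rewrite -(invA t); exists y.
  move: Aty; rewrite -{1}(invA t) => -[z Az zy].
  by rewrite -(bijK (phi t) y) -[phi t y]zy bijK.
exists (~` G `|` fwd a t 1 @^-1` B).
have mG := companion_measurable_good comp.
have mTB : measurable (fwd a t 1 @^-1` B).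
  exact: (measurable_preimage (measurable_act a _) mB).
have mGC : measurable (~` G) by exact: measurableC.
split; first exact: measurableU.
  suff -> : mu (~` G `|` fwd a t 1 @^-1` B) = mu B by [].
  rewrite setUC measureU0//; last exact: (companion_null comp).
  exact: (act_preserving a _ mB).
move=> y /not_orP[/contrapT Gy nBy] i.
have [->|ni] := pselect (i = i0); first by rewrite bt reroute_eq.
by rewrite /b /= phix /f; case: pselect.
Qed.

(** * The weak distance *)

Section RealMeasure.
Context {d} {T : measurableType d} {R : realType} (mu : probability T R).
Implicit Types A B W : set T.

Definition rmu A : R := fine (mu A).

Lemma rmuE A : measurable A -> mu A = (rmu A)%:E.
Proof. by move=> mA; rewrite /rmu fineK// fin_mu. Qed.

Lemma rmu_le A B : measurable A -> measurable B -> A `<=` B -> rmu A <= rmu B.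
Proof. by move=> mA mB AB; rewrite -lee_fin -!rmuE//; apply: le_measure; rewrite ?inE. Qed.

Lemma rmu_le1 A : measurable A -> rmu A <= 1.
Proof. by move=> mA; rewrite -lee_fin -rmuE//; exact: probability_le1. Qed.

Lemma rmuU_le A B : measurable A -> measurable B -> rmu (A `|` B) <= rmu A + rmu B.
Proof.
move=> mA mB; have mU : measurable (A `|` B) by exact: measurableU.
by rewrite -lee_fin EFinD -!rmuE//; exact: measureU2.
Qed.

Lemma rmuU A B : measurable A -> measurable B -> A `&` B = set0 ->
  rmu (A `|` B) = rmu A + rmu B.
Proof.
move=> mA mB AB; have mU : measurable (A `|` B) by exact: measurableU.
by apply: EFin_inj; rewrite EFinD -!rmuE//; exact: measureU.
Qed.

Lemma rmu_diff A B W : measurable A -> measurable B -> measurable W ->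
  (forall x, ~ W x -> A x <-> B x) -> `|rmu A - rmu B| <= rmu W.
Proof.
move=> mA mB mW AB.
have H C D : measurable C -> measurable D -> (forall x, ~ W x -> C x -> D x) ->
    rmu C <= rmu D + rmu W.
  move=> mC mD CD; apply: le_trans (rmuU_le mD mW).
  apply: rmu_le => //; first exact: measurableU.
  by move=> x Cx; have [|nW] := pselect (W x); [right|left; exact: CD].
have h1 : rmu A <= rmu B + rmu W by apply: H => // x /AB[].
have h2 : rmu B <= rmu A + rmu W by apply: H => // x /AB[].
by rewrite ler_norml; lra.
Qed.

Lemma setT_ex k (F : 'I_k -> set T) :
  [set x | exists i, F i x] = \big[setU/set0]_i F i.
Proof.
apply/seteqP; split=> x.
  by move=> [i Fi]; rewrite (bigD1 i)//=; left.
elim/big_ind : _ => //; last by move=> i _ Fi; exists i.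
by move=> A B hA hB [/hA|/hB].
Qed.

Lemma rmu_ex_le k (F : 'I_k -> set T) (r : R) : (forall i, measurable (F i)) ->
  (forall i, rmu (F i) <= r) -> rmu [set x | exists i, F i x] <= k%:R * r.
Proof.
move=> mF Fr; rewrite setT_ex.
have -> : k%:R * r = \sum_(i < k) r by rewrite sumr_const card_ord mulr_natl.
suff [] : measurable (\big[setU/set0]_i F i) /\ rmu (\big[setU/set0]_i F i) <= \sum_(i < k) r.
  by [].
elim/big_ind2 : _ => [|A a B b [mA Aa] [mB Bb]|i _]; last by split.
  by rewrite /rmu measure0.
split; first exact: measurableU.
exact: le_trans (rmuU_le mA mB) (lerD Aa Bb).
Qed.

Lemma rmu_ex_disjoint k (F : 'I_k -> set T) : (forall i, measurable (F i)) ->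
  trivIset setT F -> rmu [set x | exists i, F i x] = \sum_i rmu (F i).
Proof.
move=> mF tF; rewrite setT_ex /rmu (measure_bigsetU_ord mu (fun=> true)) //.
rewrite (eq_bigr (fun i => (rmu (F i))%:E)); last by move=> i _; rewrite -rmuE.
by rewrite sumEFin.
Qed.

End RealMeasure.

Section HausdorffBound.
Context {R : realType} {T : pseudoMetricType R}.

Lemma hausdorff_closure_le (A B : set T) (e : R) : 0 < e ->
  (forall x, A x -> exists2 y, B y & ball x e y) ->
  (forall y, B y -> exists2 x, A x & ball y e x) ->
  (hausdorff_dist (closure A) (closure B) <= (e + e)%:E)%E.
Proof.
move=> e0 AB BA; apply: ereal_inf_lbound; exists (e + e) => //.
have H C D : (forall x, C x -> exists2 y, D y & ball x e y) ->
    forall x, closure C x -> exists2 y, closure D y & ball x (e + e) y.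
  move=> CD x /(_ (ball x e) (nbhsx_ballx _ _ e0))[z [/CD[y Dy zy] xz]].
  by exists y; [exact: subset_closure|exact: ball_triangle xz zy].
by split; [exact: addr_gt0|exact: H|exact: H].
Qed.

End HausdorffBound.

Section WeakDistanceBounds.
Context {G : groupType} {R : realType} {d} {X : measurableType d}
  {mu : probability X R} (g : nat -> G).
Implicit Types a b : mp_action G mu.

Let ov a h (A B : set X) : R := rmu mu ((a h @` A) `&` B).

Lemma ball_overlaps n k a b (A B : 'I_k -> set X) (e : R) : 0 < e ->
  (forall (p : 'I_n) i j, `|ov a (g p) (A i) (A j) - ov b (g p) (B i) (B j)| < e) ->
  ball (overlaps g n a A) e (overlaps g n b B).
Proof. by move=> e0 H; split=> // i p; split=> // q r; rewrite !mxE; exact: H. Qed.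

Lemma overlap_closure_le n k a b (e : R) : 0 < e ->
  (forall A : 'I_k -> set X, mpartition A -> exists2 B : 'I_k -> set X, mpartition B &
     forall (p : 'I_n) i j, `|ov a (g p) (A i) (A j) - ov b (g p) (B i) (B j)| < e) ->
  (forall A : 'I_k -> set X, mpartition A -> exists2 B : 'I_k -> set X, mpartition B &
     forall (p : 'I_n) i j, `|ov b (g p) (A i) (A j) - ov a (g p) (B i) (B j)| < e) ->
  (hausdorff_dist (overlap_closure g (n := n) (k := k) a)
                  (overlap_closure g (n := n) (k := k) b) <= (e + e)%:E)%E.
Proof.
move=> e0 ab ba; apply: hausdorff_closure_le => // _ [A mA <-].
  by have [B mB AB] := ab A mA; exists (overlaps g n b B); [exists B|exact: ball_overlaps].
by have [B mB AB] := ba A mA; exists (overlaps g n a B); [exists B|exact: ball_overlaps].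
Qed.

Lemma measurable_overlap a h (A B : set X) : measurable A -> measurable B ->
  measurable ((a h @` A) `&` B).
Proof. by move=> mA mB; apply: measurableI => //; exact: measurable_act_image. Qed.

(** The same partition serves for both actions: its overlaps change by at most the
    measure of the set on which the actions disagree. *)
Lemma overlap_closure_close n k a b (e : R) : 0 < e ->
  (forall p : 'I_n, exists E, [/\ measurable E, rmu mu E < e &
     forall x, ~ E x -> b (g p)^-1%g x = a (g p)^-1%g x]) ->
  (hausdorff_dist (overlap_closure g (n := n) (k := k) a)
                  (overlap_closure g (n := n) (k := k) b) <= (e + e)%:E)%E.
Proof.
move=> e0 H.
have key (A : 'I_k -> set X) : mpartition A -> forall (p : 'I_n) i j,
    `|ov a (g p) (A i) (A j) - ov b (g p) (A i) (A j)| < e.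
  move=> [mA _ _] p i j; have [E [mE Ee Eq]] := H p.
  apply: le_lt_trans Ee; apply: rmu_diff => //; [exact: measurable_overlap..|].
  move=> x Ex; rewrite !act_image.
  by split=> -[h1 h2]; split=> //; move: h1; rewrite /= Eq.
apply: overlap_closure_le => // A mA; exists A => // p i j; last rewrite distrC.
  exact: key.
exact: key.
Qed.

Lemma overlap_closure_le4 n k a b :
  (hausdorff_dist (overlap_closure g (n := n) (k := k) a)
                  (overlap_closure g (n := n) (k := k) b) <= 4%:E)%E.
Proof.
have -> : 4 = 2 + 2 :> R by lra.
apply: overlap_closure_close => [|p]; first lra.
exists setT; split=> //; last by move=> x [].
by apply: le_lt_trans (rmu_le1 mu measurableT) _; lra.
Qed.

(** The sets given by weak containment need not form a partition, but taking
    [1] among the group elements shows that they nearly do: their overlaps and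
    the complement of their union are small. Removing from each set the previous
    ones, and adding the rest of the space to the first, changes them little. *)
Lemma weakly_contained_partition n k a b (A : 'I_k.+1 -> set X) (e : R) :
  weakly_contained a b -> mpartition A -> 0 < e ->
  exists2 C : 'I_k.+1 -> set X, mpartition C &
    forall (p : 'I_n) i j, `|ov a (g p) (A i) (A j) - ov b (g p) (C i) (C j)| < e.
Proof.
move=> ab [mA tA UA] e0.
pose K : R := k.+1%:R; have K0 : 0 < K by rewrite ltr0n.
(* [K * (1 + K)] and [K * K] bound, in units of [eps], the measures of the part
   left uncovered and of the overlaps; the error is counted twice, for a set and
   for its image. *)
pose c : R := 1 + 2 * (K * (1 + K) + K * K).
have c0 : 0 < c by rewrite /c; have := mulr_gt0 K0 K0; nra.
pose eps := e / (2 * c).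
have eps0 : 0 < eps by rewrite divr_gt0// mulr_gt0.
have [B mB AB] := ab k.+1 A (1%g :: [seq g p | p <- iota 0 n]) eps mA eps0.
have close h i j : h \in 1%g :: [seq g p | p <- iota 0 n] ->
    `|ov a h (A i) (A j) - ov b h (B i) (B j)| < eps.
  move=> /AB/(_ i j); rewrite -lte_fin.
  rewrite [in X in (X < _)%E -> _](rmuE mu (measurable_overlap a h (mA i) (mA j))).
  by rewrite (rmuE mu (measurable_overlap b h (mB i) (mB j))).
have ov1 (a' : mp_action G mu) (U V : set X) : ov a' 1%g U V = rmu mu (U `&` V).
  by rewrite /ov; congr (rmu mu (_ `&` _)); rewrite act_image invg1;
    apply/seteqP; split=> x /=; rewrite act1.
have close1 i j : `|rmu mu (A i `&` A j) - rmu mu (B i `&` B j)| < eps.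
  by rewrite -(ov1 a) -(ov1 b); apply: close; rewrite mem_head.
pose fresh (i : 'I_k.+1) := [set x | B i x /\ forall j : 'I_k.+1, (j < i)%N -> ~ B j x].
pose dup (i : 'I_k.+1) := [set x | exists j : 'I_k.+1, (j < i)%N /\ (B i x /\ B j x)].
pose L := [set x | ~ exists i, fresh i x].
have mfresh i : measurable (fresh i).
  apply: measurable_conj; first exact: mB.
  apply: (@measurable_all _ X 'I_k.+1) => j; apply: measurable_imp.
    exact: (measurable_prop (j < i)%N).
  by apply: measurable_not; exact: mB.
have mdup i : measurable (dup i).
  apply: (@measurable_ex _ X 'I_k.+1) => j; apply: measurable_conj;
    first exact: (measurable_prop (j < i)%N).
  by apply: measurable_conj; exact: mB.
have mU : measurable [set x | exists i, fresh i x] by exact: (@measurable_ex _ X 'I_k.+1).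
have mL : measurable L by exact: measurable_not.
have tfresh : trivIset setT fresh.
  move=> i j _ _ [x [[Bi Hi] [Bj Hj]]]; apply/val_inj => /=.
  by have [/Hj|/Hi|//] := ltngtP i j.
have dup_le i : rmu mu (dup i) <= K * eps.
  apply: rmu_ex_le => j.
    apply: measurable_conj; first exact: (measurable_prop (j < i)%N).
    by apply: measurable_conj; exact: mB.
  have [ji|ji] := boolP (j < i)%N; last first.
    apply: (@le_trans _ _ (rmu mu set0)); last by rewrite /rmu measure0 ltW.
    by rewrite le_eqVlt; apply/orP; left; apply/eqP; congr (rmu mu _);
      apply/seteqP; split=> // x [].
  apply: (@le_trans _ _ (rmu mu (B i `&` B j))).
    by rewrite le_eqVlt; apply/orP; left; apply/eqP; congr (rmu mu _);
      apply/seteqP; split=> x [] // _ [].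
  have := close1 i j; rewrite (_ : A i `&` A j = set0).
    rewrite {1}/rmu measure0 sub0r normrN => /ltW; apply: le_trans.
    exact: ler_norm.
  apply/seteqP; split=> // x Axx; have /(congr1 val) /= ij := tA i j I I (ex_intro _ x Axx).
  by rewrite ij ltnn in ji.
have sumA : \sum_i rmu mu (A i) = 1.
  rewrite -rmu_ex_disjoint// (_ : mkset _ = setT) ?/rmu ?probability_setT//.
  apply/seteqP; split=> // x _; have : (\bigcup_i A i) x by rewrite UA.
  by move=> [i _ Ai]; exists i.
have L_le : rmu mu L <= K * (1 + K) * eps.
  have -> : rmu mu L = 1 - \sum_i rmu mu (fresh i).
    rewrite -rmu_ex_disjoint// /rmu.
    have -> : L = ~` [set x | exists i, fresh i x] by [].
    by rewrite probability_setC// (rmuE mu mU) -EFinB.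
  rewrite -[X in X - _]sumA -sumrB.
  have -> : K * (1 + K) * eps = \sum_(i < k.+1) (1 + K) * eps.
    by rewrite sumr_const card_ord -mulrA mulr_natl.
  apply: ler_sum => i _.
  have := close1 i i; rewrite !setIid => /ltW; rewrite ler_norml => /andP[_ h].
  have fd : fresh i `&` dup i = set0.
    by apply/seteqP; split=> // x [[_ Hi] [j [ji [_ Bj]]]]; have := Hi j ji Bj.
  have : rmu mu (B i) <= rmu mu (fresh i) + rmu mu (dup i).
    rewrite -rmuU//; apply: rmu_le => //; first exact: measurableU.
    move=> x Bx; have [[j [ji Bj]]|nj] := pselect (exists j : 'I_k.+1, (j < i)%N /\ B j x).
      by right; exists j.
    by left; split=> // j ji Bj; apply: nj; exists j.
  have := dup_le i; lra.
pose C i := if i == ord0 then fresh i `|` L else fresh i.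
have mC i : measurable (C i) by rewrite /C; case: ifP => // _; exact: measurableU.
pose W := L `|` [set x | exists i, dup i x].
have mD : measurable [set x | exists i, dup i x] by exact: (@measurable_ex _ X 'I_k.+1).
have mW : measurable W by exact: measurableU.
have W_le : rmu mu W <= (K * (1 + K) + K * K) * eps.
  apply: le_trans (rmuU_le mu mL mD) _; rewrite mulrDl; apply: lerD => //.
  by rewrite -mulrA; exact: rmu_ex_le.
have CB x i : ~ W x -> C i x <-> B i x.
  move=> /not_orP[nL nD].
  have fB : fresh i x <-> B i x.
    split=> [[]//|Bx]; split=> // j ji Bj; apply: nD; exists i, j.
    by split.
  by rewrite -fB /C; case: ifP => // _; split=> [[]//|]; left.
exists C.
  split=> //.
  - move=> i j _ _ [x [Ci Cj]].
    have H l : C l x -> fresh l x \/ (l = ord0 /\ L x).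
      by rewrite /C; case: eqP => [->|_]; [case; [left|right]|left].
    have [fi|[i0 Li]] := H _ Ci; have [fj|[j0 Lj]] := H _ Cj.
    + by apply: tfresh => //; exists x.
    + by exfalso; apply: Lj; exists i.
    + by exfalso; apply: Li; exists j.
    + by rewrite i0 j0.
  - apply/seteqP; split=> // x _.
    have [[i fi]|nf] := pselect (exists i, fresh i x).
      by exists i => //; rewrite /C; case: ifP => // _; left.
    by exists ord0 => //; rewrite /C eqxx; right.
move=> p i j.
have gp : g p \in 1%g :: [seq g q | q <- iota 0 n].
  by rewrite inE (map_f g) ?orbT// mem_iota add0n ltn_ord.
have mbW : measurable (b (g p) @` W) by exact: measurable_act_image.
have bW : rmu mu (b (g p) @` W) = rmu mu W.
  by rewrite /rmu act_image act_preserving.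
have dBC : `|ov b (g p) (B i) (B j) - ov b (g p) (C i) (C j)| <= rmu mu W + rmu mu W.
  rewrite -{1}bW; apply: le_trans (rmuU_le mu mbW mW).
  apply: rmu_diff; [exact: measurable_overlap..|exact: measurableU|].
  move=> x /not_orP[nbW nW]; rewrite act_image in nbW.
  rewrite !act_image; split=> -[h1 h2]; split; first exact/(CB _ _ nbW).
  - exact/(CB _ _ nW).
  - exact/(CB _ _ nbW).
  - exact/(CB _ _ nW).
have dAB := close (g p) i j gp.
apply: le_lt_trans (ler_distD (ov b (g p) (B i) (B j)) _ _) _.
apply: lt_le_trans (ltr_leD dAB dBC) _.
have e2 : c * eps = e / 2 by rewrite /eps; field; rewrite gt_eqF.
rewrite /c in e2; nra.
Qed.

Lemma weakly_equivalent_hausdorff0 n k a b : weakly_equivalent a b ->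
  hausdorff_dist (overlap_closure g (n := n) (k := k.+1) a)
                 (overlap_closure g (n := n) (k := k.+1) b) = 0%E.
Proof.
move=> [ab ba]; apply/eqP; rewrite eq_le hausdorff_dist_ge0 andbT.
apply/lee_addgt0Pr => e e0; rewrite add0e [e]splitr.
by apply: overlap_closure_le => [|A mA|A mA];
  [rewrite divr_gt0|apply: weakly_contained_partition => //; rewrite divr_gt0..].
Qed.

Lemma weakly_equivalent_dist0 a b : weakly_equivalent a b -> weak_dist g a b = 0%E.
Proof.
move=> ab; apply: eseries0 => n _ _; apply: eseries0 => k _ _.
by rewrite weakly_equivalent_hausdorff0// mule0.
Qed.

Lemma weak_dist_le a b (eta : nat -> R) :
  (forall n k, (hausdorff_dist (overlap_closure g (n := n.+1) (k := k.+1) a)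
     (overlap_closure g (n := n.+1) (k := k.+1) b) <= (eta n)%:E)%E) ->
  (weak_dist g a b <= \sum_(n <oo) (eta n / (2 ^ n.+1)%:R)%:E)%E.
Proof.
move=> H.
have eta0 n : 0 <= eta n.
  by rewrite -lee_fin; apply: le_trans (hausdorff_dist_ge0 _ _) (H n 0%N).
apply: lee_nneseries => [n _ _|n _].
  by apply: nneseries_ge0 => k _ _; rewrite mule_ge0 ?hausdorff_dist_ge0// lee_fin.
apply: (@le_trans _ _ (\sum_(k <oo) (eta n / (2 ^ n.+1)%:R / (2 ^ k.+1)%:R)%:E)%E).
  apply: lee_nneseries => [k _ _|k _].
    by rewrite mule_ge0 ?hausdorff_dist_ge0// lee_fin.
  apply: (@le_trans _ _ ((2 ^- (n.+1 + k.+1))%:E * (eta n)%:E)%E).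
    by apply: lee_pmul => //; rewrite ?lee_fin// ?hausdorff_dist_ge0.
  by rewrite -EFinM lee_fin exprD invfM !natrX mulrC mulrA.
by apply: epsilon_trick0; rewrite divr_ge0.
Qed.

(** The first [N] terms of the outer series are small by assumption, and the
    others by the weights, as no Hausdorff distance exceeds [4]. *)
Lemma weak_dist_small a b (N : nat) (e : R) : 0 < e ->
  (forall p, (p <= N)%N -> exists E, [/\ measurable E, rmu mu E < e &
     forall x, ~ E x -> b (g p)^-1%g x = a (g p)^-1%g x]) ->
  (weak_dist g a b <= (e + e + 4 / 2 ^+ N)%:E)%E.
Proof.
move=> e0 H.
pose eta n : R := (e + e) + (if (n < N)%N then 0 else 4).
have ee0 : 0 <= e + e by rewrite addr_ge0 ?ltW.
apply: (le_trans (@weak_dist_le _ _ eta _)).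
  move=> n k; rewrite /eta; case: ifP => [nN|_].
    rewrite addr0; apply: overlap_closure_close => // p; apply: H.
    exact: leq_trans (ltnW (ltn_ord p)) nN.
  by apply: (le_trans (overlap_closure_le4 _ _ _ _)); rewrite lee_fin lerDr.
pose tail n : \bar R := ((if (n < N)%N then 0 else 4) / (2 ^ n.+1)%:R)%:E.
have tail0 n : (0 <= tail n)%E.
  by rewrite lee_fin divr_ge0//; case: ifP.
rewrite (eq_eseriesr (g := fun n => ((e + e) / (2 ^ n.+1)%:R)%:E + tail n)%E); last first.
  by move=> n _; rewrite -EFinD -mulrDl.
rewrite nneseriesD//; last by move=> n _ _; rewrite lee_fin divr_ge0.
rewrite [leRHS]EFinD; apply: leeD; first exact: epsilon_trick0.
rewrite (nneseries_split 0 N)//= add0n big1_seq ?add0e; last first.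
  move=> i /andP[_]; rewrite mem_index_iota => /andP[_ iN].
  by rewrite /tail iN mul0r.
rewrite -nneseries_addn//.
apply: le_trans (epsilon_trick0 xpredT (_ : 0 <= 4 / 2 ^+ N :> R));
  last by rewrite divr_ge0// exprn_ge0.
apply: lee_nneseries => // i _.
rewrite /tail ltnNge leq_addl /= lee_fin -addSn expnD natrM invfM !natrX.
by rewrite -[leRHS]mulrA [_ * 2 ^- i.+1]mulrC.
Qed.

End WeakDistanceBounds.

(** * Density *)

(** The constant is the length of a word for [h]: the two actions of [h] agree at
    every point whose trajectory along the word avoids [E]. *)
Lemma agreement_spreads (R : realType) d (X : measurableType d)
    (mu : probability X R) (I : Type) (F : groupType) (x : I -> F) h :
  free_basis x -> exists l : nat, forall (a b : mp_action F mu) E,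
    measurable E -> (forall y, ~ E y -> forall i, b (x i) y = a (x i) y) ->
    exists E', [/\ measurable E', rmu mu E' <= l%:R * rmu mu E &
      forall y, ~ E' y -> b h y = a h y].
Proof.
move=> xF; move: h.
have mpre (a : mp_action F mu) h E : measurable E -> measurable (a h @^-1` E).
  by move=> mE; apply: measurable_preimage => //; exact: measurable_act.
have rpre (a : mp_action F mu) h E : measurable E -> rmu mu (a h @^-1` E) = rmu mu E.
  by move=> mE; rewrite /rmu act_preserving.
apply: (free_basis_ind xF).
- exists 0%N => a b E mE _; exists set0; split=> //.
    by rewrite mul0r /rmu measure0.
  by move=> y _; rewrite !act1.
- move=> h k [l Hh] [m Hk]; exists (l + m)%N => a b E mE ab.
  have [Eh [mEh lEh abh]] := Hh a b E mE ab; have [Ek [mEk lEk abk]] := Hk a b E mE ab.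
  have mhk : measurable (a k @^-1` Eh) by exact: mpre.
  exists (a k @^-1` Eh `|` Ek); split; first exact: measurableU.
    apply: le_trans (rmuU_le mu mhk mEk) _.
    by rewrite rpre// natrD mulrDl lerD.
  by move=> y /not_orP[nh nk]; rewrite !actM abk// abh.
- move=> h [l Hh]; exists l => a b E mE ab; have [E' [mE' lE' abh]] := Hh a b E mE ab.
  exists (a h^-1%g @^-1` E'); split; [exact: mpre|by rewrite rpre|].
  move=> y /= /abh; rewrite -[X in _ = X]actM mulgV act1 => bh.
  by rewrite -{1}bh -actM mulVg act1.
- move=> i; exists 1%N => a b E mE ab; exists E; split=> //; first by rewrite mul1r.
  by move=> y /ab.
Qed.

Section QuotientDistance.
Context {G : groupType} {R : realType} {d} {X : measurableType d}
  {mu : probability X R} (g : nat -> G).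

(** Weakly equivalent actions are at distance zero, so the choice of the
    representatives is immaterial. *)
Lemma weak_dist_repr (a b : mp_action G mu) :
  (weak_dist g (repr (weak_class g a)) (repr (weak_class g b)) <= weak_dist g a b)%E.
Proof.
have E (c : mp_action G mu) : weak_dist g (repr (weak_class g c)) c = 0%E.
  apply: weakly_equivalent_dist0; apply/asboolP.
  have : (\pi_(weak_space mu g) (repr (weak_class g c)) = \pi_(weak_space mu g) c)%qT.
    exact: reprK.
  by move/eqquotP.
apply: le_trans (weak_dist_triangle g a _ _) _; rewrite E add0e.
by apply: le_trans (weak_dist_triangle g b _ _) _;
  rewrite [X in (_ + X)%E]weak_dist_sym E adde0.
Qed.

End QuotientDistance.

Theorem theorem1p4 (R : realType) (d : measure_display) (X : measurableType d)
    (mu : probability X R) (I : Type) (F : groupType) (x : I -> F)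
    (g : nat -> F) :
  standard_probability mu ->
  [set: I] !=set0 -> countable [set: I] -> free_basis x ->
  enumeration g ->
  dense [set c : set_type (free_classes mu g) |
          free_ergodic_classes mu g (set_val c)].
Proof.
move=> sm [i0 _] _ xF [g_surj _] O [c Oc] [W oW WO].
have [a a_free ac] := set_valP c.
have : nbhs (weak_class g a) W.
  by rewrite ac; apply: open_nbhs_nbhs; split=> //; move: Oc; rewrite -WO.
move=> /nbhs_ballP[e /= e0 eW].
pose e1 := e / 4.
have e10 : 0 < e1 by rewrite divr_gt0.
have [N N4] : exists N : nat, 4 / 2 ^+ N < e / 2 :> R.
  exists (Num.truncn (8 / e)).+1.
  have := truncnS_gt (8 / e); set N := (Num.truncn _).+1 => eN.
  have N2 : N%:R < 2 ^+ N :> R by rewrite -natrX ltr_nat ltn_expl.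
  rewrite ltr_pdivrMr ?exprn_gt0//.
  by move: (lt_trans eN N2); rewrite ltr_pdivrMr// mulrC; lra.
have /choice[l Hl] := fun p => @agreement_spreads R d X mu I F x (g p)^-1%g xF.
pose L := (\max_(p < N.+1) l p)%N.
have [n n0 Ln] : exists2 n : nat, (0 < n)%N & L%:R / n%:R < e1 :> R.
  exists (Num.truncn (L%:R / e1)).+1 => //.
  by rewrite ltr_pdivrMr ?ltr0n// mulrC -ltr_pdivrMr// truncnS_gt.
have [b [b_free b_erg [E [mE nE abE]]]] := @free_ergodic_perturbation R d X mu I F x i0 g a
  n sm xF g_surj a_free n0.
have bf : free_classes mu g (weak_class g b) by exists b.
exists (SigSub (mem_set bf)); split; last by exists b.
rewrite -WO; apply: eW.
apply: le_lt_trans (weak_dist_repr _ _ _) _.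
apply: le_lt_trans (weak_dist_small (N := N) e10 _) _.
  move=> p pN; have [E' [mE' lE' abE']] := Hl p a b E mE abE.
  exists E'; split=> //; apply: le_lt_trans lE' (le_lt_trans _ Ln).
  have n0' : 0 < n%:R :> R by rewrite ltr0n.
  rewrite ler_pdivlMr// -mulrA [_ * n%:R]mulrC.
  move: nE; rewrite rmuE// -EFinM lee_fin => nE.
  apply: (@le_trans _ _ ((l p)%:R)); first exact: ler_piMr.
  by rewrite ler_nat -(inordK (pN : p < N.+1)%N);
    exact: (leq_bigmax (F := fun q : 'I_N.+1 => l q)).
by rewrite lte_fin /e1; lra.
Qed.
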